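(* Let $C$ be a cusp in $(\mathbb{C}^2,0)$ with Puiseux pair $(m,n)$, let $E$ be its cuspidal divisor, let $\mathcal{B}=(\lambda_{-1},\lambda_0,\lambda_1,\ldots,\lambda_s)$ be the basis of $\Lambda_C$ and let $(\omega_{-1},\omega_0,\omega_1,\ldots,\omega_s)$ be a minimal standard basis for $C$. Let $\mathcal{F}$ be a totally $E$-dicritical foliation with $C$ as invariant curve and assume that $\mathcal{F}$ satisfies the $\ell$-transversality property for some $\ell\in\{1,2,\ldots,s\}$. Let $\widetilde{C}\in\operatorname{Curv}_E(\mathcal{F})$ and let $\mathcal{B}_{\widetilde{C}}=(\lambda_{-1}^{\widetilde{C}},\lambda_0^{\widetilde{C}},\lambda_1^{\widetilde{C}},\ldots,\lambda_{\tilde{s}}^{\widetilde{C}})$ be the basis of the semimodule $\Lambda_{\widetilde{C}}$. Then $\tilde{s}\geq \ell$ and $$\lambda_j^{\widetilde{C}}=\lambda_j\qquad\text{for } j=-1,0,1,\ldots,\ell.$$ In particular, $\Lambda_j^{\widetilde{C}}=\Lambda_j$ for $j=-1,0,1,\ldots,\ell$, and there is a minimal standard basis for the curve $\widetilde{C}$ of the form $$(\omega_{-1},\omega_0,\omega_1,\ldots,\omega_\ell,\omega_{\ell+1}^{\widetilde{C}},\ldots,\omega_{\tilde{s}}^{\widetilde{C}}).$$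
   Context: All objects are holomorphic germs at $0\in\mathbb{C}^2$. A foliation $\mathcal{F}$ is defined by $\omega_{\mathcal F}=0$ with $\omega_{\mathcal F}=A\,dx+B\,dy$, $A,B\in\mathbb{C}\{x,y\}$, $\gcd(A,B)=1$. For an irreducible curve $C$ with primitive parametrization $\gamma(t)$: $\nu_C(h)=\operatorname{ord}_t h(\gamma(t))$ for a function $h$, and $\nu_C(\omega)=\operatorname{ord}_t(\alpha(t))+1$ for a 1-form $\omega$, where $\gamma^*\omega=\alpha(t)\,dt$ ($\nu_C(\omega)=\infty$ if $\gamma^*\omega=0$). $C$ is an invariant curve of $\mathcal F$ if $\gamma^*\omega_{\mathcal F}=0$. A cusp with Puiseux pair $(m,n)$ is an irreducible plane curve germ with only one Puiseux pair $(m,n)$, $2\le n<m$, $\gcd(n,m)=1$. Its semigroup is $\Gamma_C=\{\nu_C(h)\}=\langle n,m\rangle$; $\Lambda_C$ is the set of (finite) differential values $\nu_C(\omega)$ of 1-forms $\omega\in\Omega^1_{(\mathbb{C}^2,0)}$. One has $\Lambda_C+\Gamma_C\subset\Lambda_C$. The basis of $\Lambda_C$ is the unique strictly increasing sequence $(\lambda_{-1},\lambda_0,\ldots,\lambda_s)$, $s$ minimal, with $\Lambda_C=\bigcup_{i=-1}^s(\lambda_i+\Gamma_C)$ ($\lambda_{-1}=n$, $\lambda_0=m$). Put $\Lambda_j=\bigcup_{k=-1}^j(\lambda_k+\Gamma_C)$, and $\Lambda_j^{\widetilde C}$ the analogous semimodule for a cusp $\widetilde C$ defined with the basis of $\Lambda_{\widetilde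 C}$. A minimal standard basis for $C$ is a list of 1-forms $(\omega_{-1},\ldots,\omega_s)$ with $\nu_C(\omega_i)=\lambda_i$ for all $i$; $\mathcal{G}_i$ is the foliation defined by $\omega_i=0$. Let $\pi:M\to(\mathbb{C}^2,0)$ be the minimal reduction of singularities of $C$, $D=\pi^{-1}(0)$, and let the cuspidal divisor $E$ be the irreducible component of $D$ met by the strict transform of $C$. A foliation $\mathcal{F}$ is totally $E$-dicritical if its strict transform $\pi^*\mathcal{F}$ is transversal to $E$ and has normal crossings with $D$ at each point of $E$. Then for every point $P\in E$ that is not a singular point of $D$ there is an invariant curve $C_P$ of $\mathcal F$ whose strict transform is nonsingular and transversal to $E$ at $P$; $\operatorname{Curv}_E(\mathcal F)$ (also written $\operatorname{Cusp}_E(\mathcal F)$) is the set of these curves $C_P$; they are cusps with Puiseux pair $(m,n)$. The jacobian curve $\mathcal{J}_{\mathcal{F},\mathcal{G}}$ of two foliations is the curve $J_{\mathcal F,\mathcal G}=0$, where $\omega_{\mathcal F}\wedge\omega_{\mathcal G}=J_{\mathcal F,\mathcal G}\,dx\wedge dy$. $\mathcal F$ and $\mathcal G$ have the $E$-transversality property if the strict transform of $\mathcal{J}_{\mathcal{F},\mathcal{G}}$ by $\pi$ does not intersect $E$. $\mathcal F$ satisfies the $\ell$-transversality property if $\mathcal F$ and $\mathcal G_\ell$ have the $E$-transversality property. *)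

(* Defs.v *)
From HB Require Import structures.
From mathcomp Require Import all_boot all_order all_algebra.
From mathcomp Require Import complex.
From mathcomp Require Import classical_sets reals.

Set Implicit Arguments.
Unset Strict Implicit.
Unset Printing Implicit Defensive.

Import Order.TTheory GRing.Theory Num.Theory.

Local Open Scope ring_scope.
Local Open Scope classical_set_scope.

(** The field of complex numbers is [R[i]] for [R : realType].  A germ of
    holomorphic function at the origin is its Taylor series, i.e. a coefficient
    function subject to [convergent1] or [convergent2]. *)

Definition ser1 (R : realType) := nat -> R[i].
Definition ser2 (R : realType) := nat -> nat -> R[i].

Definition convergent1 (R : realType) (p : ser1 R) : Prop :=
  exists r K : R[i], 0 < r /\ forall k, `|p k| * r ^+ k <= K.

Definition convergent2 (R : realType) (h : ser2 R) : Prop :=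
  exists r K : R[i], 0 < r /\ forall i j, `|h i j| * r ^+ (i + j) <= K.

Definition one1 (R : realType) : ser1 R := fun k => (k == 0%N)%:R.

Definition mul1 (R : realType) (p q : ser1 R) : ser1 R :=
  fun k => \sum_(a < k.+1) p a * q (k - a)%N.

Definition pow1 (R : realType) (p : ser1 R) (n : nat) : ser1 R :=
  iter n (mul1 p) (@one1 R).

Definition add1 (R : realType) (p q : ser1 R) : ser1 R := fun k => p k + q k.

Definition deriv1 (R : realType) (p : ser1 R) : ser1 R :=
  fun k => p k.+1 *+ k.+1.

(** [ord1 p k]: the order of [p] is the natural number [k]; no [k] satisfies
    this when [p = 0], whose order is infinite. *)
Definition ord1 (R : realType) (p : ser1 R) (k : nat) : Prop :=
  p k != 0 /\ forall i, (i < k)%N -> p i = 0.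

(** The monomial u^a v^b. *)
Definition mon2 (R : realType) (a b : nat) : ser2 R :=
  fun i j => ((i == a) && (j == b))%:R.

Definition zero2 (R : realType) : ser2 R := fun _ _ => 0.
Definition add2 (R : realType) (p q : ser2 R) : ser2 R :=
  fun i j => p i j + q i j.
Definition sub2 (R : realType) (p q : ser2 R) : ser2 R :=
  fun i j => p i j - q i j.
Definition scale2 (R : realType) (c : R[i]) (p : ser2 R) : ser2 R :=
  fun i j => c * p i j.

Definition mul2 (R : realType) (p q : ser2 R) : ser2 R :=
  fun i j => \sum_(a < i.+1) \sum_(b < j.+1) p a b * q (i - a)%N (j - b)%N.

Definition pow2 (R : realType) (p : ser2 R) (n : nat) : ser2 R :=
  iter n (mul2 p) (mon2 R 0 0).

Definition deriv2u (R : realType) (p : ser2 R) : ser2 R :=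
  fun i j => p i.+1 j *+ i.+1.
Definition deriv2v (R : realType) (p : ser2 R) : ser2 R :=
  fun i j => p i j.+1 *+ j.+1.

Definition dvd2 (R : realType) (p q : ser2 R) : Prop :=
  exists2 k, convergent2 k & q = mul2 k p.

(** Substitutions.  The sums are truncated where the omitted terms vanish,
    which is correct only when the inner series have zero constant term; this
    is the only case in which they are used. *)

Definition comp11 (R : realType) (p tau : ser1 R) : ser1 R :=
  fun k => \sum_(i < k.+1) p i * pow1 tau i k.

Definition comp21 (R : realType) (h : ser2 R) (g : ser1 R * ser1 R) : ser1 R :=
  fun k => \sum_(i < k.+1) \sum_(j < k.+1)
             h i j * mul1 (pow1 g.1 i) (pow1 g.2 j) k.

Definition comp22 (R : realType) (h : ser2 R) (F : ser2 R * ser2 R) : ser2 R :=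
  fun k l => \sum_(i < (k + l).+1) \sum_(j < (k + l).+1)
               h i j * mul2 (pow2 F.1 i) (pow2 F.2 j) k l.

Definition comp_map (R : realType) (F G : ser2 R * ser2 R) :
    ser2 R * ser2 R :=
  (comp22 F.1 G, comp22 F.2 G).

Definition comp_arc (R : realType) (F : ser2 R * ser2 R)
    (g : ser1 R * ser1 R) : ser1 R * ser1 R :=
  (comp21 F.1 g, comp21 F.2 g).

Definition local_coordinates (R : realType) (f g : ser2 R) : Prop :=
  [/\ convergent2 f, convergent2 g, f 0%N 0%N = 0, g 0%N 0%N = 0
    & f 1%N 0%N * g 0%N 1%N - f 0%N 1%N * g 1%N 0%N != 0].

(** The pair [(A, B)] is the 1-form A du + B dv. *)
Definition oneform (R : realType) := (ser2 R * ser2 R)%type.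

Definition convergent_form (R : realType) (w : oneform R) : Prop :=
  convergent2 w.1 /\ convergent2 w.2.

Definition zero_form (R : realType) : oneform R := (zero2 R, zero2 R).

Definition differential (R : realType) (f : ser2 R) : oneform R :=
  (deriv2u f, deriv2v f).

(** The coefficient of du /\ dv in the exterior product of two 1-forms. *)
Definition wedge (R : realType) (w e : oneform R) : ser2 R :=
  sub2 (mul2 w.1 e.2) (mul2 w.2 e.1).

Definition pullback_map (R : realType) (F : ser2 R * ser2 R) (w : oneform R) :
    oneform R :=
  (add2 (mul2 (comp22 w.1 F) (deriv2u F.1))
        (mul2 (comp22 w.2 F) (deriv2u F.2)),
   add2 (mul2 (comp22 w.1 F) (deriv2v F.1))
        (mul2 (comp22 w.2 F) (deriv2v F.2))).

(** The series alpha such that the pull-back of [w] by [g] is alpha(t) dt. *)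
Definition pullback_arc (R : realType) (g : ser1 R * ser1 R) (w : oneform R) :
    ser1 R :=
  add1 (mul1 (comp21 w.1 g) (deriv1 g.1)) (mul1 (comp21 w.2 g) (deriv1 g.2)).

(** A foliation is given by a 1-form without common factor in its
    coefficients; common divisors are then the units of C{u,v}. *)
Definition foliation (R : realType) (w : oneform R) : Prop :=
  convergent_form w /\
  forall h : ser2 R, convergent2 h -> dvd2 h w.1 -> dvd2 h w.2 ->
    h 0%N 0%N != 0.

(** [e] is a generator without common factors of the foliation [w = 0], where
    the coefficients of [w] may have a common factor. *)
Definition foliation_of (R : realType) (w e : oneform R) : Prop :=
  foliation e /\
  exists h : ser2 R,
    [/\ convergent2 h, h <> zero2 R & w = (mul2 h e.1, mul2 h e.2)].

Definition arc_germ (R : realType) (g : ser1 R * ser1 R) : Prop :=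
  [/\ convergent1 g.1, convergent1 g.2, g.1 0%N = 0 & g.2 0%N = 0].

(** An irreducible curve germ is handled through a primitive parametrization,
    i.e. one that does not factor through a non-invertible change of
    parameter (this excludes the zero arc). *)
Definition branch (R : realType) (g : ser1 R * ser1 R) : Prop :=
  arc_germ g /\
  forall (d : ser1 R * ser1 R) (tau : ser1 R),
    convergent1 d.1 -> convergent1 d.2 -> convergent1 tau -> tau 0%N = 0 ->
    g = (comp11 d.1 tau, comp11 d.2 tau) -> tau 1%N != 0.

Definition nonsingular_arc (R : realType) (g : ser1 R * ser1 R) : Prop :=
  g.1 1%N != 0 \/ g.2 1%N != 0.

(** Up to exchanging the coordinates and reparametrizing, the curve is
    (t^n, sum_i a_i t^i) where [m] is the least exponent with non-zero
    coefficient which is not divisible by [n].  As [n < m] and a_0 = 0, the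
    exponents below [m] are positive multiples of [n], so that [n] is the
    multiplicity; as [n] and [m] are coprime, there is no further pair. *)
Definition puiseux_cusp (R : realType) (m n : nat) (g : ser1 R * ser1 R) :
    Prop :=
  [/\ (2 <= n)%N, (n < m)%N, coprime n m, branch g &
    exists (swap : bool) (tau : ser1 R),
      let g' := if swap then (g.2, g.1) else g in
      let x := comp11 g'.1 tau in
      let y := comp11 g'.2 tau in
      [/\ convergent1 tau, tau 0%N = 0, tau 1%N != 0,
          forall k, x k = (k == n)%:R
        & y m != 0 /\ forall i, (i < m)%N -> y i != 0 -> (n %| i)%N]].

Definition invariant_curve (R : realType) (w : oneform R)
    (g : ser1 R * ser1 R) : Prop :=
  forall k, pullback_arc g w k = 0.

Definition nu_fun (R : realType) (g : ser1 R * ser1 R) (h : ser2 R)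
    (k : nat) : Prop :=
  ord1 (comp21 h g) k.

(** Differential value [k] is the order of alpha plus one, hence [k > 0]. *)
Definition nu_form (R : realType) (g : ser1 R * ser1 R) (w : oneform R)
    (k : nat) : Prop :=
  exists2 o, ord1 (pullback_arc g w) o & k = o.+1.

Definition Gamma (R : realType) (g : ser1 R * ser1 R) : set nat :=
  [set k | exists2 h : ser2 R, convergent2 h & nu_fun g h k].

Definition Lambda (R : realType) (g : ser1 R * ser1 R) : set nat :=
  [set k | exists2 w : oneform R, convergent_form w & nu_form g w k].

(** A sequence (lambda_{-1}, lambda_0, ..., lambda_s) is a list [b] of length
    [s + 2]; the index is shifted by one: lambda_j is [nth 0 b (j + 1)], and
    likewise for the lists of 1-forms.  [Lambda_upto g b i] is the union of the
    lambda + Gamma over the entries lambda of [b] in positions 0, ..., i. *)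
Definition Lambda_upto (R : realType) (g : ser1 R * ser1 R) (b : seq nat)
    (i : nat) : set nat :=
  [set p | exists k q, [/\ (k <= i)%N, (k < size b)%N, Gamma g q
                         & p = (nth 0%N b k + q)%N]].

Definition generates_Lambda (R : realType) (g : ser1 R * ser1 R)
    (b : seq nat) : Prop :=
  sorted ltn b /\ Lambda g = Lambda_upto g b (size b).

Definition Lambda_basis (R : realType) (g : ser1 R * ser1 R) (b : seq nat) :
    Prop :=
  generates_Lambda g b /\
  forall b' : seq nat, generates_Lambda g b' -> (size b <= size b')%N.

Definition minimal_standard_basis (R : realType) (g : ser1 R * ser1 R)
    (b : seq nat) (ws : seq (oneform R)) : Prop :=
  size ws = size b /\
  forall i, (i < size b)%N ->
    convergent_form (nth (zero_form R) ws i) /\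
    nu_form g (nth (zero_form R) ws i) (nth 0%N b i).

(** Blowing-up.  [Some c] is the direction of slope [c], [None] the vertical
    one; together they are the points of the exceptional divisor of the
    blowing-up of a point.  A list of directions is an infinitely near point of
    the origin: each direction is a point of the exceptional divisor of the
    blowing-up of the point given by the preceding ones.  Each such point
    comes with coordinates (u, v) centred at it. *)
Definition direction (R : realType) := option R[i].

(** The blowing-up in the coordinates at a point of its exceptional divisor:
    (u, v) |-> (u, u (v + c)), and (u, v) |-> (u v, v) at the vertical
    direction. *)
Definition blowup_chart (R : realType) (d : direction R) : ser2 R * ser2 R :=
  if d is Some c then (mon2 R 1 0, add2 (mon2 R 1 1) (scale2 c (mon2 R 1 0)))
  else (mon2 R 1 1, mon2 R 0 1).

(** The composition of the blowing-ups, in the coordinates at [P]. *)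
Definition blowup_map (R : realType) (P : seq (direction R)) :
    ser2 R * ser2 R :=
  foldr (fun d F => comp_map (blowup_chart d) F) (mon2 R 1 0, mon2 R 0 1) P.

(** In the coordinates at [P], the total exceptional divisor D is contained in
    uv = 0.  The two booleans tell whether u = 0, respectively v = 0, is a
    component of D.  At the direction [Some c] the new component is u = 0, and
    the strict transform of v = 0 passes through the point only if c = 0; at
    [None] the new component is v = 0 and u = 0 is the strict transform of
    u = 0. *)
Definition divisor (R : realType) (P : seq (direction R)) : bool * bool :=
  foldl (fun D d => if d is Some c then (true, D.2 && (c == 0))
                    else (D.1, true)) (false, false) P.

(** Reduced equation of D at [P]. *)
Definition divisor_eq (R : realType) (P : seq (direction R)) : ser2 R :=
  mon2 R (divisor P).1 (divisor P).2.

Definition corner (R : realType) (P : seq (direction R)) : bool :=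
  (divisor P).1 && (divisor P).2.

(** Equation, at its point [d], of the last exceptional divisor. *)
Definition last_divisor_eq (R : realType) (d : direction R) : ser2 R :=
  if d is Some _ then mon2 R 1 0 else mon2 R 0 1.

(** [g'] parametrizes the strict transform of the curve [g] at [P]; there is
    one exactly when the strict transform passes through [P]. *)
Definition strict_arc (R : realType) (P : seq (direction R))
    (g g' : ser1 R * ser1 R) : Prop :=
  arc_germ g' /\ g = comp_arc (blowup_map P) g'.

(** The total transform of the curve has normal crossings at the point [P] of
    the strict transform: it is contained in xy = 0 for some coordinates
    (x, y), the strict transform being x = 0. *)
Definition curve_normal_crossings (R : realType) (g : ser1 R * ser1 R)
    (P : seq (direction R)) : Prop :=
  exists (g' : ser1 R * ser1 R) (x y : ser2 R),
    [/\ strict_arc P g g', nonsingular_arc g', local_coordinates x y,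
        forall k, comp21 x g' k = 0 & dvd2 (divisor_eq P) y].

(** The minimal reduction of singularities blows up the successive points of
    the strict transform as long as the total transform has no normal
    crossings there.  Its last centre is [Q]; the cuspidal divisor E is the
    exceptional divisor of the blowing-up of [Q], and the points of E are the
    [rcons Q d]. *)
Definition cuspidal_divisor (R : realType) (g : ser1 R * ser1 R)
    (Q : seq (direction R)) : Prop :=
  (exists d, curve_normal_crossings g (rcons Q d)) /\
  forall k, (k <= size Q)%N -> ~ curve_normal_crossings g (take k Q).

Definition strict_foliation (R : realType) (P : seq (direction R))
    (w e : oneform R) : Prop :=
  foliation_of (pullback_map (blowup_map P) w) e.

(** There are coordinates (x, y) in which the foliation is dx = 0 and the
    divisor D is contained in xy = 0. *)
Definition foliation_normal_crossings (R : realType)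
    (P : seq (direction R)) (e : oneform R) : Prop :=
  exists x y : ser2 R,
    [/\ local_coordinates x y, wedge e (differential x) = zero2 R
      & dvd2 (divisor_eq P) (mul2 x y)].

Definition totally_dicritical (R : realType) (Q : seq (direction R))
    (w : oneform R) : Prop :=
  forall d : direction R, exists e : oneform R,
    [/\ strict_foliation (rcons Q d) w e,
        wedge e (differential (last_divisor_eq d)) 0%N 0%N != 0
      & foliation_normal_crossings (rcons Q d) e].

(** [g] is the curve C_P for some point P of E that is not a corner. *)
Definition Curv (R : realType) (Q : seq (direction R)) (w : oneform R)
    (g : ser1 R * ser1 R) : Prop :=
  [/\ branch g, invariant_curve w g &
    exists (d : direction R) (g' : ser1 R * ser1 R),
      [/\ ~~ corner (rcons Q d), strict_arc (rcons Q d) g g',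
          nonsingular_arc g' & comp21 (last_divisor_eq d) g' 1%N != 0]].

(** [h'] is an equation at [P] of the strict transform of the curve [h = 0]:
    all the components of D, and only them, are removed from the total
    transform.  There is none if h = 0 and P is not the origin. *)
Definition strict_equation (R : realType) (P : seq (direction R))
    (h h' : ser2 R) : Prop :=
  convergent2 h' /\
  exists a b : nat,
    [/\ comp22 h (blowup_map P) = mul2 (mon2 R a b) h',
        if (divisor P).1 then ~ dvd2 (mon2 R 1 0) h' else a = 0%N
      & if (divisor P).2 then ~ dvd2 (mon2 R 0 1) h' else b = 0%N].

Definition jacobian (R : realType) (w e : oneform R) : ser2 R := wedge w e.

Definition E_transversality (R : realType) (Q : seq (direction R))
    (w e : oneform R) : Prop :=
  forall d : direction R, exists2 h' : ser2 R,
    strict_equation (rcons Q d) (jacobian w e) h' & h' 0%N 0%N != 0.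

Definition l_transversality (R : realType) (Q : seq (direction R))
    (ws : seq (oneform R)) (w : oneform R) (l : nat) : Prop :=
  exists2 e : oneform R, foliation_of (nth (zero_form R) ws l.+1) e
                    & E_transversality Q w e.

(* Main.v *)
Require Import Defs.
From HB Require Import structures.
From mathcomp Require Import all_boot all_order all_algebra.
From mathcomp Require Import complex.
From mathcomp Require Import boolp.
From mathcomp Require Import classical_sets reals.
From mathcomp Require Import zify ring.

(** The proof compares [C] with another leaf [Ct] through the point [Q] whose
    blowing-up creates E.

    Geometry.  The Euclidean algorithm along the infinitely near points of [C]
    ([near_step], [cusp_coordinates_exist]) gives coordinates [f1], [f2] at the
    origin whose pull-backs at [Q] are, up to units, monomials in (u, v) of
    total degrees n and m.  At [Q] the leaves become smooth arcs transversal to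
    both axes, hence a monomial in [f1] and [f2] has the same order on every
    leaf, which is also the multiplicity at [Q] of its pull-back
    ([arc_monf], [arc_Gamma]).

    For a 1-form x let K(x) be the wedge product at [Q] of the pull-backs of
    [wF] and x, and let (A, B) be the coefficients of the pull-back of [wF].
    Along a leaf the tangent is proportional to (B, - A), so that
    ord B + nu(x) = ord K(x) + 1 ([leaf_kfun]).  Dicriticity makes A a multiple
    of B at the points of E, hence B divides K(x); since the zeros of K(x), for
    the form x of value lambda_l, lie in the divisor near the points of E other
    than corners, B has the same order on all leaves, namely its multiplicity
    at [Q] ([dicritical_sharp]).
    Thus nu(x) is bounded below by a number which does not depend on the leaf,
    namely the multiplicity of K(x) at [Q] up to a shift, and for the form of
    value p = lambda_l both leaves attain this bound.  (The form [w] of value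
    lambda_l and the generator [e] of its foliation differ by a unit, because
    lambda_l is not the sum of a smaller value and of an element of the
    semigroup.)

    Algebra.  It remains to see that the bound is attained on both leaves by
    every form for which it is smaller than p ([values_below_p]).  Standard
    bases of the module of forms are built as in the computation of the
    differential values of a cusp: the semimodule generated by the values found
    so far is a staircase in the plane of exponents (i, j) of the numbers
    i n + j m, whose holes beyond the last S-process lie below one corner;
    adding the next value below it creates two corners, and the S-process at the
    smaller one produces the next form ([next_corners], [step_stage]).  If some form of
    the process missed the bound on one of the leaves, then in the expansion of
    the form of value p all terms below p would have to vanish, and the term of
    level p would miss the bound as well, a contradiction ([comb_bad]).

    Hence the differential values of the two leaves agree up to lambda_l, and
    so do the bases, which are read off from the values ([basis_prefix]). *)

Set Implicit Arguments.
Unset Strict Implicit.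
Unset Printing Implicit Defensive.

Import Order.TTheory GRing.Theory Num.Theory.
Local Open Scope ring_scope.

(** * Rings of formal power series *)

(** A type of its own for sequences, as their product is the convolution and
    not the pointwise one. *)
Definition ps (A : Type) := nat -> A.

HB.instance Definition _ (A : Type) := gen_eqMixin (ps A).
HB.instance Definition _ (A : Type) := gen_choiceMixin (ps A).

Section SeriesZmodule.
Variable A : zmodType.
Definition ps_add (p q : ps A) : ps A := fun k => p k + q k.
Definition ps_opp (p : ps A) : ps A := fun k => - p k.
Definition ps_zero : ps A := fun=> 0.
Fact ps_addA : associative ps_add.
Proof. by move=> p q r; apply/funext => k; rewrite /ps_add addrA. Qed.
Fact ps_addC : commutative ps_add.
Proof. by move=> p q; apply/funext => k; rewrite /ps_add addrC. Qed.
Fact ps_add0 : left_id ps_zero ps_add.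
Proof. by move=> p; apply/funext => k; rewrite /ps_add add0r. Qed.
Fact ps_addN : left_inverse ps_zero ps_opp ps_add.
Proof. by move=> p; apply/funext => k; rewrite /ps_add addNr. Qed.
HB.instance Definition _ :=
  GRing.isZmodule.Build (ps A) ps_addA ps_addC ps_add0 ps_addN.

Lemma psDE (p q : ps A) k : (p + q) k = p k + q k. Proof. by []. Qed.
Lemma psNE (p : ps A) k : (- p) k = - p k. Proof. by []. Qed.
Lemma psBE (p q : ps A) k : (p - q) k = p k - q k. Proof. by []. Qed.
Lemma ps0E k : (0 : ps A) k = 0. Proof. by []. Qed.
Lemma ps_sumE I (r : seq I) (P : pred I) (F : I -> ps A) k :
  (\sum_(i <- r | P i) F i) k = \sum_(i <- r | P i) F i k.
Proof. exact: (big_morph (fun p : ps A => p k) (fun p q => psDE p q k) (ps0E k)). Qed.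
Lemma psMnE (p : ps A) n k : (p *+ n) k = p k *+ n.
Proof. by elim: n => // n IH; rewrite !mulrS psDE IH. Qed.
End SeriesZmodule.

Section SeriesRing.
Variable A : comNzRingType.
Definition ps_one : ps A := fun k => (k == 0%N)%:R.
Definition ps_mul (p q : ps A) : ps A :=
  fun k => \sum_(a < k.+1) p a * q (k - a)%N.
Let tr N (p : ps A) : {poly A} := \poly_(i < N) p i.
Let ps_mulE N (p q : ps A) k : (k < N)%N -> ps_mul p q k = (tr N p * tr N q)`_k.
Proof.
move=> kN; rewrite coefM; apply: eq_bigr => i _; rewrite !coef_poly.
by rewrite !ifT //; have := ltn_ord i; lia.
Qed.
Fact ps_mulC : commutative ps_mul.
Proof.
by move=> p q; apply/funext => k; rewrite !(@ps_mulE k.+1) // mulrC.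
Qed.
Fact ps_mulA : associative ps_mul.
Proof.
move=> p q r; apply/funext => k; rewrite !(@ps_mulE k.+1) //.
transitivity (tr k.+1 p * (tr k.+1 q * tr k.+1 r))`_k; last first.
  rewrite mulrA !coefM; apply: eq_bigr => i _; congr (_ * _).
  by rewrite coef_poly ltn_ord (@ps_mulE k.+1).
rewrite !coefM; apply: eq_bigr => i _; congr (_ * _).
have ik : (k - i < k.+1)%N by lia.
by rewrite coef_poly ik (@ps_mulE k.+1).
Qed.
Fact ps_mul1 : left_id ps_one ps_mul.
Proof.
move=> p; apply/funext => k; rewrite /ps_mul big_ord_recl /ps_one /= mul1r subn0.
by rewrite big1 ?addr0 // => i _; rewrite mul0r.
Qed.
Fact ps_mulDl : left_distributive ps_mul (@ps_add A).
Proof.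
move=> p q r; apply/funext => k; rewrite /ps_mul /ps_add -big_split.
by apply: eq_bigr => i _; rewrite mulrDl.
Qed.
Fact ps_oner_neq0 : ps_one != 0 :> ps A.
Proof.
by apply/eqP => /(congr1 (fun p => p 0%N)); apply/eqP; exact: oner_neq0.
Qed.
HB.instance Definition _ := GRing.Zmodule_isComNzRing.Build (ps A)
  ps_mulA ps_mulC ps_mul1 ps_mulDl ps_oner_neq0.

Lemma psME (p q : ps A) k : (p * q) k = \sum_(a < k.+1) p a * q (k - a)%N.
Proof. by []. Qed.
Lemma ps1E k : (1 : ps A) k = (k == 0%N)%:R. Proof. by []. Qed.
Lemma psM0E (p q : ps A) : (p * q) 0%N = p 0%N * q 0%N.
Proof. by rewrite psME big_ord1. Qed.
End SeriesRing.

Definition vanish (A : zmodType) (N : nat) (p : ps A) :=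
  forall k, (k < N)%N -> p k = 0.

Lemma vanishM (A : comNzRingType) a b (p q : ps A) :
  vanish a p -> vanish b q -> vanish (a + b)%N (p * q).
Proof.
move=> pa qb k kab; rewrite psME big1 // => i _.
have [ia|ai] := ltnP i a; first by rewrite pa ?mul0r.
by rewrite qb ?mulr0 //; have := ltn_ord i; lia.
Qed.

(** The lowest coefficient of a product is the product of the lowest ones. *)
Lemma vanishM_lead (A : comNzRingType) a b (p q : ps A) :
  vanish a p -> vanish b q -> (p * q) (a + b)%N = p a * q b.
Proof.
move=> pa qb; rewrite psME.
have ab : (a < (a + b).+1)%N by lia.
rewrite (bigD1 (Ordinal ab)) //= addKn big1 ?addr0 // => i /eqP iab.
have [ia|ai] := ltnP i a; first by rewrite pa ?mul0r.
rewrite qb ?mulr0 //; have := ltn_ord i.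
have : (i : nat) <> a by move=> E; apply: iab; apply/val_inj.
lia.
Qed.

Definition no_zero_divisors (A : comNzRingType) :=
  forall a b : A, a * b = 0 -> a = 0 \/ b = 0.

Lemma ps_lowest (A : zmodType) (p : ps A) :
  p <> 0 -> exists2 k, vanish k p & p k <> 0.
Proof.
move=> p0; have [k pk] : exists k, p k != 0.
  apply: contrapT => H; apply: p0; apply/funext => k.
  by apply/eqP/negbNE/negP => pk; apply: H; exists k.
have ex : exists k, p k != 0 by exists k.
exists (ex_minn ex); case: ex_minnP => j pj jmin; last exact/eqP.
by move=> i ij; apply/eqP/negbNE/negP => /jmin; lia.
Qed.

Lemma ps_no_zero_divisors (A : comNzRingType) :
  no_zero_divisors A -> no_zero_divisors (ps A).
Proof.
move=> Ad p q pq; apply: contrapT => /not_orP [/ps_lowest [a pa pa0]].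
move=> /ps_lowest [b qb qb0].
by have := vanishM_lead pa qb; rewrite pq => /esym /Ad [].
Qed.

Lemma field_no_zero_divisors (K : fieldType) : no_zero_divisors K.
Proof. by move=> a b /eqP; rewrite mulf_eq0 => /orP [] /eqP; [left|right]. Qed.

(** By induction on [k], the first nonzero coefficient of [q] would show up in
    [p * q], multiplied by that of [p]. *)
Lemma vanish_cancel (A : comNzRingType) a b (p q : ps A) :
  no_zero_divisors A -> vanish a p -> p a <> 0 -> vanish (a + b)%N (p * q) ->
  vanish b q.
Proof.
move=> Ad pa pa0 pq k; elim/ltn_ind: k => k IH kb.
have qk : vanish k q by move=> i ik; apply: IH => //; lia.
have := vanishM_lead pa qk; rewrite pq; last by lia.
by move=> /esym /Ad [].
Qed.

(** * Series in two variables and substitutions *)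

Section TwoVariables.
Variable K : fieldType.
Local Notation S2 := (ps (ps K)).

Definition vanish2 (N : nat) (h : S2) := forall i j, (i + j < N)%N -> h i j = 0.

Definition cmon (c : K) (a b : nat) : S2 :=
  fun i j => if (i == a) && (j == b) then c else 0.

Lemma ps2ME (p q : S2) i j :
  (p * q) i j = \sum_(a < i.+1) \sum_(b < j.+1) p a b * q (i - a)%N (j - b)%N.
Proof. by rewrite psME ps_sumE. Qed.

Lemma cmon0 a b : cmon 0 a b = 0.
Proof. by apply/funext => i; apply/funext => j; rewrite /cmon if_same. Qed.

Lemma cmonD c d a b : cmon (c + d) a b = cmon c a b + cmon d a b.
Proof.
apply/funext => i; apply/funext => j; rewrite !psDE /cmon.
by case: ifP => _; rewrite ?addr0.
Qed.

Lemma cmon_mulE c a b (h : S2) i j :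
  (cmon c a b * h) i j =
  if (a <= i)%N && (b <= j)%N then c * h (i - a)%N (j - b)%N else 0.
Proof.
rewrite ps2ME.
case: (boolP ((a <= i)%N && (b <= j)%N)) => [/andP [ai bj]|ab].
  have ai' : (a < i.+1)%N by lia.
  have bj' : (b < j.+1)%N by lia.
  rewrite (bigD1 (Ordinal ai')) //= (bigD1 (Ordinal bj')) //=.
  rewrite {1}/cmon !eqxx /= [X in _ + X + _]big1 ?addr0; last first.
    move=> k /eqP kb; rewrite /cmon eqxx /= ifF ?mul0r //.
    by apply/eqP => E; apply: kb; apply/val_inj.
  rewrite big1 ?addr0 // => k /eqP ka; rewrite big1 // => l _.
  rewrite /cmon ifF ?mul0r //; apply/negbTE; rewrite negb_and; apply/orP; left.
  by apply/eqP => E; apply: ka; apply/val_inj.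
rewrite big1 // => k _; rewrite big1 // => l _; rewrite /cmon ifF ?mul0r //.
by have := ltn_ord k; have := ltn_ord l; lia.
Qed.

Lemma cmonM c d a b a' b' :
  cmon c a b * cmon d a' b' = cmon (c * d) (a + a') (b + b').
Proof.
apply/funext => i; apply/funext => j; rewrite cmon_mulE /cmon.
case: ifP => ab; last by rewrite ifF //; lia.
have -> : ((i - a == a') && (j - b == b'))%N =
          ((i == a + a') && (j == b + b'))%N by lia.
by case: ifP; rewrite ?mulr0.
Qed.

Lemma cmon1 : cmon 1 0 0 = 1.
Proof.
apply/funext => i; apply/funext => j; rewrite /cmon ps1E.
by case: i => [|i] /=; rewrite ?ps1E //; case: j.
Qed.

Lemma cmonX c a b n : cmon c a b ^+ n = cmon (c ^+ n) (a * n) (b * n).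
Proof.
by elim: n => [|n IH]; rewrite ?muln0 ?expr0 ?cmon1 // !exprS IH cmonM !mulnS.
Qed.

Lemma vanish2_cmon c a b : vanish2 (a + b) (cmon c a b).
Proof. by move=> i j ij; rewrite /cmon ifF //; lia. Qed.

Lemma vanish2M a b (p q : S2) :
  vanish2 a p -> vanish2 b q -> vanish2 (a + b) (p * q).
Proof.
move=> pa qb i j ij; rewrite ps2ME big1 // => k _; rewrite big1 // => l _.
have [kla|akl] := ltnP (k + l) a; first by rewrite pa ?mul0r.
by rewrite qb ?mulr0 //; have := ltn_ord k; have := ltn_ord l; lia.
Qed.

Lemma vanish2D N (p q : S2) : vanish2 N p -> vanish2 N q -> vanish2 N (p + q).
Proof. by move=> pN qN i j ij; rewrite !psDE pN ?qN ?addr0. Qed.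
Lemma vanish2N N (p : S2) : vanish2 N p -> vanish2 N (- p).
Proof. by move=> pN i j ij; rewrite !psNE pN ?oppr0. Qed.
Lemma vanish2W a b (p : S2) : (a <= b)%N -> vanish2 b p -> vanish2 a p.
Proof. by move=> ab pb i j ij; apply: pb; lia. Qed.

Definition taylor2 N (h : S2) : S2 :=
  \sum_(i < N) \sum_(j < N) cmon (h i j) i j.

Lemma taylor2E N (h : S2) i j :
  taylor2 N h i j = if (i < N)%N && (j < N)%N then h i j else 0.
Proof.
rewrite /taylor2 !ps_sumE; under eq_bigr => k _ do rewrite !ps_sumE.
case: (boolP ((i < N)%N && (j < N)%N)) => [/andP [iN jN]|ij].
  rewrite (bigD1 (Ordinal iN)) //= (bigD1 (Ordinal jN)) //=.
  rewrite {1}/cmon !eqxx /= [X in _ + X + _]big1 ?addr0; last first.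
    move=> k /eqP kj; rewrite /cmon eqxx /= ifF //.
    by apply/eqP => E; apply: kj; apply/val_inj.
  rewrite big1 ?addr0 // => k /eqP ki; rewrite big1 // => l _.
  rewrite /cmon ifF //; apply/negbTE; rewrite negb_and; apply/orP; left.
  by apply/eqP => E; apply: ki; apply/val_inj.
rewrite big1 // => k _; rewrite big1 // => l _; rewrite /cmon ifF //.
by have := ltn_ord k; have := ltn_ord l; lia.
Qed.

Lemma taylor2P N (h : S2) : vanish2 N (h - taylor2 N h).
Proof.
move=> i j ij; rewrite !psBE taylor2E ifT ?subrr //; lia.
Qed.

End TwoVariables.

(** The common features of the rings of series in one and in two variables:
    constants, and the filtration by the order of vanishing. *)
Record filtered_ring (K : fieldType) (T : comNzRingType) (cst : K -> T)
    (fil : nat -> T -> Prop) : Prop := FilteredRing {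
  fil_cstM : forall c d, cst (c * d) = cst c * cst d;
  fil_cst1 : cst 1 = 1;
  filD : forall N x y, fil N x -> fil N y -> fil N (x + y);
  filN : forall N x, fil N x -> fil N (- x);
  filM : forall a b x y, fil a x -> fil b y -> fil (a + b)%N (x * y);
  filW : forall a b x, (a <= b)%N -> fil b x -> fil a x;
  fil0 : forall x, fil 0 x;
  fil_sep : forall x, (forall N, fil N x) -> x = 0 }.

Section FilteredRingTheory.
Variables (K : fieldType) (T : comNzRingType) (cst : K -> T).
Variables (fil : nat -> T -> Prop) (FT : filtered_ring cst fil).
Local Notation S2 := (ps (ps K)).

Lemma filX n x : fil 1 x -> fil n (x ^+ n).
Proof.
move=> x1; elim: n => [|n IH]; first exact: (fil0 FT).
by rewrite exprS -add1n; apply: (filM FT).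
Qed.

(** A continuous additive map is determined by its values on monomials. *)
Lemma additive_density (psi : S2 -> T) (s : nat) :
  (forall p q, psi (p + q) = psi p + psi q) ->
  (forall N p, vanish2 (N + s) p -> fil N (psi p)) ->
  (forall c i j, psi (cmon c i j) = 0) -> forall p, psi p = 0.
Proof.
move=> psiD psiF psi0 p; apply: (fil_sep FT) => N.
have psi00 : psi 0 = 0 by apply: (addrI (psi 0)); rewrite -psiD !addr0.
have psi_taylor M : psi (taylor2 M p) = 0.
  rewrite /taylor2 (big_morph psi psiD psi00) big1 // => i _.
  by rewrite (big_morph psi psiD psi00) big1.
by rewrite -[p](subrK (taylor2 (N + s) p)) psiD psi_taylor addr0;
   apply: psiF; exact: taylor2P.
Qed.

(** These conditions determine [phi], and they make it multiplicative: both
    facts need to be checked on monomials only. *)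
Record substitution (phi : S2 -> T) (x y : T) : Prop := Substitution {
  subD : forall p q, phi (p + q) = phi p + phi q;
  sub_cmon : forall c i j, phi (cmon c i j) = cst c * x ^+ i * y ^+ j;
  sub_fil : forall N p, vanish2 N p -> fil N (phi p) }.

Variables (phi : S2 -> T) (x y : T).
Hypothesis subst : substitution phi x y.

Lemma sub0 : phi 0 = 0.
Proof. by apply: (addrI (phi 0)); rewrite -(subD subst) !addr0. Qed.
Lemma subN p : phi (- p) = - phi p.
Proof. by apply: (addrI (phi p)); rewrite -(subD subst) !subrr sub0. Qed.
Lemma subB p q : phi (p - q) = phi p - phi q.
Proof. by rewrite (subD subst) subN. Qed.

Lemma subM p q : phi (p * q) = phi p * phi q.
Proof.
apply/eqP; rewrite -subr_eq0; apply/eqP.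
move: p; apply: (additive_density (s := 0)).
- move=> p p'; rewrite mulrDl !(subD subst) mulrDl; ring.
- move=> N p; rewrite addn0 => pN; apply: (filD FT).
    by apply: (sub_fil subst); rewrite -[N]addn0; apply: vanish2M.
  apply: (filN FT); rewrite -[N]addn0; apply: (filM FT); last exact: (fil0 FT).
  exact: (sub_fil subst).
move=> c i j; move: q; apply: (additive_density (s := 0)).
- move=> p p'; rewrite mulrDr !(subD subst) mulrDr; ring.
- move=> N p; rewrite addn0 => pN; apply: (filD FT).
    by apply: (sub_fil subst); rewrite -[N]add0n; apply: vanish2M.
  apply: (filN FT); rewrite -[N]add0n; apply: (filM FT); first exact: (fil0 FT).
  exact: (sub_fil subst).
move=> d k l; rewrite cmonM !(sub_cmon subst) (fil_cstM FT) !exprD; ring.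
Qed.

Lemma sub1 : phi 1 = 1.
Proof. by rewrite -cmon1 (sub_cmon subst) (fil_cst1 FT) !expr0 !mulr1. Qed.
Lemma subX p n : phi (p ^+ n) = phi p ^+ n.
Proof. by elim: n => [|n IH]; rewrite ?expr0 ?sub1 // !exprS subM IH. Qed.

Lemma sub_eq psi : substitution psi x y -> forall p, phi p = psi p.
Proof.
move=> subst' p; apply/eqP; rewrite -subr_eq0; apply/eqP.
move: p; apply: (additive_density (s := 0)).
- move=> p p'; rewrite (subD subst) (subD subst'); ring.
- move=> N p; rewrite addn0 => pN; apply: (filD FT).
    exact: (sub_fil subst).
  by apply: (filN FT); apply: (sub_fil subst').
by move=> c i j; rewrite (sub_cmon subst) (sub_cmon subst') subrr.
Qed.

End FilteredRingTheory.

Section Derivations.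
Variable K : fieldType.
Local Notation S2 := (ps (ps K)).
Definition du (p : S2) : S2 := fun i j => p i.+1 j *+ i.+1.
Definition dv (p : S2) : S2 := fun i j => p i j.+1 *+ j.+1.

Lemma duD p q : du (p + q) = du p + du q.
Proof.
by apply/funext => i; apply/funext => j; rewrite /du !psDE mulrnDl.
Qed.
Lemma dvD p q : dv (p + q) = dv p + dv q.
Proof.
by apply/funext => i; apply/funext => j; rewrite /dv !psDE mulrnDl.
Qed.
Lemma vanish2_du N (p : S2) : vanish2 (N + 1) p -> vanish2 N (du p).
Proof. by move=> pN i j ij; rewrite /du pN ?mul0rn //; lia. Qed.
Lemma vanish2_dv N (p : S2) : vanish2 (N + 1) p -> vanish2 N (dv p).
Proof. by move=> pN i j ij; rewrite /dv pN ?mul0rn //; lia. Qed.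
Lemma du_cmon c a b : du (cmon c a b) = cmon (c *+ a) a.-1 b.
Proof.
apply/funext => i; apply/funext => j; rewrite /du /cmon.
case: a => [|a] /=; first by rewrite mulr0n mul0rn; case: ifP.
by rewrite eqSS; case: ifP => [/andP [/eqP -> _] //|_]; rewrite mul0rn.
Qed.
Lemma dv_cmon c a b : dv (cmon c a b) = cmon (c *+ b) a b.-1.
Proof.
apply/funext => i; apply/funext => j; rewrite /dv /cmon.
case: b => [|b] /=; first by rewrite andbF mulr0n mul0rn; case: ifP.
by rewrite eqSS; case: ifP => [/andP [_ /eqP ->] //|_]; rewrite mul0rn.
Qed.
End Derivations.

Section ChainRule.
Variables (K : fieldType) (T : comNzRingType) (cst : K -> T).
Variables (fil : nat -> T -> Prop) (FT : filtered_ring cst fil).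
Local Notation S2 := (ps (ps K)).
Variables (phi : S2 -> T) (x y : T).
Hypothesis subst : substitution cst fil phi x y.
Variable D : T -> T.
Hypotheses (DD : forall a b, D (a + b) = D a + D b)
  (DM : forall a b, D (a * b) = D a * b + a * D b)
  (Dcst : forall c, D (cst c) = 0)
  (Dfil : forall N a, fil (N + 1) a -> fil N (D a)).

Let D1 : D 1 = 0. Proof. by rewrite -(fil_cst1 FT) Dcst. Qed.
Let DX a n : D (a ^+ n) = D a * a ^+ n.-1 *+ n.
Proof.
case: n => [|n]; first by rewrite expr0 D1 mulr0n.
elim: n => [|n IH]; first by rewrite expr1 expr0 mulr1.
by rewrite exprS DM IH /= [in RHS]mulrS exprS mulrnAr; congr (_ + _ *+ _); ring.
Qed.

(** Both sides are continuous and additive in [p], so that it is enough to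
    differentiate monomials. *)
Lemma sub_chain p : D (phi p) = phi (du p) * D x + phi (dv p) * D y.
Proof.
apply/eqP; rewrite -subr_eq0; apply/eqP.
move: p; apply: (additive_density FT (s := 1)).
- move=> p p'; rewrite duD dvD !(subD subst) DD; ring.
- move=> N p pN; apply: (filD FT); first exact/Dfil/(sub_fil subst).
  apply: (filN FT); apply: (filD FT);
    rewrite -[N]addn0; apply: (filM FT); try exact: (fil0 FT);
    apply: (sub_fil subst).
    exact: vanish2_du.
  exact: vanish2_dv.
have cstMn c n : cst (c *+ n) = cst c * n%:R.
  have cst0 : cst 0 = 0.
    by have := sub_cmon subst 0 0 0; rewrite cmon0 (sub0 subst) !expr0 !mulr1.
  have cstD a b : cst (a + b) = cst a + cst b.
    have := sub_cmon subst (a + b) 0 0; rewrite cmonD (subD subst).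
    by rewrite !(sub_cmon subst) !expr0 !mulr1.
  elim: n => [|n IH]; first by rewrite mulr0n mulr0 cst0.
  by rewrite mulrS cstD IH mulrSr mulrDr mulr1 addrC.
move=> c i j; rewrite du_cmon dv_cmon !(sub_cmon subst) !DM Dcst !DX !cstMn.
rewrite -[D x * _ *+ i]mulr_natr -[D y * _ *+ j]mulr_natr mul0r add0r.
move: (i%:R) (j%:R) (x ^+ i) (y ^+ j) (x ^+ i.-1) (y ^+ j.-1) (cst c).
by move=> ni nj xi yj xi' yj' c'; ring.
Qed.
End ChainRule.

Section CoefSubstitution.
Variables (K : fieldType) (T : comNzRingType) (cst : K -> T).
Variables (fil : nat -> T -> Prop).
Variables (I : Type) (deg : I -> nat) (co : I -> T -> K).
Hypotheses (filE : forall N t, fil N t <-> forall k, (deg k < N)%N -> co k t = 0)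
  (co_ext : forall s t, (forall k, co k s = co k t) -> s = t)
  (coD : forall k s t, co k (s + t) = co k s + co k t)
  (co_cst : forall k c t, co k (cst c * t) = c * co k t)
  (fil_M : forall a b s t, fil a s -> fil b t -> fil (a + b)%N (s * t)).

(** Only finitely many monomials contribute to a given coefficient, so that
    truncated sums do define a continuous map. *)
Lemma coef_substitution (phi : ps (ps K) -> T) x y :
  fil 1 x -> fil 1 y ->
  (forall h k, co k (phi h) =
     \sum_(i < (deg k).+1) \sum_(j < (deg k).+1) h i j * co k (x ^+ i * y ^+ j)) ->
  substitution cst fil phi x y.
Proof.
move=> x1 y1 phiE.
have pw n s : fil 1 s -> fil n (s ^+ n).
  move=> s1; elim: n => [|n IH]; first by apply/filE.
  by rewrite exprS -add1n; apply: fil_M.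
have co0 i j k : (deg k < i + j)%N -> co k (x ^+ i * y ^+ j) = 0.
  by move=> kij; have /filE := fil_M (pw i _ x1) (pw j _ y1); apply.
split=> [p q|c i j|N p pN].
- apply: co_ext => k; rewrite coD !phiE -big_split; apply: eq_bigr => i _.
  by rewrite -big_split; apply: eq_bigr => j _; rewrite !psDE mulrDl.
- apply: co_ext => k; rewrite phiE -mulrA co_cst.
  case: (boolP ((i < (deg k).+1)%N && (j < (deg k).+1)%N)) => [/andP [ik jk]|ij].
    rewrite (bigD1 (Ordinal ik)) //= (bigD1 (Ordinal jk)) //=.
    rewrite {1}/cmon !eqxx /= [X in _ + X + _]big1 ?addr0; last first.
      move=> l /eqP lj; rewrite /cmon eqxx /= ifF ?mul0r //.
      by apply/eqP => E; apply: lj; apply/val_inj.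
    rewrite big1 ?addr0 // => l /eqP li; rewrite big1 // => l' _.
    rewrite /cmon ifF ?mul0r //; apply/negbTE; rewrite negb_and; apply/orP; left.
    by apply/eqP => E; apply: li; apply/val_inj.
  rewrite co0 ?mulr0; last by lia.
  rewrite big1 // => l _; rewrite big1 // => l' _.
  by rewrite /cmon ifF ?mul0r //; have := ltn_ord l; have := ltn_ord l'; lia.
apply/filE => k kN; rewrite phiE big1 // => i _; rewrite big1 // => j _.
have [ij|ij] := ltnP (i + j) N; first by rewrite pN ?mul0r.
by rewrite co0 ?mulr0 //; lia.
Qed.
End CoefSubstitution.

Section Series.
Variable R : realType.
Local Notation K := R[i].
Local Notation S1 := (ps K).
Local Notation S2 := (ps (ps K)).
Local Notation arc := (S1 * S1)%type.
Local Notation map2 := (S2 * S2)%type.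

Lemma mul1E (p q : S1) : mul1 p q = p * q. Proof. by []. Qed.
Lemma pow1E (p : S1) n : pow1 p n = p ^+ n.
Proof. by elim: n => [|n IH] //; rewrite exprS -IH. Qed.
Lemma mul2E (p q : S2) : mul2 p q = p * q.
Proof. by apply/funext => i; apply/funext => j; rewrite ps2ME. Qed.
Lemma mon2E a b : mon2 R a b = cmon 1 a b.
Proof.
by apply/funext => i; apply/funext => j; rewrite /mon2 /cmon; case: ifP.
Qed.
Lemma scale2E c (p : S2) : scale2 c p = cmon c 0 0 * p.
Proof.
apply/funext => i; apply/funext => j.
by rewrite cmon_mulE /= !subn0.
Qed.
Lemma pow2E (p : S2) n : pow2 p n = p ^+ n.
Proof.
elim: n => [|n IH]; first by rewrite expr0 -cmon1 -mon2E.
by rewrite exprS -IH -mul2E.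
Qed.

Definition cst1 (A : zmodType) (c : A) : ps A := fun k => if k == 0%N then c else 0.

Lemma cst1ME (c : K) (p : S1) k : (cst1 c * p) k = c * p k.
Proof.
rewrite psME big_ord_recl /= subn0 big1 ?addr0 // => i _.
by rewrite /cst1 mul0r.
Qed.

Lemma filtered1 : filtered_ring (@cst1 K) (@vanish K).
Proof.
split.
- by move=> c d; apply/funext => k; rewrite cst1ME /cst1; case: ifP; rewrite ?mulr0.
- by apply/funext => k; rewrite /cst1 ps1E; case: eqP.
- by move=> N x y xN yN k kN; rewrite psDE xN ?yN ?addr0.
- by move=> N x xN k kN; rewrite psNE xN ?oppr0.
- exact: vanishM.
- by move=> a b x ab xb k ka; apply: xb; lia.
- by [].
- by move=> x xN; apply/funext => k; exact: (xN k.+1).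
Qed.

Lemma filtered2 : filtered_ring (fun c : K => cmon c 0 0) (@vanish2 K).
Proof.
split.
- by move=> c d; rewrite cmonM.
- exact: cmon1.
- exact: vanish2D.
- exact: vanish2N.
- exact: vanish2M.
- exact: vanish2W.
- by [].
- by move=> x xN; apply/funext => i; apply/funext => j; exact: (xN (i + j).+1).
Qed.

(** [comp21] and [comp22], with the arguments in the order that makes them
    homomorphisms of rings of series. *)
Definition ev (g : arc) (h : S2) : S1 := comp21 h g.
Definition pb (F : map2) (h : S2) : S2 := comp22 h F.

Definition centred1 (g : arc) := g.1 0%N = 0 /\ g.2 0%N = 0.
Definition centred2 (F : map2) := F.1 0%N 0%N = 0 /\ F.2 0%N 0%N = 0.

Lemma vanish_1 (p : S1) : p 0%N = 0 -> vanish 1 p.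
Proof. by move=> p0 [|k]. Qed.
Lemma vanish2_1 (p : S2) : p 0%N 0%N = 0 -> vanish2 1 p.
Proof. by move=> p0 [|i] [|j]. Qed.

Lemma ev_subst g : centred1 g ->
  substitution (@cst1 K) (@vanish K) (ev g) g.1 g.2.
Proof.
move=> [g1 g2]; apply: (@coef_substitution K S1 _ _ nat id (fun k p => p k)).
- by [].
- by move=> s t st; apply/funext.
- by [].
- by move=> k c t; rewrite cst1ME.
- exact: vanishM.
- exact: vanish_1.
- exact: vanish_1.
move=> h k; rewrite /ev /comp21; apply: eq_bigr => i _; apply: eq_bigr => j _.
by rewrite !pow1E mul1E.
Qed.

Lemma pb_subst F : centred2 F ->
  substitution (fun c : K => cmon c 0 0) (@vanish2 K) (pb F) F.1 F.2.
Proof.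
move=> [F1 F2]; apply: (@coef_substitution K S2 _ _ (nat * nat)%type
  (fun k => (k.1 + k.2)%N) (fun k p => p k.1 k.2)).
- move=> N t; split=> [tN [i j]|H i j ij]; first exact: tN.
  exact: (H (i, j)).
- by move=> s t st; apply/funext => i; apply/funext => j; exact: (st (i, j)).
- by [].
- by move=> k c t; rewrite cmon_mulE /= !subn0.
- exact: vanish2M.
- exact: vanish2_1.
- exact: vanish2_1.
move=> h [k l]; rewrite /pb /comp22 /=.
apply: eq_bigr => i _; apply: eq_bigr => j _.
by rewrite !pow2E mul2E.
Qed.

Section Ev.
Variables (g : arc) (gc : centred1 g).
Let s := ev_subst gc.
Lemma evD p q : ev g (p + q) = ev g p + ev g q. Proof. exact: (subD s). Qed.
Lemma evB p q : ev g (p - q) = ev g p - ev g q. Proof. exact: (subB s). Qed.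
Lemma evM p q : ev g (p * q) = ev g p * ev g q. Proof. exact: (subM filtered1 s). Qed.
Lemma evX p n : ev g (p ^+ n) = ev g p ^+ n. Proof. exact: (subX filtered1 s). Qed.
Lemma ev_cmon c i j : ev g (cmon c i j) = cst1 c * g.1 ^+ i * g.2 ^+ j.
Proof. exact: (sub_cmon s). Qed.
Lemma ev_fil N p : vanish2 N p -> vanish N (ev g p). Proof. exact: (sub_fil s). Qed.
Lemma ev0 p : ev g p 0%N = p 0%N 0%N.
Proof.
rewrite -[p](subrK (taylor2 1 p)) evD psDE (ev_fil (@taylor2P _ 1 p)) // add0r.
rewrite /taylor2 !big_ord1 ev_cmon !expr0 !mulr1 !psDE /cmon !eqxx /=.
by rewrite !psNE subrr add0r.
Qed.
End Ev.

Section Pb.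
Variables (F : map2) (Fc : centred2 F).
Let s := pb_subst Fc.
Lemma pbD p q : pb F (p + q) = pb F p + pb F q. Proof. exact: (subD s). Qed.
Lemma pbB p q : pb F (p - q) = pb F p - pb F q. Proof. exact: (subB s). Qed.
Lemma pb0 : pb F 0 = 0. Proof. exact: (sub0 s). Qed.
Lemma pbM p q : pb F (p * q) = pb F p * pb F q. Proof. exact: (subM filtered2 s). Qed.
Lemma pb_cmon c i j : pb F (cmon c i j) = cmon c 0 0 * F.1 ^+ i * F.2 ^+ j.
Proof. exact: (sub_cmon s). Qed.
Lemma pb_fil N p : vanish2 N p -> vanish2 N (pb F p). Proof. exact: (sub_fil s). Qed.
Lemma pb00 p : pb F p 0%N 0%N = p 0%N 0%N.
Proof.
rewrite -[p](subrK (taylor2 1 p)) pbD !psDE (pb_fil (@taylor2P _ 1 p)) // add0r.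
rewrite /taylor2 !big_ord1 pb_cmon !expr0 !mulr1 /cmon !eqxx /=.
by rewrite !psNE subrr add0r.
Qed.
End Pb.

Definition map_arc (F : map2) (g : arc) : arc := (ev g F.1, ev g F.2).
Definition map_map (F G : map2) : map2 := (pb G F.1, pb G F.2).

Lemma map_arc_centred F g : centred2 F -> centred1 g -> centred1 (map_arc F g).
Proof. by move=> [F1 F2] gc; split; rewrite /= ev0. Qed.
Lemma map_map_centred F G : centred2 F -> centred2 G -> centred2 (map_map F G).
Proof. by move=> [F1 F2] gc; split; rewrite /= pb00. Qed.

Lemma ev_pb F g h : centred2 F -> centred1 g ->
  ev g (pb F h) = ev (map_arc F g) h.
Proof.
move=> Fc gc; have Fg := map_arc_centred Fc gc.
move: h; apply: (sub_eq filtered1); last exact: ev_subst.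
split=> [p q|c i j|N p pN]; first by rewrite pbD // evD.
  by rewrite pb_cmon // !evM // !evX // ev_cmon // !expr0 !mulr1.
exact/ev_fil/pb_fil.
Qed.

Lemma pb_pb F G h : centred2 F -> centred2 G ->
  pb G (pb F h) = pb (map_map F G) h.
Proof.
move=> Fc Gc; have FG := map_map_centred Fc Gc.
move: h; apply: (sub_eq filtered2); last exact: pb_subst.
have X p n : pb G (p ^+ n) = pb G p ^+ n by exact: (subX filtered2 (pb_subst Gc)).
split=> [p q|c i j|N p pN]; first by rewrite pbD // pbD.
  by rewrite pb_cmon // !pbM // !X // pb_cmon // !expr0 !mulr1.
exact/pb_fil/pb_fil.
Qed.

Lemma map_arcA F G g : centred2 F -> centred2 G -> centred1 g ->
  map_arc (map_map F G) g = map_arc F (map_arc G g).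
Proof. by move=> Fc Gc gc; rewrite /map_arc /= !ev_pb. Qed.
Lemma map_mapA F G H : centred2 F -> centred2 G -> centred2 H ->
  map_map (map_map F G) H = map_map F (map_map G H).
Proof. by move=> Fc Gc Hc; rewrite /map_map /= !pb_pb. Qed.

Lemma ev_id (g : arc) : centred1 g -> g = map_arc (cmon 1 1 0, cmon 1 0 1) g.
Proof.
move=> gc; rewrite /map_arc !ev_cmon //= !expr0 !expr1 !mulr1.
by case: g gc => g1 g2 _ /=; rewrite !(fil_cst1 filtered1) !mul1r.
Qed.

Lemma pb_id (h : S2) : pb (cmon 1 1 0, cmon 1 0 1) h = h.
Proof.
have c : centred2 (cmon (1 : K) 1 0, cmon 1 0 1) by [].
move: h; apply: (sub_eq filtered2); first exact: pb_subst.
split=> // d i j; rewrite /= !cmonX !cmonM !expr1n !mulr1.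
by rewrite !mul1n !mul0n !addn0 !add0n.
Qed.

Definition dt (p : S1) : S1 := deriv1 p.

Lemma dtE p k : dt p k = p k.+1 *+ k.+1. Proof. by []. Qed.
Lemma dtD p q : dt (p + q) = dt p + dt q.
Proof. by apply/funext => k; rewrite psDE !dtE psDE mulrnDl. Qed.
Lemma dt_cst c : dt (cst1 c) = 0.
Proof. by apply/funext => k; rewrite dtE mul0rn. Qed.
Lemma vanish_dt N p : vanish (N + 1) p -> vanish N (dt p).
Proof. by move=> pN k kN; rewrite dtE pN ?mul0rn //; lia. Qed.

(** Leibniz' rule in one variable, in terms of the Euler derivation, for which
    it is a statement about each term of the product. *)
Lemma euler1_leibniz (A : comNzRingType) (p q : ps A) k :
  (p * q) k *+ k =
  \sum_(a < k.+1) p a *+ a * q (k - a)%N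
    + \sum_(a < k.+1) p a * (q (k - a)%N *+ (k - a)).
Proof.
rewrite psME -big_split /= -sumrMnl; apply: eq_bigr => a _.
rewrite mulrnAl mulrnAr -mulrnDr; congr (_ *+ _); have := ltn_ord a; lia.
Qed.

Lemma deriv_leibniz (A : comNzRingType) (p q : ps A) k :
  (p * q) k.+1 *+ k.+1 =
  \sum_(a < k.+1) (p a.+1 *+ a.+1) * q (k - a)%N
    + \sum_(a < k.+1) p a * (q (k - a).+1 *+ (k - a).+1).
Proof.
rewrite euler1_leibniz; congr (_ + _).
  rewrite big_ord_recl mulr0n mul0r add0r; apply: eq_bigr => a _.
  by rewrite lift0 subSS.
rewrite big_ord_recr /= subnn mulr0n mulr0 addr0; apply: eq_bigr => a _.
by rewrite subSn //; have := ltn_ord a; lia.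
Qed.

Lemma dtM p q : dt (p * q) = dt p * q + p * dt q.
Proof. by apply/funext => k; rewrite dtE deriv_leibniz. Qed.

Lemma duM (p q : S2) : du (p * q) = du p * q + p * du q.
Proof.
apply/funext => i.
transitivity ((p * q) i.+1 *+ i.+1).
  by apply/funext => j; rewrite psMnE.
have duE (r : S2) l : du r l = r l.+1 *+ l.+1.
  by apply/funext => j; rewrite psMnE.
rewrite deriv_leibniz psDE !psME; congr (_ + _); apply: eq_bigr => a _.
  by rewrite duE.
by rewrite duE.
Qed.

Lemma dvM (p q : S2) : dv (p * q) = dv p * q + p * dv q.
Proof.
have dvE (r : S2) l : dv r l = dt (r l) by [].
apply/funext => i; rewrite dvE psDE !psME.
rewrite (big_morph dt dtD (_ : dt 0 = 0)) //; last first.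
  by apply/funext => k; rewrite dtE mul0rn.
by rewrite -big_split; apply: eq_bigr => a _; rewrite dtM !dvE.
Qed.

Lemma dt_ev g h : centred1 g ->
  dt (ev g h) = ev g (du h) * dt g.1 + ev g (dv h) * dt g.2.
Proof.
move=> gc; apply: (sub_chain filtered1 (ev_subst gc)).
- exact: dtD.
- exact: dtM.
- exact: dt_cst.
- exact: vanish_dt.
Qed.

Lemma du_pb F h : centred2 F ->
  du (pb F h) = pb F (du h) * du F.1 + pb F (dv h) * du F.2.
Proof.
move=> Fc; apply: (sub_chain filtered2 (pb_subst Fc)).
- exact: duD.
- exact: duM.
- by move=> c; rewrite du_cmon mulr0n cmon0.
- by move=> N p; exact: vanish2_du.
Qed.

Lemma dv_pb F h : centred2 F ->
  dv (pb F h) = pb F (du h) * dv F.1 + pb F (dv h) * dv F.2.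
Proof.
move=> Fc; apply: (sub_chain filtered2 (pb_subst Fc)).
- exact: dvD.
- exact: dvM.
- by move=> c; rewrite dv_cmon mulr0n cmon0.
- by move=> N p; exact: vanish2_dv.
Qed.

Definition fpb (F : map2) (w : map2) : map2 :=
  (pb F w.1 * du F.1 + pb F w.2 * du F.2, pb F w.1 * dv F.1 + pb F w.2 * dv F.2).
Definition apb (g : arc) (w : map2) : S1 :=
  ev g w.1 * dt g.1 + ev g w.2 * dt g.2.
Definition wdg (w e : map2) : S2 := w.1 * e.2 - w.2 * e.1.
Definition jac (F : map2) : S2 := wdg (du F.1, dv F.1) (du F.2, dv F.2).

Lemma pullback_mapE F w : pullback_map F w = fpb F w.
Proof. by rewrite /pullback_map /fpb !mul2E. Qed.
Lemma wedgeE w e : wedge w e = wdg w e.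
Proof. by rewrite /wedge !mul2E. Qed.

Lemma apb_map F g w : centred2 F -> centred1 g ->
  apb (map_arc F g) w = apb g (fpb F w).
Proof.
move=> Fc gc; rewrite /apb /= !dt_ev // !evD // !evM // !ev_pb //.
ring.
Qed.

Lemma fpb_map F G w : centred2 F -> centred2 G ->
  fpb (map_map F G) w = fpb G (fpb F w).
Proof.
move=> Fc Gc; rewrite /fpb /= !du_pb // !dv_pb // !pbD // !pbM // !pb_pb //.
by congr pair; ring.
Qed.

Lemma wdg_fpb F w e : centred2 F -> wdg (fpb F w) (fpb F e) = pb F (wdg w e) * jac F.
Proof.
move=> Fc; rewrite /wdg /jac /wdg /= pbB // !pbM //; ring.
Qed.

Lemma fpb_diff F h : centred2 F -> fpb F (du h, dv h) = (du (pb F h), dv (pb F h)).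
Proof. by move=> Fc; rewrite du_pb // dv_pb. Qed.

Lemma jac_map F G : centred2 F -> centred2 G ->
  jac (map_map F G) = pb G (jac F) * jac G.
Proof.
move=> Fc Gc; rewrite /jac /= !du_pb // !dv_pb // /wdg /= pbB // !pbM //.
ring.
Qed.

End Series.

Section Orders.
Variable R : realType.
Local Notation K := R[i].
Local Notation S1 := (ps K).
Local Notation S2 := (ps (ps K)).
Local Notation arc := (S1 * S1)%type.
Local Notation map2 := (S2 * S2)%type.
Local Notation ord1 := (@Defs.ord1 R).
Implicit Types (p q : S1) (f h U : S2) (g : arc) (F : map2).

Let Kd : no_zero_divisors K := @field_no_zero_divisors K.

(** * Orders along arcs *)

Lemma cst1_0 : cst1 (0 : K) = 0.
Proof. by apply/funext => b; rewrite /cst1 if_same. Qed.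

Lemma ord1M p q a b : ord1 p a -> ord1 q b -> ord1 (p * q) (a + b).
Proof.
move=> [pa pv] [qb qv]; split; last exact: vanishM.
by rewrite vanishM_lead // mulf_neq0.
Qed.
Lemma ord1_1 : ord1 (1 : S1) 0. Proof. by split=> //; rewrite ps1E oner_neq0. Qed.
Lemma ord1X p a n : ord1 p a -> ord1 (p ^+ n) (a * n).
Proof.
move=> pa; elim: n => [|n IH]; first by rewrite muln0; exact: ord1_1.
by rewrite exprS mulnS; apply: ord1M.
Qed.
Lemma ord1_unit p : p 0%N <> 0 -> ord1 p 0. Proof. by move=> /eqP. Qed.
Lemma ord1_inj p a b : ord1 p a -> ord1 p b -> a = b.
Proof.
move=> [/eqP pa pva] [/eqP pb pvb]; case: (ltngtP a b) => // ab.
  by case: pa; apply: pvb.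
by case: pb; apply: pva.
Qed.
Lemma ord1_exists p : p <> 0 -> exists k, ord1 p k.
Proof. by move=> /ps_lowest [k pv /eqP pk]; exists k. Qed.
Lemma ord1_factor p q k : ord1 (p * q) k ->
  exists a b, [/\ ord1 p a, ord1 q b & k = (a + b)%N].
Proof.
move=> pq; have [|a pa] := ord1_exists (p := p).
  by move=> p0; case: pq => /eqP + _; rewrite p0 mul0r.
have [|b qb] := ord1_exists (p := q).
  by move=> q0; case: pq => /eqP + _; rewrite q0 mulr0.
by exists a, b; split=> //; apply: ord1_inj pq _; apply: ord1M.
Qed.

(** A monomial times a unit.  Functions whose zeros lie in the exceptional
    divisor have this form at its points, and charts preserve it. *)
Definition mu i j h := exists2 U : S2, U 0%N 0%N <> 0 & h = cmon 1 i j * U.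

Lemma unit00M U f : U 0%N 0%N <> 0 -> f 0%N 0%N <> 0 -> (U * f) 0%N 0%N <> 0.
Proof.
by rewrite !psM0E => /eqP u0 /eqP f0; apply/eqP; rewrite mulf_neq0.
Qed.
Lemma one00 : (1 : S2) 0%N 0%N <> 0.
Proof. by rewrite !ps1E; apply/eqP; exact: oner_neq0. Qed.
Lemma unit00X U n : U 0%N 0%N <> 0 -> (U ^+ n) 0%N 0%N <> 0.
Proof.
move=> u0; elim: n => [|n IH]; first exact: one00.
by rewrite exprS; exact: unit00M.
Qed.

Lemma muM i j k l f h : mu i j f -> mu k l h -> mu (i + k) (j + l) (f * h).
Proof.
move=> [U u0 ->] [V v0 ->]; exists (U * V); first exact: unit00M.
by rewrite -[in RHS](mulr1 (1 : K)) -cmonM; ring.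
Qed.
Lemma mu_mon i j : mu i j (cmon 1 i j).
Proof. by exists 1; [exact: one00 | rewrite mulr1]. Qed.
Lemma mu_unit U : U 0%N 0%N <> 0 -> mu 0 0 U.
Proof. by move=> u0; exists U => //; rewrite cmon1 mul1r. Qed.
Lemma muX i j f n : mu i j f -> mu (i * n) (j * n) (f ^+ n).
Proof.
move=> mf; elim: n => [|n IH]; first by rewrite !muln0 expr0; apply/mu_unit/one00.
by rewrite exprS !mulnS; exact: muM.
Qed.

Lemma mu_pb i j a b c d F h : centred2 F -> mu i j h -> mu a b F.1 -> mu c d F.2 ->
  mu (a * i + c * j) (b * i + d * j) (pb F h).
Proof.
move=> Fc [U u0 ->] m1 m2; rewrite pbM // pb_cmon // cmon1 mul1r.
rewrite -[(_ + _)%N]addn0 -[(b * i + d * j)%N]addn0.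
by apply: muM; [apply: muM; exact: muX | apply: mu_unit; rewrite pb00].
Qed.
Lemma mu_pb1 i a b F h : centred2 F -> mu i 0 h -> mu a b F.1 ->
  mu (a * i) (b * i) (pb F h).
Proof.
move=> Fc [U u0 ->] m1; rewrite pbM // pb_cmon // cmon1 mul1r expr0 mulr1.
rewrite -[(a * i)%N]addn0 -[(b * i)%N]addn0.
by apply: muM; [exact: muX | apply: mu_unit; rewrite pb00].
Qed.
Lemma mu_pb2 i a b F h : centred2 F -> mu 0 i h -> mu a b F.2 ->
  mu (a * i) (b * i) (pb F h).
Proof.
move=> Fc [U u0 ->] m1; rewrite pbM // pb_cmon // cmon1 mul1r expr0 mul1r.
rewrite -[(a * i)%N]addn0 -[(b * i)%N]addn0.
by apply: muM; [exact: muX | apply: mu_unit; rewrite pb00].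
Qed.

Lemma mu_ev i j a b g h : centred1 g -> mu i j h -> ord1 g.1 a -> ord1 g.2 b ->
  ord1 (ev g h) (a * i + b * j).
Proof.
move=> gc [U u0 ->] g1 g2; rewrite evM // ev_cmon // (fil_cst1 (filtered1 R)) mul1r.
rewrite -[(_ + _)%N]addn0; apply: ord1M.
  by apply: ord1M; exact: ord1X.
by apply: ord1_unit; rewrite ev0.
Qed.

Lemma mu_vanish2 i j h : mu i j h -> vanish2 (i + j) h.
Proof.
move=> [U _ ->]; rewrite -[(i + j)%N]addn0.
by apply: vanish2M => //; exact: vanish2_cmon.
Qed.

(** Modulo higher order, multiplication by a unit is multiplication by its
    constant term. *)
Lemma unit_cancel N U h : U 0%N 0%N <> 0 -> vanish2 N (U * h) -> vanish2 N h.
Proof.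
move=> /eqP u0; elim: N => // N IH Uh.
have hN : vanish2 N h by apply: IH => i j ij; apply: Uh; lia.
have hc : vanish2 N.+1 (cmon (U 0%N 0%N) 0 0 * h).
  have -> : cmon (U 0%N 0%N) 0 0 * h = U * h - (U - cmon (U 0%N 0%N) 0 0) * h.
    by rewrite mulrBl subKr.
  apply: vanish2D => //; apply: vanish2N; rewrite -add1n; apply: vanish2M => //.
  by apply: vanish2_1; rewrite !psBE /cmon /= subrr.
move=> i j ij; have := hc i j ij; rewrite cmon_mulE /= !subn0.
by move/eqP; rewrite mulf_eq0 (negbTE u0) /= => /eqP.
Qed.

Lemma mu_cancel N i j f h : mu i j f -> vanish2 (N + (i + j)) (f * h) -> vanish2 N h.
Proof.
move=> [U u0 ->] fh; apply: (unit_cancel u0) => a b ab.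
have := fh (a + i)%N (b + j)%N; rewrite -mulrA cmon_mulE !leq_addl /= !addnK mul1r.
by apply; lia.
Qed.

(** [sharp k f]: at the point of the divisor u = 0 the function [f] is u^k
    times a unit. *)
Definition sharp k f := vanish k f /\ f k 0%N <> 0.

Lemma sharpM a b f h : sharp a f -> sharp b h -> sharp (a + b) (f * h).
Proof.
move=> [fa fa0] [hb hb0]; split; first exact: vanishM.
rewrite vanishM_lead // psM0E; apply/eqP; rewrite mulf_neq0 //; exact/eqP.
Qed.

(** The restriction to u = 0 of the product, divided by its power of u, is the
    product of those of the factors; if it is nonzero at the point, so are
    they. *)
Lemma sharp_factor k f h : sharp k (f * h) -> exists k1, sharp k1 f.
Proof.
move=> [fhv fh0].
have Sd := ps_no_zero_divisors Kd.
have [|a fa fa0] := ps_lowest (p := f).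
  by move=> f0; apply: fh0; rewrite f0 mul0r.
have [|b hb hb0] := ps_lowest (p := h).
  by move=> h0; apply: fh0; rewrite h0 mulr0.
have lead := vanishM_lead fa hb.
have kab : k = (a + b)%N.
  case: (ltngtP k (a + b)) => // kab.
    by case: fh0; rewrite (vanishM fa hb) //.
  by have := fhv _ kab; rewrite lead => /Sd [].
exists a; split=> // fa00; apply: fh0.
by rewrite kab lead psM0E fa00 mul0r.
Qed.

Definition srow (r : nat) (a : S1) : S2 := fun k => if k == r then a else 0.

Lemma srow_mulE r a h k : (srow r a * h) k = if (r <= k)%N then a * h (k - r)%N else 0.
Proof.
rewrite psME; case: leqP => [rk|kr].
  have rk' : (r < k.+1)%N by lia.
  rewrite (bigD1 (Ordinal rk')) //= {1}/srow eqxx big1 ?addr0 // => i /eqP ir.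
  rewrite /srow ifF ?mul0r //; apply/eqP => E1; apply: ir; exact/val_inj.
rewrite big1 // => i _; rewrite /srow ifF ?mul0r //; have := ltn_ord i; lia.
Qed.

Lemma vanish_factor k f : vanish k f -> exists h, f = cmon 1 k 0 * h.
Proof.
move=> fk; exists (fun i => f (i + k)%N); apply/funext => i; apply/funext => j.
rewrite cmon_mulE /= mul1r subn0 andbT; case: leqP => ki; first by rewrite subnK.
by rewrite fk.
Qed.

Lemma sharp_ev k f g : centred1 g -> ord1 g.1 1 -> sharp k f -> ord1 (ev g f) k.
Proof.
move=> gc g1 [fk fk0]; have [h fE] := vanish_factor fk.
rewrite fE evM // ev_cmon // (fil_cst1 (filtered1 R)) mul1r expr0 mulr1.
rewrite -{2}[k]mul1n -[X in ord1 _ X]addn0; apply: ord1M; first exact: ord1X.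
apply: ord1_unit; rewrite ev0 // => h0; apply: fk0; rewrite fE cmon_mulE /=.
by rewrite leqnn !subnn h0 mulr0.
Qed.

(** * The charts of a blowing-up *)

Definition chart (d : direction R) : map2 :=
  if d is Some c then (cmon 1 1 0, cmon 1 1 1 + cmon c 1 0)
  else (cmon 1 1 1, cmon 1 0 1).

Lemma blowup_chartE d : blowup_chart d = chart d.
Proof.
case: d => [c|] /=; rewrite /blowup_chart !mon2E ?scale2E // cmonM mulr1.
by [].
Qed.

Lemma chart_centred d : centred2 (chart d).
Proof. by case: d => [c|]; split=> //=; rewrite !psDE /cmon /= addr0. Qed.

Definition blowup (P : seq (direction R)) : map2 :=
  foldr (fun d F => map_map (chart d) F) (cmon 1 1 0, cmon 1 0 1) P.

Lemma blowup_mapE P : blowup_map P = blowup P.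
Proof.
by elim: P => [|d P IH] /=; [rewrite !mon2E | rewrite blowup_chartE IH].
Qed.

Lemma blowup_centred P : centred2 (blowup P).
Proof.
elim: P => [|d P IH] /=; first by [].
exact: map_map_centred (chart_centred d) IH.
Qed.

Lemma map_idl F : centred2 F -> map_map (cmon 1 1 0, cmon 1 0 1) F = F.
Proof.
move=> Fc; case: F Fc => F1 F2 Fc; rewrite /map_map /= !pb_cmon //=.
by rewrite cmon1 !expr0 !expr1 !mul1r mulr1.
Qed.
Lemma map_idr F : map_map F (cmon 1 1 0, cmon 1 0 1) = F.
Proof. by case: F => F1 F2; rewrite /map_map /= !pb_id. Qed.

Lemma blowup_cat P P' : blowup (P ++ P') = map_map (blowup P) (blowup P').
Proof.
elim: P => [|d P IH] /=.
  by rewrite map_idl //; exact: blowup_centred.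
by rewrite IH map_mapA //; (exact: chart_centred || exact: blowup_centred).
Qed.
Lemma blowup_rcons P d : blowup (rcons P d) = map_map (blowup P) (chart d).
Proof. by rewrite -cats1 blowup_cat /= map_idr. Qed.

Section ChartRows.
Variable c : K.
Let V : S1 := fun k => if k == 0%N then c else (k == 1%N)%:R.
Let rows h : S2 := fun k => \sum_(j < k.+1) cst1 (h (k - j)%N j) * V ^+ j.

Let chart_srow : chart (Some c) = (srow 1 1, srow 1 V).
Proof.
congr pair; apply/funext => i; apply/funext => j; rewrite ?psDE /cmon /srow.
  by case: (i == 1%N) => //=; rewrite ps1E; case: (j == 0%N).
case: (i == 1%N) => //=; last by rewrite addr0.
by rewrite /V; case: j => [|[|j]] /=; rewrite ?add0r ?addr0.
Qed.

Let srowX a j : srow 1 a ^+ j = srow j (a ^+ j).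
Proof.
elim: j => [|j IH].
  by rewrite !expr0; apply/funext => k; rewrite /srow ps1E; case: k.
rewrite exprS IH; apply/funext => k; rewrite srow_mulE /srow.
case: k => [|k] //=; rewrite subn1 /= eqSS; case: ifP => // _.
  by rewrite exprS.
by rewrite mulr0.
Qed.

Let rowsE h : pb (chart (Some c)) h = rows h.
Proof.
move: h; apply: (sub_eq (filtered2 R) (pb_subst (chart_centred (Some c)))).
split=> [f h|d i j|N h hN].
- apply/funext => k; rewrite psDE -big_split; apply: eq_bigr => j _ /=.
  rewrite -mulrDl; congr (_ * _); apply/funext => l.
  by rewrite [RHS]psDE /cst1; case: ifP; rewrite ?addr0.
- apply/funext => k; rewrite chart_srow /= !srowX expr1n.
  have -> : cmon d 0 0 = srow 0 (cst1 d).
    by apply/funext => a; apply/funext => b; rewrite /cmon /srow /cst1; case: eqP.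
  rewrite -mulrA srow_mulE /= subn0 srow_mulE mul1r /rows.
  case: leqP => [ik|ki]; last first.
    rewrite mulr0 big1 // => l _; rewrite /cmon ifF ?cst1_0 ?mul0r //; lia.
  rewrite /srow; case: eqP => [E1|kij].
    have jk : (j < k.+1)%N by lia.
    rewrite (bigD1 (Ordinal jk)) //= big1 ?addr0 => [|l /eqP lj].
      by rewrite /cmon eqxx andbT ifT //; lia.
    rewrite /cmon ifF ?cst1_0 ?mul0r //.
    apply/negbTE; rewrite negb_and; apply/orP; right; apply/eqP => E2.
    by apply: lj; apply/val_inj.
  rewrite mulr0 big1 // => l _; rewrite /cmon ifF ?cst1_0 ?mul0r //.
  by have := ltn_ord l; lia.
move=> i j ij; rewrite /rows big1 // => l _; rewrite hN; last by have := ltn_ord l; lia.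
by rewrite cst1_0 mul0r.
Qed.

Let Vlow j l : (j < l)%N -> (V ^+ j) l = 0.
Proof.
elim: j l => [|j IH] l jl; first by rewrite expr0 ps1E; case: l jl.
rewrite exprS psME; case: l jl => // l jl.
rewrite big_ord_recl big_ord_recl big1 ?addr0 /= => [|i _].
  by rewrite !IH ?mulr0 ?addr0 // /bump /=; lia.
by rewrite /V /= mul0r.
Qed.
Let Vtop j : (V ^+ j) j = 1.
Proof.
elim: j => [|j IH] //; rewrite exprS psME.
rewrite big_ord_recl big_ord_recl big1 ?addr0 /= => [|i _].
  by rewrite Vlow ?mulr0 ?add0r /V /= ?/bump ?subSS ?subn0 ?IH ?mul1r //; lia.
by rewrite /V /= mul0r.
Qed.

(** The order of vanishing along the exceptional divisor of a blowing-up is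
    the multiplicity at its centre: the coefficient of u^k in the transform is
    the homogeneous part of degree k evaluated at (1, v + c), and a binary form
    is determined by this polynomial in v. *)
Lemma vanish_chart k h : vanish k (pb (chart (Some c)) h) <-> vanish2 k h.
Proof.
rewrite rowsE; split=> [hk i j ij|hk i ik].
  have := hk _ ij; rewrite /rows.
  set a := fun l => h (i + j - l)%N l.
  have indep M : (\sum_(l < M) cst1 (a l) * V ^+ l = 0) -> forall l, (l < M)%N -> a l = 0.
    elim: M => // M IH E1.
    have aM : a M = 0.
      move/(congr1 (fun p : S1 => p M)): E1; rewrite ps_sumE big_ord_recr /=.
      rewrite big1 ?add0r => [|l _]; last by rewrite cst1ME Vlow ?mulr0.
      by rewrite cst1ME Vtop mulr1.
    move=> l; rewrite ltnS leq_eqVlt => /orP [/eqP -> //|]; apply: IH.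
    move: E1; rewrite big_ord_recr /= aM.
    by rewrite cst1_0 mul0r addr0.
  by move=> /indep /(_ j); rewrite /a addnK; apply; lia.
rewrite /rows big1 // => l _; rewrite hk; last by have := ltn_ord l; lia.
by rewrite cst1_0 mul0r.
Qed.
End ChartRows.

Lemma mu_chart_noncorner c i j h : c <> 0 -> mu i j h ->
  mu (i + j) 0 (pb (chart (Some c)) h).
Proof.
move=> c0 mh; have := mu_pb (chart_centred (Some c)) mh.
move=> /(_ 1%N 0%N 1%N 0%N); rewrite !mul1n !mul0n; apply.
  exact: mu_mon.
exists (cmon 1 0 1 + cmon c 0 0); first by rewrite !psDE /cmon /= add0r.
by rewrite mulrDr !cmonM !mul1r.
Qed.

Lemma mu_sharp i h : mu i 0 h -> sharp i h.
Proof.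
move=> [U u0 ->]; split=> [k ki|].
  apply/funext => j; rewrite cmon_mulE ifF //; lia.
by rewrite cmon_mulE leqnn /= subnn mul1r.
Qed.

End Orders.

(** * Convergence *)

Section Convergence.
Variable R : realType.
Local Notation K := R[i].
Local Notation S1 := (ps K).
Local Notation S2 := (ps (ps K)).
Local Notation arc := (S1 * S1)%type.
Local Notation map2 := (S2 * S2)%type.
Implicit Types (p q : S1) (f h : S2) (r s : K).

(** The complex numbers are only partially ordered, so that a product divided
    by a sum replaces the minimum. *)
Lemma common_lower r s : 0 < r -> 0 < s -> exists t, [/\ 0 < t, t <= r & t <= s].
Proof.
move=> r0 s0; exists (r * s / (r + s)); split.
- by rewrite divr_gt0 ?mulr_gt0 ?addr_gt0.
- rewrite ler_pdivrMr ?addr_gt0 //; apply: ler_wpM2l; first exact: ltW.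
  by rewrite lerDr ltW.
- rewrite ler_pdivrMr ?addr_gt0 // mulrC; apply: ler_wpM2l; first exact: ltW.
  by rewrite lerDl ltW.
Qed.

Lemma half_powers k : (k.+1%:R : K) * 2^-1 ^+ k <= 1.
Proof.
elim: k => [|k IH]; first by rewrite expr0 mulr1.
rewrite exprSr mulrA ler_pdivrMr ?ltr0n // mul1r.
apply: le_trans (_ : (k.+1%:R * 2%:R) * 2^-1 ^+ k <= _); last first.
  by rewrite mulrAC ler_piMl // ler0n.
rewrite ler_wpM2r ?exprn_ge0 ?invr_ge0 ?ler0n //.
by rewrite -natrM ler_nat; lia.
Qed.

Let geom_mul (A B : nat -> K) (cA cB : K) n :
  (forall k, (k <= n)%N -> 0 <= A k <= cA * 2^-1 ^+ k) ->
  (forall k, (k <= n)%N -> 0 <= B k <= cB * 2^-1 ^+ k) ->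
  \sum_(a < n.+1) A a * B (n - a)%N <= cA * cB.
Proof.
move=> HA HB.
have cA0 : 0 <= cA.
  by have /andP [h1 h2] := HA 0%N isT; rewrite expr0 mulr1 in h2; apply: le_trans h2.
have cB0 : 0 <= cB.
  by have /andP [h1 h2] := HB 0%N isT; rewrite expr0 mulr1 in h2; apply: le_trans h2.
apply: le_trans (_ : \sum_(a < n.+1) cA * cB * 2^-1 ^+ n <= _).
  apply: ler_sum => a _; have an : (a <= n)%N by have := ltn_ord a; lia.
  have bn : (n - a <= n)%N by lia.
  have /andP [a0 a1] := HA _ an; have /andP [b0 b1] := HB _ bn.
  apply: le_trans (ler_pM a0 b0 a1 b1) _.
  by rewrite mulrACA -exprD subnKC.
rewrite sumr_const card_ord -[_ *+ n.+1]mulr_natr -[_ * n.+1%:R]mulrA.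
apply: ler_piMr; first exact: mulr_ge0.
by rewrite mulrC half_powers.
Qed.

Lemma conv1_cst c : convergent1 (cst1 c : S1).
Proof.
exists 1, `|c|; split=> // k; rewrite expr1n mulr1 /cst1; case: ifP => _ //.
by rewrite normr0.
Qed.

Let ler_radius (x : K) (r s : K) k c : 0 < s -> s <= r -> `|x| * r ^+ k <= c ->
  `|x| * s ^+ k <= c.
Proof.
move=> s0 sr; apply: le_trans; rewrite ler_wpM2l // lerXn2r // nnegrE ltW //.
exact: lt_le_trans sr.
Qed.

Lemma conv1D p q : convergent1 p -> convergent1 q -> convergent1 (p + q).
Proof.
move=> [r [c [r0 rc]]] [s [d [s0 sd]]]; have [t [t0 tr ts]] := common_lower r0 s0.
exists t, (c + d); split=> // k; rewrite psDE.
apply: le_trans (_ : (`|p k| + `|q k|) * t ^+ k <= _).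
  by apply: ler_wpM2r; [apply/exprn_ge0/ltW | exact: ler_normD].
rewrite mulrDl lerD //; [exact: ler_radius (rc k) | exact: ler_radius (sd k)].
Qed.

Lemma conv1M p q : convergent1 p -> convergent1 q -> convergent1 (p * q).
Proof.
move=> [r [c [r0 rc]]] [s [d [s0 sd]]]; have [t [t0 tr ts]] := common_lower r0 s0.
exists (t / 2%:R), (c * d); split; first by rewrite divr_gt0 ?ltr0n.
move=> k; rewrite psME.
have t2 : 0 <= t / 2%:R by rewrite ltW // divr_gt0 ?ltr0n.
pose A a := `|p a| * (t / 2%:R) ^+ a; pose B a := `|q a| * (t / 2%:R) ^+ a.
apply: le_trans (_ : \sum_(a < k.+1) A a * B (k - a)%N <= _); last first.
  have h0 a : 0 <= (2^-1 : K) ^+ a by rewrite exprn_ge0 // invr_ge0 ler0n.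
  apply: geom_mul => a _; rewrite /A /B exprMn mulrA; apply/andP; split;
    try (by rewrite !mulr_ge0 // exprn_ge0 // ltW); apply: ler_wpM2r => //.
    exact: ler_radius (rc a).
  exact: ler_radius (sd a).
rewrite -ler_pdivlMr ?exprn_gt0 ?divr_gt0 ?ltr0n //.
apply: le_trans (ler_norm_sum _ _ _) _; rewrite mulr_suml; apply: ler_sum => a _.
rewrite ler_pdivlMr ?exprn_gt0 ?divr_gt0 ?ltr0n // normrM /A /B.
by rewrite mulrACA -exprD subnKC //; have := ltn_ord a; lia.
Qed.

Lemma conv2D f h : convergent2 f -> convergent2 h -> convergent2 (f + h).
Proof.
move=> [r [c [r0 rc]]] [s [d [s0 sd]]]; have [t [t0 tr ts]] := common_lower r0 s0.
exists t, (c + d); split=> // i j; rewrite !psDE.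
apply: le_trans (_ : (`|f i j| + `|h i j|) * t ^+ (i + j) <= _).
  by apply: ler_wpM2r; [apply/exprn_ge0/ltW | exact: ler_normD].
rewrite mulrDl lerD //; [exact: ler_radius (rc i j) | exact: ler_radius (sd i j)].
Qed.

Lemma conv2_cmon (c : K) a b : convergent2 (cmon c a b : S2).
Proof.
exists 1, `|c|; split=> // i j; rewrite expr1n mulr1 /cmon; case: ifP => _ //.
by rewrite normr0.
Qed.

Lemma conv2M f h : convergent2 f -> convergent2 h -> convergent2 (f * h).
Proof.
move=> [r [c [r0 rc]]] [s [d [s0 sd]]]; have [t [t0 tr ts]] := common_lower r0 s0.
exists (t / 2%:R), (c * d); split; first by rewrite divr_gt0 ?ltr0n.
move=> i j; rewrite ps2ME.
have c0 : 0 <= c by apply: le_trans (rc 0%N 0%N); rewrite mulr_ge0 // exprn_ge0 // ltW.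
have d0 : 0 <= d by apply: le_trans (sd 0%N 0%N); rewrite mulr_ge0 // exprn_ge0 // ltW.
have t2 : 0 <= t / 2%:R by rewrite ltW // divr_gt0 ?ltr0n.
rewrite -ler_pdivlMr ?exprn_gt0 ?divr_gt0 ?ltr0n //.
apply: le_trans (_ : \sum_(a < i.+1) \sum_(b < j.+1)
    (c / t ^+ (a + b)) * (d / t ^+ ((i - a) + (j - b))) <= _).
  apply: le_trans (ler_norm_sum _ _ _) _; apply: ler_sum => a _.
  apply: le_trans (ler_norm_sum _ _ _) _; apply: ler_sum => b _.
  rewrite normrM ler_pM // ler_pdivlMr ?exprn_gt0 //.
    exact: ler_radius (rc a b).
  exact: ler_radius (sd _ _).
apply: le_trans (_ : \sum_(a < i.+1) \sum_(b < j.+1) c * d / t ^+ (i + j) <= _).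
  apply: ler_sum => a _; apply: ler_sum => b _; rewrite mulrACA -invfM -exprD.
  have -> // : (a + b + (i - a + (j - b)) = i + j)%N.
  by have := ltn_ord a; have := ltn_ord b; lia.
have x0 : 0 <= c * d / t ^+ (i + j).
  by rewrite !mulr_ge0 // invr_ge0; exact/exprn_ge0/ltW.
have -> : c * d / (t / 2%:R) ^+ (i + j) = c * d / t ^+ (i + j) * (2 ^ (i + j))%:R.
  by rewrite expr_div_n invfM invrK natrX mulrA.
move: (c * d / t ^+ (i + j)) x0 => x x0.
rewrite !sumr_const !card_ord -mulrnA -[x *+ _]mulr_natr; apply: ler_wpM2l => //.
by rewrite ler_nat expnD mulnC; apply: leq_mul; exact: ltn_expl.
Qed.

End Convergence.

(** * Composition and inversion of series in one variable *)

Section OneVariable.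
Variable R : realType.
Local Notation K := R[i].
Local Notation S1 := (ps K).
Local Notation S2 := (ps (ps K)).
Local Notation arc := (S1 * S1)%type.
Local Notation ord1 := (@Defs.ord1 R).
Implicit Types (p q tau f : S1) (h : S2) (g : arc) (r s : K).

Definition cmp p tau : S1 := comp11 p tau.
Definition varX : S1 := fun k => (k == 1%N)%:R.

Lemma varXn_mulE n q i : (varX ^+ n * q) i = if (n <= i)%N then q (i - n)%N else 0.
Proof.
elim: n i => [|n IH] i; first by rewrite expr0 mul1r subn0.
rewrite exprS -mulrA psME; case: i => [|i]; first by rewrite big_ord1 /varX /= mul0r.
rewrite big_ord_recl big_ord_recl big1 ?addr0 => [|l _].
  by rewrite /varX /= mul0r add0r mul1r /bump /= !subSS subn0 IH.
by rewrite /varX /= mul0r.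
Qed.

(** A series in t is a series in (t, v) which does not depend on v; this
    reduces composition to evaluation on the arc (tau, 0). *)
Definition emb p : S2 := fun i => cst1 (p i).

Lemma embD p q : emb (p + q) = emb p + emb q.
Proof.
apply/funext => i; apply/funext => j; rewrite /emb !psDE /cst1.
by case: ifP; rewrite ?addr0.
Qed.

Lemma embM p q : emb (p * q) = emb p * emb q.
Proof.
apply/funext => i; rewrite /emb !psME; apply/funext => j; rewrite ps_sumE /cst1.
case: j => [|j] /=; last by rewrite big1 // => a _; rewrite cst1ME mulr0.
by apply: eq_bigr => a _; rewrite cst1ME.
Qed.

Lemma ev_emb g p : ev g (emb p) = cmp p g.1.
Proof.
apply/funext => k; rewrite /cmp /comp11 /ev /comp21; apply: eq_bigr => i _.
rewrite big_ord_recl big1 ?addr0 => [|j _]; last by rewrite /emb /cst1 /= mul0r.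
by rewrite mul1E !pow1E /emb /cst1 /= expr0 mulr1.
Qed.
Lemma cmp_ev p tau : cmp p tau = ev (tau, 0) (emb p).
Proof. by rewrite ev_emb. Qed.

Section Cmp.
Variables (tau : S1) (tau0 : tau 0%N = 0).
Let c : centred1 (tau, 0). Proof. by []. Qed.
Lemma cmpD p q : cmp (p + q) tau = cmp p tau + cmp q tau.
Proof. by rewrite !cmp_ev embD evD. Qed.
Lemma cmpM p q : cmp (p * q) tau = cmp p tau * cmp q tau.
Proof. by rewrite !cmp_ev embM evM. Qed.
Lemma cmp_fil N p : vanish N p -> vanish N (cmp p tau).
Proof.
move=> pN; rewrite cmp_ev; apply: ev_fil => // i j ij.
by rewrite /emb /cst1; case: eqP => // j0; apply: pN; lia.
Qed.
Lemma cmp_cst a : cmp (cst1 a) tau = cst1 a.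
Proof.
rewrite cmp_ev (_ : emb _ = cmon a 0 0) ?ev_cmon ?expr0 ?mulr1 //.
by apply/funext => i; apply/funext => j; rewrite /emb /cst1 /cmon; case: i; case: j.
Qed.
Lemma cmp_var : cmp varX tau = tau.
Proof.
rewrite cmp_ev (_ : emb _ = cmon 1 1 0) ?ev_cmon //.
  by rewrite expr0 mulr1 (fil_cst1 (filtered1 R)) mul1r.
apply/funext => i; apply/funext => j; rewrite /emb /cst1 /cmon /varX.
by case: j => [|j]; [case: i => [|[|i]] | rewrite andbF].
Qed.
Lemma cmpX p n : cmp (p ^+ n) tau = cmp p tau ^+ n.
Proof.
elim: n => [|n IH]; last by rewrite !exprS cmpM IH.
by rewrite !expr0 -(fil_cst1 (filtered1 R)) cmp_cst.
Qed.
Lemma cmp0E p : cmp p tau 0%N = p 0%N.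
Proof. by rewrite cmp_ev ev0. Qed.

Lemma cmp_evA g h : centred1 g -> cmp (ev g h) tau = ev (cmp g.1 tau, cmp g.2 tau) h.
Proof.
move=> gc; have gc' : centred1 (cmp g.1 tau, cmp g.2 tau).
  by case: gc => g1 g2; split; rewrite /= cmp0E.
move: h; apply: (sub_eq (filtered1 R)); last exact: ev_subst.
split=> [p q|a i j|N p pN]; first by rewrite evD // cmpD.
  by rewrite ev_cmon // !cmpM !cmpX cmp_cst.
exact/cmp_fil/ev_fil.
Qed.
End Cmp.

Lemma cmpA p tau f : tau 0%N = 0 -> f 0%N = 0 -> cmp (cmp p tau) f = cmp p (cmp tau f).
Proof.
move=> t0 f0; rewrite (cmp_ev p tau) cmp_evA //=.
have -> : cmp 0 f = 0 by have := cmp_cst f0 0; rewrite cst1_0.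
by rewrite -cmp_ev.
Qed.

Lemma cmp_id p : cmp p varX = p.
Proof.
rewrite cmp_ev.
have e : substitution (@cst1 K) (@vanish K) (fun h : S2 => (fun i => h i 0%N) : S1)
    varX 0.
  split=> [f h|a i j|N f fN k kN]; last by apply: fN; rewrite addn0.
    by apply/funext => k; rewrite !psDE.
  apply/funext => k; rewrite -mulrA cst1ME varXn_mulE /cmon; case: j => [|j].
    rewrite expr0 ps1E subn_eq0 eqn_leq andbC.
    by do 2 case: leqP => _ //=; rewrite ?mulr1 ?mulr0.
  by rewrite exprS mul0r andbF ps0E if_same mulr0.
have c : centred1 ((varX, 0) : arc) by [].
by rewrite (sub_eq (filtered1 R) (ev_subst c) e).
Qed.

Lemma ord1_cmp p tau k : tau 0%N = 0 -> tau 1%N != 0 -> ord1 p k -> ord1 (cmp p tau) k.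
Proof.
move=> t0 t1 [pk pv].
have tau1 : ord1 tau 1 by split=> // -[|i].
have [q pE] : exists q, p = varX ^+ k * q.
  exists (fun i => p (i + k)%N); apply/funext => i; rewrite varXn_mulE.
  by case: leqP => ki; [rewrite subnK | rewrite pv].
have q0 : q 0%N <> 0.
  move=> q0; case/eqP: pk; rewrite pE.
  have vX : vanish 1 varX by case.
  have := vanishM_lead (filX (filtered1 R) k vX) (_ : vanish 0 q).
  by rewrite addn0 q0 mulr0; apply.
rewrite pE cmpM // cmpX // cmp_var // -[X in ord1 _ X]addn0 -{2}[k]mul1n.
by apply: ord1M; [exact: ord1X | apply: ord1_unit; rewrite cmp0E].
Qed.

Lemma ord1_cmpE p tau k : tau 0%N = 0 -> tau 1%N != 0 -> ord1 (cmp p tau) k -> ord1 p k.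
Proof.
move=> t0 t1 ck; have [p0|] := pselect (p = 0).
  case: ck => /eqP + _; rewrite p0 -cst1_0 cmp_cst // cst1_0 => [] //.
move=> /ord1_exists [a pa]; have := ord1_cmp t0 t1 pa.
by move=> /(ord1_inj ck) ->.
Qed.

(** ** Majorants *)

Definition partial_norm n r f : K := \sum_(k < n) `|f k| * r ^+ k.

Lemma partial_norm_ge0 n r f : 0 <= r -> 0 <= partial_norm n r f.
Proof. by move=> r0; apply: sumr_ge0 => k _; rewrite mulr_ge0 // exprn_ge0. Qed.

Lemma partial_normD n r f p : 0 <= r ->
  partial_norm n r (f + p) <= partial_norm n r f + partial_norm n r p.
Proof.
move=> r0; rewrite -big_split /=; apply: ler_sum => k _.
by rewrite -mulrDl; apply: ler_wpM2r; [exact: exprn_ge0 | exact: ler_normD].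
Qed.

(** The norm is the value at 1 of a polynomial with nonnegative coefficients;
    the product of two such polynomials bounds the norm of the product. *)
Lemma partial_normM n r f p : 0 <= r ->
  partial_norm n r (f * p) <= partial_norm n r f * partial_norm n r p.
Proof.
move=> r0.
pose P f : {poly K} := \poly_(k < n) (`|f k| * r ^+ k).
have Pge f' k : 0 <= (P f')`_k.
  by rewrite coef_poly; case: ifP => // _; rewrite mulr_ge0 // exprn_ge0.
have PE f' : partial_norm n r f' = (P f').[1].
  by rewrite horner_poly; apply: eq_bigr => k _; rewrite expr1n mulr1.
rewrite !PE -hornerM.
have PM k : 0 <= (P f * P p)`_k.
  by rewrite coefM; apply: sumr_ge0 => a _; rewrite mulr_ge0.
apply: le_trans (_ : \sum_(k < n) (P f * P p)`_k <= _).
  rewrite -PE; apply: ler_sum => k _; rewrite psME coefM.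
  apply: le_trans (_ : (\sum_(a < k.+1) `|f a * p (k - a)%N|) * r ^+ k <= _).
    by apply: ler_wpM2r; [exact: exprn_ge0 | exact: ler_norm_sum].
  rewrite mulr_suml; apply: ler_sum => a _; rewrite !coef_poly.
  have ka := ltn_ord a; have kn := ltn_ord k.
  rewrite !ifT; try lia.
  rewrite normrM mulrACA -exprD subnKC //; lia.
set Q := P f * P p.
have [nQ|Qn] := leqP n (size Q); last first.
  rewrite (@horner_coef_wide _ n) ?(ltnW Qn) //.
  by apply: ler_sum => k _; rewrite expr1n mulr1.
rewrite horner_coef; under [leRHS]eq_bigr => k _ do rewrite expr1n mulr1.
rewrite -(big_mkord xpredT (fun k => Q`_k)) -[leRHS](big_mkord xpredT (fun k => Q`_k)).
rewrite [leRHS](big_cat_nat (n := n)) //= lerDl.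
by apply: sumr_ge0 => k _; exact: PM.
Qed.

Lemma partial_norm1 n r : partial_norm n r 1 <= 1.
Proof.
case: n => [|n]; first by rewrite /partial_norm big_ord0.
rewrite /partial_norm big_ord_recl big1 ?addr0 => [|k _].
  by rewrite ps1E /= normr1 expr0 mulr1.
by rewrite ps1E /= normr0 mul0r.
Qed.

Lemma partial_normX n r f i : 0 <= r -> partial_norm n r (f ^+ i) <= partial_norm n r f ^+ i.
Proof.
move=> r0; elim: i => [|i IH]; first by rewrite !expr0; exact: partial_norm1.
rewrite !exprS; apply: le_trans (partial_normM _ _ _ r0) _.
by apply: ler_wpM2l => //; exact: partial_norm_ge0.
Qed.

Lemma partial_norm_cmp n r p f : 0 <= r ->
  partial_norm n r (cmp p f) <= \sum_(i < n) `|p i| * partial_norm n r f ^+ i.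
Proof.
move=> r0.
apply: le_trans (_ : \sum_(i < n) `|p i| * partial_norm n r (f ^+ i) <= _); last first.
  by apply: ler_sum => i _; apply: ler_wpM2l => //; exact: partial_normX.
under [leRHS]eq_bigr => i _ do rewrite mulr_sumr.
rewrite exchange_big; apply: ler_sum => k _ /=.
have -> : cmp p f k = \sum_(i < k.+1) p i * (f ^+ i) k.
  by rewrite /cmp /comp11; apply: eq_bigr => i _; rewrite pow1E.
apply: le_trans (_ : (\sum_(i < k.+1) `|p i * (f ^+ i) k|) * r ^+ k <= _).
  by apply: ler_wpM2r; [exact: exprn_ge0 | exact: ler_norm_sum].
rewrite mulr_suml.
rewrite -(big_mkord xpredT (fun i => `|p i * (f ^+ i) k| * r ^+ k)).
rewrite -(big_mkord xpredT (fun i => `|p i| * (`|(f ^+ i) k| * r ^+ k))).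
rewrite [leRHS](big_cat_nat (n := k.+1)) //=.
rewrite -[leLHS]addr0; apply: lerD.
  by apply: ler_sum => i _; rewrite normrM mulrA.
by apply: sumr_ge0 => i _; rewrite !mulr_ge0 // exprn_ge0.
Qed.

Lemma geom_bound (x : K) n : 0 <= x -> x <= 2^-1 -> \sum_(i < n) x ^+ i <= 2%:R.
Proof.
move=> x0 x2.
suff H : \sum_(i < n) x ^+ i <= 2%:R - 2%:R * 2^-1 ^+ n.
  by apply: le_trans H _; rewrite lerBlDr lerDl mulr_ge0 // exprn_ge0 // invr_ge0.
elim: n => [|n IH]; first by rewrite big_ord0 expr0 mulr1 subrr.
rewrite big_ord_recr /=.
apply: le_trans (lerD IH (_ : x ^+ n <= 2^-1 ^+ n)) _.
  by apply: lerXn2r => //; rewrite nnegrE ?invr_ge0.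
have -> : 2%:R * 2^-1 ^+ n.+1 = 2^-1 ^+ n :> K by rewrite exprS mulrA divff ?mul1r // pnatr_eq0.
by rewrite mulr_natl mulr2n opprD !addrA addrNK.
Qed.

(** Without constant term, [tau] has small norm on small discs, so that [p]
    converges at this norm. *)
Lemma conv1_cmp p tau : convergent1 p -> convergent1 tau -> tau 0%N = 0 ->
  convergent1 (cmp p tau).
Proof.
move=> [r [c [r0 rc]]] [s [d [s0 sd]]] t0.
have d0 : 0 <= d by apply: le_trans (sd 0%N); rewrite mulr_ge0 // exprn_ge0 // ltW.
have c0 : 0 <= c by apply: le_trans (rc 0%N); rewrite mulr_ge0 // exprn_ge0 // ltW.
have [t [t_gt0 ts tr]] : exists t, [/\ 0 < t, t <= s / 2%:R & t <= r * s / (4%:R * d + 1)].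
  apply: common_lower; first by rewrite divr_gt0.
  by rewrite divr_gt0 ?mulr_gt0 // ltr_wpDl // mulr_ge0.
have ts2 : t / s <= 2^-1 by rewrite ler_pdivrMr // mulrC.
have ts0 : 0 <= t / s by rewrite ltW // divr_gt0.
have tau_k j : `|tau j| * t ^+ j <= d * (t / s) ^+ j.
  rewrite expr_div_n [leRHS]mulrA [leRHS]mulrAC; apply: ler_wpM2r.
    exact/exprn_ge0/ltW.
  by rewrite ler_pdivlMr ?exprn_gt0.
have tau_norm n : partial_norm n t tau <= r / 2%:R.
  case: n => [|n]; first by rewrite /partial_norm big_ord0 ltW // divr_gt0.
  rewrite /partial_norm big_ord_recl t0 normr0 mul0r add0r.
  apply: le_trans (_ : \sum_(k < n) d * (t / s) * (t / s) ^+ k <= _).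
    by apply: ler_sum => k _; rewrite -mulrA -exprS lift0; exact: tau_k.
  rewrite -mulr_sumr; apply: le_trans (_ : d * (t / s) * 2%:R <= _).
    by apply: ler_wpM2l; [rewrite mulr_ge0 | exact: geom_bound].
  rewrite ler_pdivlMr // -!mulrA -natrM.
  move: tr; rewrite ler_pdivlMr ?ltr_wpDl ?mulr_ge0 // => tr.
  have : t * (4%:R * d) <= r * s.
    by apply: le_trans tr; apply: ler_wpM2l; [exact: ltW | rewrite lerDl].
  rewrite -ler_pdivrMr // => h; apply: le_trans h.
  by rewrite le_eqVlt; apply/orP; left; apply/eqP; field; rewrite gt_eqF.
exists t, (c * 2%:R); split=> // k.
have t_ge0 := ltW t_gt0.
apply: le_trans (_ : partial_norm k.+1 t (cmp p tau) <= _).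
  rewrite /partial_norm big_ord_recr /= lerDr; exact: partial_norm_ge0.
apply: le_trans (partial_norm_cmp _ _ _ t_ge0) _.
apply: le_trans (_ : \sum_(i < k.+1) c * 2^-1 ^+ i <= _); last first.
  by rewrite -mulr_sumr; apply: ler_wpM2l => //; apply: geom_bound; rewrite ?invr_ge0.
apply: ler_sum => i _; apply: le_trans (_ : `|p i| * (r / 2%:R) ^+ i <= _).
  apply: ler_wpM2l => //; apply: lerXn2r; rewrite ?nnegrE //.
    exact: partial_norm_ge0.
  by rewrite ltW // divr_gt0.
by rewrite exprMn mulrA; apply: ler_wpM2r; [rewrite exprn_ge0 // invr_ge0 | exact: rc].
Qed.

End OneVariable.

Section Inverse.
Variable R : realType.
Local Notation K := R[i].
Local Notation S1 := (ps K).
Local Notation ord1 := (@Defs.ord1 R).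
Local Notation varX := (varX R).
Variable g : S1.
Hypotheses (g_conv : convergent1 g) (g0 : g 0%N = 0) (g1 : g 1%N != 0).

(** The inverse series is the fixed point of tau |-> (t - g2(tau)) / g'(0)
    where g2 collects the terms of degree at least two; the map contracts both
    the t-adic distance and a small ball for the norm of coefficients. *)
Let a := g 1%N.
Let g2 : S1 := g - cst1 a * varX.
Let step (f : S1) : S1 := cst1 a^-1 * (varX - cmp g2 f).

Let g2_van : vanish 2 g2.
Proof.
move=> [|[|k]] // _; rewrite /g2 psBE cst1ME /varX /=.
  by rewrite mulr0 subr0.
by rewrite mulr1 subrr.
Qed.

Let vW M N (f : S1) : (M <= N)%N -> vanish N f -> vanish M f.
Proof. by move=> MN fN k kM; apply: fN; lia. Qed.

Let step_contract N (f f' : S1) : vanish 1 f -> vanish 1 f' -> vanish N (f - f') ->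
  vanish N.+1 (step f - step f').
Proof.
move=> f1 f'1 ff'; have -> : step f - step f' = cst1 a^-1 * (cmp g2 f' - cmp g2 f).
  by rewrite /step; ring.
have H : vanish N.+1 (cmp g2 f' - cmp g2 f).
  move=> k kN; rewrite psBE /cmp /comp11 -sumrB big1 // => i _; rewrite -mulrBr !pow1E.
  case: (nat_of_ord i) => [|[|{}i]]; [by rewrite g2_van ?mul0r | by rewrite g2_van ?mul0r |].
  have -> : (f' ^+ i.+2) k - (f ^+ i.+2) k = (f' ^+ i.+2 - f ^+ i.+2) k by [].
  rewrite -opprB subrXX psNE; set s := \sum_(_ < _) _.
  have -> : ((f - f') * s) k = 0; last by rewrite oppr0 mulr0.
  have s1 : vanish 1 s.
    move=> j j1; rewrite /s ps_sumE big1 // => l _.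
    have [l0|l0] := eqVneq (l : nat) 0%N.
      apply: (vanishM (a := 1) (b := 0)) => //.
      by apply: (vW _ (filX (filtered1 R) _ f1)); rewrite l0.
    apply: (vanishM (a := 0) (b := 1)) => //.
    by apply: (vW _ (filX (filtered1 R) _ f'1)); rewrite lt0n.
  by apply: (vanishM ff' s1); lia.
by apply: (vanishM (a := 0) (b := N.+1)).
Qed.

Let step_van (f : S1) : vanish 1 f -> vanish 1 (step f).
Proof.
move=> f1; apply: (vanishM (a := 0) (b := 1)) => // k k1.
have k0 : k = 0%N by lia.
by rewrite k0 psBE cmp0E // ?g2_van ?subr0 //; exact: f1.
Qed.

Let s N := iter N step 0.
Let s_van N : vanish 1 (s N).
Proof. by elim: N => // N IH; exact: step_van. Qed.
Let s_stab N : vanish N.+1 (s N.+1 - s N).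
Proof.
elim: N => [|N IH]; first by rewrite /s /= subr0; exact: step_van.
exact (step_contract (s_van N.+1) (s_van N) IH).
Qed.
Let tau : S1 := fun k => s k k.
Let tau_s N k : (k <= N)%N -> s N k = tau k.
Proof.
elim: N => [|N IH] kN; first by rewrite (_ : k = 0%N) //; lia.
have [E|kN'] := eqVneq k N.+1; first by rewrite E.
rewrite -IH; last lia.
have kN1 : (k < N.+1)%N by lia.
by have /eqP := @s_stab N k kN1; rewrite psBE subr_eq0 => /eqP.
Qed.
Let tau_van : vanish 1 tau.
Proof. by move=> k k1; have := s_van k k1. Qed.

Let tau_fix : step tau = tau.
Proof.
apply/funext => k; rewrite -(tau_s (leqnSn k)) /s iterS -/(s k).
have H : vanish k.+1 (tau - s k) by move=> i ik; rewrite psBE tau_s ?subrr.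
have kk : (k < k.+2)%N by lia.
have /eqP := @step_contract _ _ _ tau_van (@s_van k) H k kk.
by rewrite psBE subr_eq0 => /eqP.
Qed.

Let tau_right : cmp g tau = varX.
Proof.
have t0 : tau 0%N = 0 by apply: tau_van.
have -> : g = g2 + cst1 a * varX by rewrite /g2 subrK.
rewrite cmpD // cmpM // cmp_cst // cmp_var // -{2}tau_fix /step mulrA.
rewrite -(fil_cstM (filtered1 R)) divff // (fil_cst1 (filtered1 R)) mul1r.
by rewrite addrC subrK.
Qed.

Let tau_1 : tau 1%N != 0.
Proof.
apply/eqP => t1; have t2 : vanish 2 tau by move=> [|[|k]] // _; exact: tau_van.
have : (cmp g tau) 1%N = 0.
  rewrite /cmp /comp11 !big_ord_recl big_ord0 !pow1E /= g0 mul0r add0r addr0.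
  by rewrite /bump /= expr1 t1 mulr0.
by rewrite tau_right /varX /= => /eqP; rewrite oner_eq0.
Qed.

Let tau_conv : convergent1 tau.
Proof.
have [rho [c [rho0 rc]]] := g_conv.
have c0 : 0 <= c by apply: le_trans (rc 0%N); rewrite mulr_ge0 // ?exprn_ge0 // ltW.
have a0 : 0 < `|a| by rewrite normr_gt0.
have c41 : 0 < 4%:R * c + 1 by rewrite ltr_wpDl // mulr_ge0.
have [B [B0 B1 B2]] : exists B, [/\ 0 < B, B <= rho / 2%:R &
    B <= `|a| * rho ^+ 2 / (4%:R * c + 1)].
  by apply: common_lower; rewrite divr_gt0 ?mulr_gt0 ?exprn_gt0.
pose r := `|a| * B / 2%:R.
have r0 : 0 < r by rewrite divr_gt0 ?mulr_gt0.
have x0 : 0 <= B / rho by rewrite ltW // divr_gt0.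
have x2 : B / rho <= 2^-1 by rewrite ler_pdivrMr // mulrC.
have main : `|a|^-1 * (r + c * ((B / rho) ^+ 2 * 2%:R)) <= B.
  rewrite mulrC ler_pdivrMr // /r.
  have h : 4%:R * c * B <= `|a| * rho ^+ 2.
    move: B2; rewrite ler_pdivlMr // mulrC; apply: le_trans.
    by apply: ler_wpM2r; [exact: ltW | rewrite lerDl].
  have h' : c * ((B / rho) ^+ 2 * 2%:R) <= B * `|a| / 2%:R.
    rewrite expr_div_n mulrAC mulrA ler_pdivrMr ?exprn_gt0 //.
    have -> : c * (B ^+ 2 * 2%:R) = 4%:R * c * B * (B / 2%:R).
      by field.
    have -> : B * `|a| / 2%:R * rho ^+ 2 = `|a| * rho ^+ 2 * (B / 2%:R).
      by field.
    by apply: ler_wpM2r => //; rewrite ltW // divr_gt0.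
  apply: le_trans (lerD (lexx _) h') _; rewrite le_eqVlt; apply/orP; left.
  by apply/eqP; field.
have norm_cst n (b : K) (f : S1) : partial_norm n r (cst1 b * f) = `|b| * partial_norm n r f.
  rewrite /partial_norm mulr_sumr; apply: eq_bigr => k _.
  by rewrite cst1ME normrM mulrA.
have norm_s N n : partial_norm n r (s N) <= B.
  elim: N n => [|N IH] n.
    by rewrite /partial_norm big1 ?(ltW B0) // => k _; rewrite normr0 mul0r.
  rewrite /s iterS -/(s N) norm_cst normfV; apply: le_trans main.
  apply: ler_wpM2l; first by rewrite invr_ge0.
  apply: le_trans (partial_normD _ _ _ (ltW r0)) _; apply: lerD.
    case: n => [|[|n]]; rewrite /partial_norm ?big_ord0 ?(ltW r0) //.
      by rewrite big_ord1 /varX /= normr0 mul0r ltW.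
    rewrite !big_ord_recl big1 => [|k _]; last by rewrite /varX /= normr0 mul0r.
    by rewrite /varX /bump /= normr0 mul0r normr1 mul1r add0r addr0 expr1.
  have -> : partial_norm n r (- cmp g2 (s N)) = partial_norm n r (cmp g2 (s N)).
    by apply: eq_bigr => k _; rewrite psNE normrN.
  apply: le_trans (partial_norm_cmp _ _ _ (ltW r0)) _.
  have -> : c * ((B / rho) ^+ 2 * 2%:R) = c * (B / rho) ^+ 2 * 2%:R by rewrite mulrA.
  apply: le_trans (_ : \sum_(i < n.-2) c * (B / rho) ^+ 2 * (B / rho) ^+ i <= _); last first.
    rewrite -mulr_sumr; apply: ler_wpM2l; last exact: geom_bound.
    by apply: mulr_ge0 => //; exact: exprn_ge0.
  have le0 : 0 <= \sum_(i < n.-2) c * (B / rho) ^+ 2 * (B / rho) ^+ i.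
    apply: sumr_ge0 => i _; apply: mulr_ge0; last exact: exprn_ge0.
    by apply: mulr_ge0 => //; exact: exprn_ge0.
  case: n le0 => [|[|n]] le0 //=; first by rewrite !big_ord0.
    by rewrite big_ord1 g2_van // normr0 mul0r big_ord0.
  rewrite big_ord_recl big_ord_recl /= !g2_van // normr0 !mul0r !add0r.
  apply: ler_sum => i _; rewrite /bump /= !add1n.
  have -> : g2 i.+2 = g i.+2 by rewrite /g2 psBE cst1ME /varX /= mulr0 subr0.
  apply: le_trans (_ : `|g i.+2| * B ^+ i.+2 <= _).
    apply: ler_wpM2l => //; apply: lerXn2r => //; rewrite nnegrE ?(ltW B0) //.
    exact/partial_norm_ge0/ltW.
  have -> : c * (B / rho) ^+ 2 * (B / rho) ^+ i = c * B ^+ i.+2 / rho ^+ i.+2.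
    by rewrite -[LHS]mulrA -exprD add2n expr_div_n mulrA.
  rewrite ler_pdivlMr ?exprn_gt0 //.
  rewrite mulrAC; apply: ler_wpM2r; [exact/exprn_ge0/ltW | exact: rc].
exists r, B; split=> // k; rewrite /tau.
apply: le_trans (norm_s k k.+1); rewrite /partial_norm big_ord_recr /= lerDr.
exact/partial_norm_ge0/ltW.
Qed.

Lemma right_inverse : exists t : S1,
  [/\ convergent1 t, t 0%N = 0, t 1%N != 0 & cmp g t = varX].
Proof. by exists tau; split=> //; exact: tau_van. Qed.
End Inverse.

Lemma inverse_series (R : realType) (g : ps R[i]) :
  convergent1 g -> g 0%N = 0 -> g 1%N != 0 ->
  exists t : ps R[i], [/\ convergent1 t, t 0%N = 0 & cmp t g = varX R].
Proof.
move=> gc g0 g1; have [t [tc t0 t1 gt]] := right_inverse gc g0 g1.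
have [u [uc u0 u1 tu]] := right_inverse tc t0 t1.
have gu : g = u by rewrite -[LHS]cmp_id -tu -cmpA // gt cmp_var.
by exists t; split=> //; rewrite gu.
Qed.

(** * Infinitely near points of a cusp *)

Section NearPoints.
Variable R : realType.
Local Notation K := R[i].
Local Notation S1 := (ps K).
Local Notation S2 := (ps (ps K)).
Local Notation arc := (S1 * S1)%type.
Local Notation map2 := (S2 * S2)%type.
Local Notation ord1 := (@Defs.ord1 R).
Implicit Types (p q tau : S1) (f h psi : S2) (g C : arc) (P : seq (direction R)).

Definition conv_arc g := convergent1 g.1 /\ convergent1 g.2.

Lemma map_chart_some c g : centred1 g ->
  map_arc (chart (Some c)) g = (g.1, g.1 * (g.2 + cst1 c)).
Proof.
move=> gc; rewrite /map_arc /= evD // !ev_cmon // !expr0 !expr1 !(fil_cst1 (filtered1 R)).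
by congr pair; ring.
Qed.
Lemma map_chart_none g : centred1 g -> map_arc (chart None) g = (g.1 * g.2, g.2).
Proof.
move=> gc; rewrite /map_arc /= !ev_cmon // !expr0 !expr1 !(fil_cst1 (filtered1 R)).
by congr pair; ring.
Qed.

Lemma map_blowup_cons d P g : centred1 g ->
  map_arc (blowup (d :: P)) g = map_arc (chart d) (map_arc (blowup P) g).
Proof.
by move=> gc; rewrite /= map_arcA //; [exact: chart_centred | exact: blowup_centred].
Qed.

Lemma blowup_arc_centred P g : centred1 g -> centred1 (map_arc (blowup P) g).
Proof. by move=> gc; apply: map_arc_centred => //; exact: blowup_centred. Qed.

Lemma blowup_arc_conv P g : centred1 g -> conv_arc g -> conv_arc (map_arc (blowup P) g).
Proof.
move=> gc gv; elim: P => [|d P [IH1 IH2]]; first by rewrite /= -ev_id.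
rewrite map_blowup_cons //; have gPc := blowup_arc_centred P gc.
case: d => [c|]; rewrite ?map_chart_some ?map_chart_none //; split=> //=.
  by apply: conv1M => //; apply: conv1D => //; exact: conv1_cst.
exact: conv1M.
Qed.

Lemma strict_arcE P C g : strict_arc P C g ->
  [/\ centred1 g, conv_arc g & C = map_arc (blowup P) g].
Proof. by rewrite /strict_arc blowup_mapE => -[[g1 g2 g10 g20] e]. Qed.

Lemma ev_lin g h : centred1 g -> ev g h 1%N = h 1%N 0%N * g.1 1%N + h 0%N 1%N * g.2 1%N.
Proof.
move=> [g10 g20]; rewrite /ev /comp21 !big_ord_recl !big_ord0 !mul1E !pow1E /=.
rewrite /bump /= !expr0 !expr1 !mul1r !mulr1 ps1E /= !mulr0 !addr0 add0r.
rewrite [(_ * _ : S1) 1%N]psME !big_ord_recl big_ord0 g10 /bump /= subnn g20.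
by rewrite mul0r mulr0 !addr0 mulr0 addr0 addrC.
Qed.

Lemma ord1_1P p : p 0%N = 0 -> p 1%N <> 0 -> ord1 p 1.
Proof. by move=> p0 /eqP p1; split=> // -[|i]. Qed.

(** The linear part of [x] vanishes on the tangent of the arc, that of [y] is
    the one of the divisor up to a factor, and they are independent: hence there
    is at most one component, and the arc is transversal to it. *)
Lemma normal_crossings_arc C P : curve_normal_crossings C P ->
  exists g, [/\ centred1 g, conv_arc g, C = map_arc (blowup P) g, nonsingular_arc g &
    [/\ ~~ corner P, (divisor P).1 -> ord1 g.1 1 & (divisor P).2 -> ord1 g.2 1]].
Proof.
move=> [g [x [y [/strict_arcE [gc gv Cg] ns [_ _ x0 y0 det] xg [k _ yE]]]]].
exists g; split=> //.
have {}yE : y = (k : S2) * cmon 1 (divisor P).1 (divisor P).2.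
  by rewrite yE mul2E /divisor_eq mon2E.
have y10 : y 1%N 0%N = if (divisor P).2 then 0 else
    if (divisor P).1 then k 0%N 0%N else k 1%N 0%N.
  rewrite yE mulrC cmon_mulE mul1r.
  by case: (divisor P).1; case: (divisor P).2.
have y01 : y 0%N 1%N = if (divisor P).1 then 0 else
    if (divisor P).2 then k 0%N 0%N else k 0%N 1%N.
  rewrite yE mulrC cmon_mulE mul1r.
  by case: (divisor P).1; case: (divisor P).2.
have lin : x 1%N 0%N * g.1 1%N + x 0%N 1%N * g.2 1%N = 0.
  by have := ev_lin x gc; have -> : ev g x 1%N = 0 := xg 1%N.
rewrite /corner; split.
- apply/negP => /andP [D1 D2]; move: det; rewrite y10 y01 D1 D2 !mulr0 subrr.
  by rewrite eqxx.
- move=> D1; have [g10 g20] := gc; apply: ord1_1P => // g11.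
  move: det; rewrite y10 y01 D1 mulr0 sub0r oppr_eq0 => det.
  have x01 : x 0%N 1%N != 0 by apply: contraNneq det => ->; rewrite mul0r.
  move: lin; rewrite g11 mulr0 add0r => /eqP; rewrite mulf_eq0 (negbTE x01) /= => /eqP g21.
  by case: ns; rewrite ?g11 ?g21 eqxx.
move=> D2; have [g10 g20] := gc; apply: ord1_1P => // g21.
move: det; rewrite y10 y01 D2 mulr0 subr0 => det.
have x10 : x 1%N 0%N != 0 by apply: contraNneq det => ->; rewrite mul0r.
move: lin; rewrite g21 mulr0 addr0 => /eqP; rewrite mulf_eq0 (negbTE x10) /= => /eqP g11.
by case: ns; rewrite ?g11 ?g21 eqxx.
Qed.

Lemma conv2_emb p : convergent1 p -> convergent2 (emb p : S2).
Proof.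
move=> [r [c [r0 rc]]]; exists r, c; split=> // i j; rewrite /emb /cst1.
have c0 : 0 <= c by apply: le_trans (rc 0%N); rewrite mulr_ge0 // exprn_ge0 // ltW.
by case: j => [|j] /=; [rewrite addn0 | rewrite normr0 mul0r].
Qed.

(** Conversely: solve g.1(t) = u for t, so that the curve is v = phi(u). *)
Lemma normal_crossings_of_transversal C P g : strict_arc P C g ->
  divisor P = (true, false) -> ord1 g.1 1 -> curve_normal_crossings C P.
Proof.
move=> sg DP g1; have [gc [g1v g2v] _] := strict_arcE sg; have [g10 g20] := gc.
have [t [tv t0 tg]] : exists t : S1, [/\ convergent1 t, t 0%N = 0 & cmp t g.1 = varX R].
  by apply: inverse_series => //; case: g1.
pose phi := cmp g.2 t.
exists g, (cmon 1 0 1 - emb phi : S2), (cmon 1 1 0 : S2); split=> //.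
- by left; case: g1.
- have phi0 : phi 0%N = 0 by rewrite /phi cmp0E.
  split.
  + apply: conv2D; first exact: conv2_cmon.
    have [r [c [r0 rc]]] := conv2_emb (conv1_cmp g2v tv t0).
    by exists r, c; split=> // i j; rewrite !psNE normrN.
  + exact: conv2_cmon.
  + by rewrite !psBE /emb /cst1 /cmon /= phi0 subrr.
  + by [].
  rewrite !psBE /emb /cst1 /cmon /= mulr0 subr0 mulr1 sub0r oppr_eq0.
  by rewrite oner_eq0.
- move=> k; rewrite -[comp21 _ _]/(ev g _) evB // ev_emb ev_cmon // expr0 expr1.
  rewrite (fil_cst1 (filtered1 R)) !mul1r /phi cmpA // tg cmp_id.
  by rewrite subrr.
exists (cmon 1 0 0 : S2); first exact: conv2_cmon.
by rewrite mul2E /divisor_eq DP mon2E cmonM mulr1.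
Qed.

(** A function vanishing at the origin is u A + v B; its transform is divisible
    by the equation of the exceptional divisor, and the quotient at a point is
    read on the linear part. *)
Definition quo_u psi : S2 := fun i j => psi i.+1 j.
Definition quo_v psi : S2 := fun i j => if i == 0%N then psi 0%N j.+1 else 0.

Lemma split_uv psi : psi 0%N 0%N = 0 ->
  psi = cmon 1 1 0 * quo_u psi + cmon 1 0 1 * quo_v psi.
Proof.
move=> p0; apply/funext => i; apply/funext => j; rewrite !psDE !cmon_mulE !mul1r.
case: i => [|i] /=; case: j => [|j] /=; rewrite /quo_u /quo_v ?subn0 ?subn1 /= ?addr0 ?add0r //.
Qed.

Lemma pb_some psi c : psi 0%N 0%N = 0 -> exists psi',
  [/\ pb (chart (Some c)) psi = cmon 1 1 0 * psi',
      psi' 0%N 0%N = psi 1%N 0%N + c * psi 0%N 1%N & psi' 0%N 1%N = psi 0%N 1%N].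
Proof.
move=> p0; have cc := chart_centred (Some c).
exists (pb (chart (Some c)) (quo_u psi) + (cmon 1 0 1 + cmon c 0 0) * pb (chart (Some c)) (quo_v psi)).
have row0 h j : pb (chart (Some c)) h 0%N j = if j == 0%N then h 0%N 0%N else 0.
  have h1 : vanish2 1 (h - cmon (h 0%N 0%N) 0 0).
    by apply: vanish2_1; rewrite !psBE /cmon /= subrr.
  have /vanish_chart /(_ 0%N isT) := h1; move=> /(_ c).
  rewrite pbB // pb_cmon // !expr0 !mulr1 psBE => /eqP; rewrite subr_eq0 => /eqP ->.
  by rewrite /cmon.
split.
- rewrite {1}(split_uv p0) pbD // !pbM // !pb_cmon // !expr0 !expr1 cmon1 !mul1r mulr1 /=.
  rewrite mulrDr mulrA; congr (_ + _ * _).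
  by rewrite mulrDr !cmonM !mul1r.
- rewrite !psDE mulrDl !psDE !cmon_mulE /= !row0 /= ?mul0r ?add0r.
  by rewrite /quo_u /quo_v.
rewrite !psDE mulrDl !psDE !cmon_mulE /= !row0 /= mulr0 addr0 add0r mul1r.
by rewrite /quo_v.
Qed.

Lemma pb_none psi : psi 0%N 0%N = 0 -> exists psi',
  [/\ pb (chart None) psi = cmon 1 0 1 * psi',
      psi' 0%N 0%N = psi 0%N 1%N & psi' 1%N 0%N = psi 1%N 0%N].
Proof.
move=> p0; have cc := chart_centred (None : direction R).
have E f : f 0%N 0%N = 0 -> pb (chart None) f = cmon 1 0 1 *
    (cmon 1 1 0 * pb (chart None) (quo_u f) + pb (chart None) (quo_v f)).
  move=> f0; rewrite {1}(split_uv f0) pbD // !pbM // !pb_cmon //.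
  rewrite !expr0 !expr1 cmon1 !mul1r mulr1 /=.
  by rewrite mulrDr mulrA cmonM mulr1.
exists (cmon 1 1 0 * pb (chart None) (quo_u psi) + pb (chart None) (quo_v psi)); split.
- exact: E.
- by rewrite !psDE cmon_mulE /= add0r pb00.
rewrite !psDE cmon_mulE /= mul1r subnn pb00 // /quo_u.
pose B := quo_v psi; rewrite -[quo_v psi]/B.
have -> : pb (chart None) B 1%N 0%N = 0; last by rewrite addr0.
rewrite -[B](subrK (cmon (B 0%N 0%N) 0 0)) pbD // pb_cmon // !expr0 !mulr1 !psDE.
rewrite E; last by rewrite !psBE /cmon /= subrr.
by rewrite cmon_mulE /cmon /= addr0.
Qed.

Lemma jac_chart_some (c : K) : jac (chart (Some c)) = cmon 1 1 0.
Proof.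
rewrite /jac /wdg /= duD dvD !du_cmon !dv_cmon !mulr0n !mulr1n /=.
by rewrite !cmon0 mul0r subr0 addr0 cmon1 mul1r.
Qed.
Lemma jac_chart_none : jac (chart (None : direction R)) = cmon 1 0 1.
Proof.
rewrite /jac /wdg /= !du_cmon !dv_cmon !mulr0n !mulr1n /=.
by rewrite !cmon0 mulr0 subr0 cmon1 mulr1.
Qed.

End NearPoints.

Section Euclid.
Variable R : realType.
Local Notation K := R[i].
Local Notation S1 := (ps K).
Local Notation S2 := (ps (ps K)).
Local Notation arc := (S1 * S1)%type.
Local Notation map2 := (S2 * S2)%type.
Local Notation ord1 := (@Defs.ord1 R).
Implicit Types (p q tau : S1) (f h psi : S2) (g C : arc) (P : seq (direction R)).

Variables (n m : nat) (f1 f2 : S2).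
Hypotheses (co : coprime n m) (n2 : (2 <= n)%N) (nm : (n < m)%N).

(** The Euclidean algorithm along the infinitely near points of a cusp.  As
    long as the divisor has at most one component, it lies in [f1 = 0] and the
    strict transform [psi = 0] of [f2 = 0] is transversal to [f1 = 0];
    afterwards the point is a corner and both functions are monomials up to
    units. *)
Inductive near_state P g : Prop :=
| State_u k e m' psi of mu 1 0 (pb (blowup P) f1) &
    pb (blowup P) f2 = cmon 1 k 0 * psi & psi 0%N 0%N = 0 & psi 0%N 1%N <> 0 &
    mu e 0 (jac (blowup P)) & ord1 g.1 n & ord1 (ev g psi) m' &
    (m = m' + k * n)%N & divisor P = ((0 < k)%N, false)
| State_v k e m' psi of mu 0 1 (pb (blowup P) f1) &
    pb (blowup P) f2 = cmon 1 0 k * psi & psi 0%N 0%N = 0 & psi 1%N 0%N <> 0 &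
    mu 0 e (jac (blowup P)) & ord1 g.2 n & ord1 (ev g psi) m' &
    (m = m' + k * n)%N & divisor P = (false, (0 < k)%N)
| State_corner i j k l a b e e' of mu i j (pb (blowup P) f1) &
    mu k l (pb (blowup P) f2) & mu e e' (jac (blowup P)) &
    divisor P = (true, true) & ord1 g.1 a & ord1 g.2 b &
    (0 < a)%N & (0 < b)%N & (n = i * a + j * b)%N & (m = k * a + l * b)%N.

(** Along an arc transversal to both axes at such a point, [f1] and [f2] have
    orders n and m. *)
Record last_centre P : Prop := LastCentre {
  lc_div : divisor P = (true, true);
  lc_mu : exists i j k l, [/\ mu i j (pb (blowup P) f1), mu k l (pb (blowup P) f2),
    (n = i + j)%N & (m = k + l)%N];
  lc_jac : exists e e', mu e e' (jac (blowup P)) }.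

Lemma pb_rcons P d h : pb (blowup (rcons P d)) h = pb (chart d) (pb (blowup P) h).
Proof.
by rewrite blowup_rcons -pb_pb //; [exact: blowup_centred | exact: chart_centred].
Qed.
Lemma jac_rcons P d :
  jac (blowup (rcons P d)) = pb (chart d) (jac (blowup P)) * jac (chart d).
Proof.
by rewrite blowup_rcons jac_map //; [exact: blowup_centred | exact: chart_centred].
Qed.
Lemma divisor_rcons P d : divisor (rcons P d) =
  if d is Some c then (true, (divisor P).2 && (c == 0)) else ((divisor P).1, true).
Proof. by rewrite /divisor -cats1 foldl_cat. Qed.

Lemma ord1_pos p a : p 0%N = 0 -> ord1 p a -> (0 < a)%N.
Proof. by move=> p0 [pa _]; rewrite lt0n; apply: contraNneq pa => ->; rewrite p0. Qed.

Let n_ndvd k : (m = n + k * n)%N -> False.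
Proof.
move=> e; have : (n %| m)%N by rewrite e dvdn_addl ?dvdn_mull.
by move=> /gcdn_idPl; rewrite (eqP co); lia.
Qed.

Lemma chart_mu1 (c : K) : mu 1 0 (chart (Some c)).1. Proof. exact: mu_mon. Qed.
Lemma chart_mu_0 : mu 1 1 (chart (Some 0 : direction R)).2.
Proof.
by rewrite /= cmon0 addr0; exact: mu_mon.
Qed.
Lemma chart_mu_c (c : K) : c <> 0 -> mu 1 0 (chart (Some c)).2.
Proof.
move=> c0; exists (cmon 1 0 1 + cmon c 0 0); first by rewrite !psDE /cmon /= add0r.
by rewrite mulrDr !cmonM !mul1r.
Qed.
Lemma chart_muN1 : mu 1 1 (chart (None : direction R)).1. Proof. exact: mu_mon. Qed.
Lemma chart_muN2 : mu 0 1 (chart (None : direction R)).2. Proof. exact: mu_mon. Qed.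

(** A blowing-up subtracts the smaller of the two orders from the larger one.
    Since n does not divide m and they are coprime, the algorithm leaves the
    first phase at a corner, and it ends with both orders equal to one; then
    the next direction is none of the two axes. *)
Lemma near_step P d g : centred1 g -> near_state P (map_arc (chart d) g) ->
  near_state (rcons P d) g \/
  exists2 c, c <> 0 & [/\ d = Some c, last_centre P & ord1 g.1 1].
Proof.
move=> gc; have [g10 g20] := gc.
case=> [k e m' psi mf1 f2E p0 p1 mj o1 o2 mE D | k e m' psi mf1 f2E p0 p1 mj o1 o2 mE D
       | i j k l a b e e' mf1 mf2 mj D o1 o2 a0 b0 nE mE].
- (* The divisor is u = 0, with [g.1] of order n.  The direction is vertical
     exactly when the order of [psi], hence that of [g.2], is less than n. *)
  case: d o1 o2 => [c|]; rewrite ?map_chart_some ?map_chart_none //= => o1.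
  + rewrite -map_chart_some // -(@ev_pb R _ _ _ (chart_centred _) gc).
    have [psi' [E p'0 p'1]] := pb_some c p0.
    rewrite E evM // ev_cmon // expr0 mulr1 expr1 (fil_cst1 (filtered1 R)) mul1r => o2.
    have [a [m'' [oa om'' m'E]]] := ord1_factor o2.
    have an := ord1_inj oa o1; subst a.
    have m''0 : (0 < m'')%N.
      rewrite lt0n; apply/eqP => z; rewrite z addn0 in m'E.
      by apply: (n_ndvd (k := k)); rewrite mE m'E.
    left; apply: (@State_u _ _ k.+1 (1 * e + 1)%N m'' psi').
    * by rewrite pb_rcons; exact: (mu_pb1 (chart_centred _) mf1 (chart_mu1 c)).
    * rewrite pb_rcons f2E (pbM (chart_centred _)) E.
      rewrite (pb_cmon (chart_centred _)) /=.
      by rewrite expr0 cmon1 mul1r mulr1 cmonX mulrA cmonM expr1n mul1n mul0n mulr1 addn1.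
    * by have [] := om''; rewrite -(ev0 gc); case: m'' {m'E om''} m''0 => // m'' _ _ ->.
    * by rewrite p'1.
    * rewrite jac_rcons jac_chart_some.
      exact (muM (mu_pb1 (chart_centred _) mj (chart_mu1 c)) (mu_mon _ 1 0)).
    * exact: o1.
    * exact: om''.
    * by rewrite mE m'E mulSn; lia.
    * by rewrite divisor_rcons D.
  rewrite -map_chart_none // -(@ev_pb R _ _ _ (chart_centred _) gc).
  have [psi' [E p'0 p'1]] := pb_none p0.
  rewrite E evM // ev_cmon // expr0 mulr1 expr1 (fil_cst1 (filtered1 R)) mul1r => o2.
  have [a [b [oa ob nE]]] := ord1_factor o1.
  have a0 := ord1_pos g10 oa; have b0 := ord1_pos g20 ob.
  have op : ord1 (ev g psi') 0 by apply: ord1_unit; rewrite ev0 // p'0.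
  have m'E := ord1_inj o2 (ord1M ob op).
  have k0 : (0 < k)%N by case: k mE {f2E D} => // mE; lia.
  left; apply: (@State_corner _ _ 1 1 (1 * k + 0) (1 * k + 1) a b (1 * e + 0) (1 * e + 1)) => //.
  + by rewrite pb_rcons; exact: (mu_pb1 (chart_centred _) mf1 chart_muN1).
  + rewrite pb_rcons f2E (pbM (chart_centred _)) E.
    apply: muM; first by exact: (mu_pb1 (chart_centred _) (mu_mon _ _ _) chart_muN1).
    by exists psi' => //; rewrite p'0.
  + rewrite jac_rcons jac_chart_none; apply: muM (mu_mon _ _ _).
    by exact: (mu_pb1 (chart_centred _) mj chart_muN1).
  + by rewrite divisor_rcons D k0.
  + by rewrite !mul1n.
  + by rewrite mE m'E nE; nia.
- (* The divisor is v = 0, with [g.2] of order n.  It becomes u = 0 in the next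
     chart if the direction is neither of the axes. *)
  case: d o1 o2 => [c|]; rewrite ?map_chart_some ?map_chart_none //= => o1.
  + rewrite -map_chart_some // -(@ev_pb R _ _ _ (chart_centred _) gc).
    have [psi' [E p'0 p'1]] := pb_some c p0.
    rewrite E evM // ev_cmon // expr0 mulr1 expr1 (fil_cst1 (filtered1 R)) mul1r => o2.
    have [a [b [oa ob nE]]] := ord1_factor o1.
    have a0 := ord1_pos g10 oa.
    have [c0|c0] := pselect (c = 0).
      subst c; rewrite cst1_0 addr0 in ob.
      have b0 := ord1_pos g20 ob.
      have op : ord1 (ev g psi') 0.
        by apply: ord1_unit; rewrite ev0 // p'0 mul0r addr0.
      have m'E := ord1_inj o2 (ord1M oa op).
      have k0 : (0 < k)%N by case: k mE {f2E D} => // mE; lia.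
      left; apply: (@State_corner _ _ 1 1 (1 * k + 1) (1 * k + 0) a b (1 * e + 1) (1 * e + 0)) => //.
      * by rewrite pb_rcons; exact: (mu_pb2 (chart_centred _) mf1 chart_mu_0).
      * rewrite pb_rcons f2E (pbM (chart_centred _)) E.
        apply: muM; first by exact: (mu_pb2 (chart_centred _) (mu_mon _ _ _) chart_mu_0).
        by exists psi' => //; rewrite p'0 mul0r addr0.
      * rewrite jac_rcons jac_chart_some; apply: muM (mu_mon _ _ _).
        by exact: (mu_pb2 (chart_centred _) mj chart_mu_0).
      * by rewrite divisor_rcons D eqxx k0.
      * by rewrite !mul1n.
      * by rewrite mE m'E nE; nia.
    have b0 : b = 0%N.
      apply: ord1_inj ob _; apply: ord1_unit.
      by rewrite psDE g20 add0r.
    rewrite b0 addn0 in nE; subst a.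
    have [a [m'' [oa' om'' m'E]]] := ord1_factor o2.
    have an := ord1_inj oa' oa; subst a.
    have m''0 : (0 < m'')%N.
      rewrite lt0n; apply/eqP => z; rewrite z addn0 in m'E.
      by apply: (n_ndvd (k := k)); rewrite mE m'E.
    have p'00 : psi' 0%N 0%N = 0.
      by have [] := om''; rewrite -(ev0 gc); case: m'' {m'E om''} m''0 => // m'' _ _ ->.
    have p01 : psi 0%N 1%N <> 0.
      by move=> z; apply: p1; move: p'0; rewrite p'00 z mulr0 addr0.
    have U0 : ((cmon 1 0 1 + cmon c 0 0 : S2) ^+ k) 0%N 0%N <> 0.
      by apply: unit00X; rewrite !psDE /cmon /= add0r.
    left; apply: (@State_u _ _ k.+1 (1 * e + 1)%N m'' ((cmon 1 0 1 + cmon c 0 0) ^+ k * psi')).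
    * by rewrite pb_rcons; exact: (mu_pb2 (chart_centred _) mf1 (chart_mu_c c0)).
    * rewrite pb_rcons f2E (pbM (chart_centred _)) E.
      rewrite (pb_cmon (chart_centred _)) /=.
      have -> : cmon 1 1 1 + cmon c 1 0 = cmon 1 1 0 * (cmon 1 0 1 + cmon c 0 0).
        by rewrite mulrDr !cmonM !mul1r.
      rewrite expr0 cmon1 !mul1r exprMn cmonX expr1n mul1n mul0n.
      have -> : cmon (1 : K) k.+1 0 = cmon 1 k 0 * cmon 1 1 0 by rewrite cmonM mulr1 addn1.
      by ring.
    * by rewrite !psM0E p'00 mulr0.
    * rewrite psM0E psME !big_ord_recl big_ord0 /= p'00 mulr0 !addr0.
      by move=> /eqP; rewrite mulf_eq0 => /orP [] /eqP //; rewrite subn0 p'1.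
    * rewrite jac_rcons jac_chart_some.
      exact (muM (mu_pb2 (chart_centred _) mj (chart_mu_c c0)) (mu_mon _ 1 0)).
    * exact: oa.
    * by rewrite evM //; apply: (ord1M (a := 0)) om''; apply: ord1_unit; rewrite ev0.
    * by rewrite mE m'E mulSn; lia.
    * by rewrite divisor_rcons D; move/eqP/negbTE: c0 => ->; rewrite andbF.
  rewrite -map_chart_none // -(@ev_pb R _ _ _ (chart_centred _) gc).
  have [psi' [E p'0 p'1]] := pb_none p0.
  rewrite E evM // ev_cmon // expr0 mulr1 expr1 (fil_cst1 (filtered1 R)) mul1r => o2.
  have [a [m'' [oa om'' m'E]]] := ord1_factor o2.
  have an := ord1_inj oa o1; subst a.
  have m''0 : (0 < m'')%N.
    rewrite lt0n; apply/eqP => z; rewrite z addn0 in m'E.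
    by apply: (n_ndvd (k := k)); rewrite mE m'E.
  left; apply: (@State_v _ _ k.+1 (1 * e + 1)%N m'' psi').
  + by rewrite pb_rcons; exact: (mu_pb2 (chart_centred _) mf1 chart_muN2).
  + rewrite pb_rcons f2E (pbM (chart_centred _)) E.
    rewrite (pb_cmon (chart_centred _)) /=.
    by rewrite expr0 cmon1 !mul1r cmonX mulrA cmonM expr1n mul1n mul0n mulr1 addn1.
  + by have [] := om''; rewrite -(ev0 gc); case: m'' {m'E om''} m''0 => // m'' _ _ ->.
  + by rewrite p'1.
  + rewrite jac_rcons jac_chart_none.
    exact (muM (mu_pb2 (chart_centred _) mj chart_muN2) (mu_mon _ 0 1)).
  + exact: o1.
  + exact: om''.
  + by rewrite mE m'E mulSn; lia.
  + by rewrite divisor_rcons D.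
(* At a corner the direction is an axis as long as the orders differ. *)
case: d o1 o2 => [c|]; rewrite ?map_chart_some ?map_chart_none //= => o1 o2.
  have [a' [b' [oa ob bE]]] := ord1_factor o2.
  have a'E := ord1_inj oa o1; subst a'.
  have [c0|c0] := pselect (c = 0).
    subst c; rewrite cst1_0 addr0 in ob.
    left; apply: (@State_corner _ _ (1 * i + 1 * j) (0 * i + 1 * j) (1 * k + 1 * l) (0 * k + 1 * l)
      a b' (1 * e + 1 * e' + 1) (0 * e + 1 * e' + 0)) => //.
    + by rewrite pb_rcons; exact: (mu_pb (chart_centred _) mf1 (chart_mu1 0) chart_mu_0).
    + by rewrite pb_rcons; exact: (mu_pb (chart_centred _) mf2 (chart_mu1 0) chart_mu_0).
    + rewrite jac_rcons jac_chart_some; apply: muM (mu_mon _ _ _).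
      by exact: (mu_pb (chart_centred _) mj (chart_mu1 0) chart_mu_0).
    + by rewrite divisor_rcons D eqxx.
    + exact: ord1_pos g20 ob.
    + by rewrite nE bE; nia.
    + by rewrite mE bE; nia.
  have b'0 : b' = 0%N.
    by apply: ord1_inj ob _; apply: ord1_unit; rewrite psDE g20 add0r.
  have ba : b = a by rewrite bE b'0 addn0.
  rewrite ba -mulnDl in nE; rewrite ba -mulnDl in mE.
  have a1 : a = 1%N.
    have : (a %| gcdn n m)%N by rewrite nE mE dvdn_gcd !dvdn_mull.
    by rewrite (eqP co) dvdn1 => /eqP.
  rewrite a1 !muln1 in nE mE oa.
  right; exists c => //; split=> //; split=> //.
    by exists i, j, k, l.
  by exists e, e'.
have [a' [b' [oa ob aE]]] := ord1_factor o1.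
have b'E := ord1_inj ob o2; subst b'.
left; apply: (@State_corner _ _ (1 * i + 0 * j) (1 * i + 1 * j) (1 * k + 0 * l) (1 * k + 1 * l)
  a' b (1 * e + 0 * e' + 0) (1 * e + 1 * e' + 1)) => //.
+ by rewrite pb_rcons; exact: (mu_pb (chart_centred _) mf1 chart_muN1 chart_muN2).
+ by rewrite pb_rcons; exact: (mu_pb (chart_centred _) mf2 chart_muN1 chart_muN2).
+ rewrite jac_rcons jac_chart_none; apply: muM (mu_mon _ _ _).
  by exact: (mu_pb (chart_centred _) mj chart_muN1 chart_muN2).
+ by rewrite divisor_rcons D.
+ exact: ord1_pos g10 oa.
+ by rewrite nE aE; nia.
+ by rewrite mE aE; nia.
Qed.

(** Before the last centre the strict transform is singular, or tangent to the
    divisor, or it passes through a corner. *)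
Lemma near_state_not_nc P g : centred1 g -> near_state P g -> nonsingular_arc g ->
  ~~ corner P -> ((divisor P).1 -> ord1 g.1 1) -> ((divisor P).2 -> ord1 g.2 1) -> False.
Proof.
move=> gc st ns nc d1 d2; case: st => [k e m' psi _ _ _ p1 _ o1 o2 mE D
    | k e m' psi _ _ _ p1 _ o1 o2 mE D | i j k l a b e e' _ _ _ D _ _ _ _ _ _].
- have [k0|k0] := posnP k; last first.
    by have := ord1_inj (d1 _) o1; rewrite D k0 => /(_ isT); lia.
  have m'm : m' = m by rewrite mE k0; lia.
  have g11 : g.1 1%N = 0 by case: o1 => _; apply.
  have : ev g psi 1%N = 0 by case: o2 => _; apply; lia.
  rewrite ev_lin // g11 mulr0 add0r => /eqP; rewrite mulf_eq0 => /orP [] /eqP // g21.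
  by case: ns; rewrite ?g11 ?g21 eqxx.
- have [k0|k0] := posnP k; last first.
    by have := ord1_inj (d2 _) o1; rewrite D k0 => /(_ isT); lia.
  have m'm : m' = m by rewrite mE k0; lia.
  have g21 : g.2 1%N = 0 by case: o1 => _; apply.
  have : ev g psi 1%N = 0 by case: o2 => _; apply; lia.
  rewrite ev_lin // g21 mulr0 addr0 => /eqP; rewrite mulf_eq0 => /orP [] /eqP // g11.
  by case: ns; rewrite ?g11 ?g21 eqxx.
by move: nc; rewrite /corner D.
Qed.

Lemma near_points L gL : centred1 gL -> nonsingular_arc gL -> ~~ corner L ->
  ((divisor L).1 -> ord1 gL.1 1) -> ((divisor L).2 -> ord1 gL.2 1) ->
  forall rest P, L = P ++ rest -> near_state P (map_arc (blowup rest) gL) ->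
  exists P' c rest', [/\ L = P' ++ Some c :: rest', c <> 0, last_centre P' &
    ord1 (map_arc (blowup rest') gL).1 1].
Proof.
move=> gc ns nc d1 d2; elim=> [|d rest IH] P LE.
  rewrite cats0 in LE; subst P; rewrite /= -ev_id // => st.
  by case: (near_state_not_nc gc st ns nc d1 d2).
rewrite map_blowup_cons // => /(near_step (blowup_arc_centred _ gc)) [st|[c c0 [dE lc o1]]].
  by apply: (IH (rcons P d)) => //; rewrite cat_rcons.
by exists P, c, rest; rewrite -dE.
Qed.

End Euclid.

Section CuspCoordinates.
Variable R : realType.
Local Notation K := R[i].
Local Notation S1 := (ps K).
Local Notation S2 := (ps (ps K)).
Local Notation arc := (S1 * S1)%type.
Local Notation map2 := (S2 * S2)%type.
Local Notation ord1 := (@Defs.ord1 R).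
Implicit Types (p q tau : S1) (f h psi : S2) (g C : arc) (P Q : seq (direction R)).

Lemma conv2_derivative f (D : S2) : convergent2 f ->
  (forall i j, exists i' j' k, [/\ D i j = f i' j' *+ k.+1, (k <= i + j)%N &
     (i' + j' = (i + j).+1)%N]) -> convergent2 D.
Proof.
move=> [r [c [r0 rc]]] HD; exists (r / 2%:R), (c / r); split; first by rewrite divr_gt0.
move=> i j; have [i' [j' [k [-> kij e]]]] := HD i j.
have := rc i' j'; rewrite e => h.
rewrite -[f i' j' *+ _]mulr_natr normrM normr_nat exprMn.
have h1 : `|f i' j'| * r ^+ (i + j) <= c / r by rewrite ler_pdivlMr // -mulrA -exprSr.
have h2 : (k.+1%:R : K) * 2^-1 ^+ (i + j) <= 1.
  apply: le_trans (half_powers R (i + j)); apply: ler_wpM2r.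
    by rewrite exprn_ge0 // invr_ge0.
  by rewrite ler_nat.
rewrite mulrACA -[leRHS]mulr1; apply: ler_pM => //.
  by rewrite mulr_ge0 // exprn_ge0 // ltW.
by rewrite mulr_ge0 // exprn_ge0 // invr_ge0.
Qed.
Lemma conv2_du f : convergent2 f -> convergent2 (du f).
Proof.
by move=> fc; apply: conv2_derivative fc _ => i j; exists i.+1, j, i; split=> //; lia.
Qed.
Lemma conv2_dv f : convergent2 f -> convergent2 (dv f).
Proof.
by move=> fc; apply: conv2_derivative fc _ => i j; exists i, j.+1, j; split=> //; lia.
Qed.

Definition emb_v p : S2 := srow 0 p.

Lemma pb_emb (F : map2) p k l : centred2 F -> pb F (emb p) k l =
  \sum_(i < (k + l).+1) p i * (F.1 ^+ i) k l.
Proof.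
move=> Fc; rewrite /pb /comp22; apply: eq_bigr => i _.
rewrite big_ord_recl big1 ?addr0 => [|j _]; last by rewrite /emb /cst1 /= mul0r.
by rewrite mul2E !pow2E /emb /cst1 /= expr0 mulr1.
Qed.

Lemma pb_emb_u (F : map2) p : centred2 F -> F.1 = cmon 1 1 0 -> pb F (emb p) = emb p.
Proof.
move=> Fc F1; apply/funext => k; apply/funext => l; rewrite pb_emb // F1.
have kl : (k < (k + l).+1)%N by lia.
rewrite (bigD1 (Ordinal kl)) //= big1 ?addr0 => [|i /eqP ik]; last first.
  rewrite cmonX /cmon ifF ?mulr0 // mul1n; apply/negbTE; rewrite negb_and.
  by apply/orP; left; apply/eqP => E; apply: ik; apply/val_inj.
rewrite cmonX /cmon expr1n mul1n mul0n eqxx /= /emb /cst1.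
by case: ifP; rewrite ?mulr1 ?mulr0.
Qed.
Lemma pb_emb_v (F : map2) p : centred2 F -> F.1 = cmon 1 0 1 -> pb F (emb p) = emb_v p.
Proof.
move=> Fc F1; apply/funext => k; apply/funext => l; rewrite pb_emb // F1.
have kl : (l < (k + l).+1)%N by lia.
rewrite (bigD1 (Ordinal kl)) //= big1 ?addr0 => [|i /eqP ik]; last first.
  rewrite cmonX /cmon ifF ?mulr0 // mul1n; apply/negbTE; rewrite negb_and.
  by apply/orP; right; apply/eqP => E; apply: ik; apply/val_inj.
rewrite cmonX /cmon expr1n mul1n mul0n eqxx andbT /emb_v /srow.
by case: ifP; rewrite ?mulr1 ?mulr0.
Qed.

Lemma ev_emb_v g p : centred1 g -> ev g (emb_v p) = cmp p g.2.
Proof.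
move=> gc; have sc : centred2 (cmon (1 : K) 0 1, cmon 1 0 1) by [].
rewrite -(pb_emb_v p sc) // ev_pb // ev_emb /map_arc /= ev_cmon //.
by rewrite expr0 expr1 (fil_cst1 (filtered1 R)) !mul1r.
Qed.

Lemma conv2_emb_v p : convergent1 p -> convergent2 (emb_v p).
Proof.
move=> [r [c [r0 rc]]]; exists r, c; split=> // i j; rewrite /emb_v /srow.
have c0 : 0 <= c by apply: le_trans (rc 0%N); rewrite mulr_ge0 // exprn_ge0 // ltW.
by case: i => [|i] /=; [rewrite add0n | rewrite normr0 mul0r].
Qed.

Lemma varXn_E n k : (varX R ^+ n) k = (k == n)%:R.
Proof.
rewrite -[_ ^+ n]mulr1 varXn_mulE ps1E subn_eq0 eqn_leq andbC.
by do 2 case: leqP.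
Qed.

(** Below t^m the second coordinate is a polynomial in the first one, which is
    t^n; subtracting it does not change the coefficient of t^m, as n does not
    divide m. *)
Lemma puiseux_polynomial (n m : nat) (X Y tau : S1) :
  (2 <= n)%N -> (n < m)%N -> coprime n m ->
  X 0%N = 0 -> Y 0%N = 0 -> tau 0%N = 0 -> tau 1%N != 0 ->
  (forall k, cmp X tau k = (k == n)%:R) ->
  cmp Y tau m != 0 -> (forall i, (i < m)%N -> cmp Y tau i != 0 -> (n %| i)%N) ->
  exists p, [/\ convergent1 p, p 0%N = 0, ord1 X n & ord1 (Y - cmp p X) m].
Proof.
move=> n2 nm co X0 Y0 t0 t1 XE ym yi.
pose p : S1 := fun k => if (k * n < m)%N then cmp Y tau (k * n)%N else 0.
have XE' : cmp X tau = varX R ^+ n by apply/funext => k; rewrite XE varXn_E.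
have n_m : ~ (n %| m)%N by move=> /gcdn_idPl; rewrite (eqP co); lia.
exists p; split.
- exists 1, (\sum_(i < m) `|p i|); split=> // k; rewrite expr1n mulr1.
  have [km|mk] := ltnP k m.
    by rewrite (bigD1 (Ordinal km)) //= lerDl; apply: sumr_ge0.
  rewrite {1}/p ifF ?normr0; first by apply: sumr_ge0.
  by apply/negbTE; rewrite -leqNgt; nia.
- by rewrite /p mul0n cmp0E // Y0 if_same.
- apply: (ord1_cmpE t0 t1); rewrite XE'; split; first by rewrite varXn_E eqxx oner_neq0.
  by move=> i i_n; rewrite varXn_E ltn_eqF.
apply: (ord1_cmpE t0 t1).
have -> : cmp (Y - cmp p X) tau = cmp Y tau - cmp p (varX R ^+ n).
  rewrite cmpD // -XE' -cmpA //; congr (_ + _).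
  apply/eqP; rewrite -subr_eq0 opprK -cmpD // addNr; apply/eqP.
  by have := cmp_cst t0 0; rewrite cst1_0.
have cE i : cmp p (varX R ^+ n) i = if (n %| i)%N then p (i %/ n)%N else 0.
  rewrite /cmp /comp11; under eq_bigr => k _ do rewrite pow1E -exprM varXn_E.
  case: ifP => [/dvdnP [k iE]|ni].
    have n0 : (0 < n)%N by lia.
    have ki : (k < i.+1)%N by nia.
    have -> : (i %/ n = k)%N by rewrite iE mulnK.
    rewrite (bigD1 (Ordinal ki)) //= big1 ?addr0 => [|l /eqP lk].
      by rewrite (_ : (i == n * k)%N) ?mulr1 // iE mulnC.
    have -> : (i == n * l)%N = false; last by rewrite mulr0.
    apply/eqP => E; apply: lk; apply/val_inj => /=.
    by apply/eqP; rewrite -(eqn_pmul2l n0) -E mulnC -iE.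
  rewrite big1 // => l _; case: eqP => [E|_]; last by rewrite mulr0.
  by have := dvdn_mulr l (dvdnn n); rewrite -E ni.
split.
  by rewrite psBE cE ifF ?subr0 //; exact/negbTE/negP.
move=> i im; rewrite psBE cE; case: ifP => [/dvdnP [k iE]|ni].
  by rewrite iE mulnK ?(leq_trans _ n2) // /p -iE im subrr.
by rewrite subr0; apply/eqP/negbNE/negP => /(yi i im); rewrite ni.
Qed.

Record cusp_coordinates (n m : nat) C Q (f1 f2 : S2) : Prop := CuspCoordinates {
  cc_centred : centred2 (f1, f2);
  cc_conv1 : convergent2 f1;
  cc_conv2 : convergent2 f2;
  cc_inverse : exists2 G : map2, centred2 G & map_map G (f1, f2) = (cmon 1 1 0, cmon 1 0 1);
  cc_centre : last_centre n m f1 f2 Q;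
  cc_strict : exists c g, [/\ c <> 0, centred1 g,
     C = map_arc (blowup (rcons Q (Some c))) g & ord1 g.1 1] }.

Lemma conv2N f : convergent2 f -> convergent2 (- f).
Proof. by move=> [r [c [r0 rc]]]; exists r, c; split=> // i j; rewrite !psNE normrN. Qed.

Lemma puiseux_coordinates (m n : nat) C : puiseux_cusp m n C ->
  exists f1 f2 : S2, [/\ centred2 (f1, f2), convergent2 f1, convergent2 f2,
    exists2 G : map2, centred2 G & map_map G (f1, f2) = (cmon 1 1 0, cmon 1 0 1)
    & near_state n m f1 f2 [::] C].
Proof.
move=> [n2 nm co [[C1v C2v C10 C20] _] [swap [tau [tv t0 t1]]]].
have jac1 : mu 0 0 (jac (blowup (Nil (direction R)))).
  rewrite /jac /wdg /= !du_cmon !dv_cmon !mulr0n !mulr1n /=.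
  by rewrite !cmon0 mul0r subr0 cmon1 mul1r; apply/mu_unit/one00.
have Cc : centred1 C by [].
case: swap => /= xE [ym yi].
  have [p [pv p0 oX oY]] := puiseux_polynomial n2 nm co C20 C10 t0 t1 xE ym yi.
  have fc : centred2 (cmon (1 : K) 0 1, cmon 1 1 0 - emb_v p).
    by split=> //=; rewrite !psBE /cmon /emb_v /srow /= p0 subrr.
  exists (cmon 1 0 1), (cmon 1 1 0 - emb_v p); split=> //.
  - exact: conv2_cmon.
  - by apply: conv2D; [exact: conv2_cmon | exact/conv2N/conv2_emb_v].
  - exists (cmon 1 0 1 + emb p, cmon 1 1 0).
      by split=> //=; rewrite !psDE /cmon /emb /cst1 /= p0 addr0.
    rewrite /map_map /= pbD // (pb_emb_v p fc) // !pb_cmon //= !expr0 !expr1 cmon1.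
    by rewrite !mul1r mulr1 subrK.
  apply: (@State_v _ _ _ _ _ _ _ 0 0 m (cmon 1 1 0 - emb_v p)) => //.
  - by rewrite pb_id; exact: mu_mon.
  - by rewrite pb_id cmon1 mul1r.
  - by case: fc.
  - rewrite !psBE /cmon /emb_v /srow /= subr0; apply/eqP; exact: oner_neq0.
  - rewrite evB // ev_cmon // ev_emb_v // expr0 expr1 (fil_cst1 (filtered1 R)).
    by rewrite mul1r mulr1.
  - by rewrite mul0n addn0.
have [p [pv p0 oX oY]] := puiseux_polynomial n2 nm co C10 C20 t0 t1 xE ym yi.
have fc : centred2 (cmon (1 : K) 1 0, cmon 1 0 1 - emb p).
  by split=> //=; rewrite !psBE /cmon /emb /cst1 /= p0 subrr.
exists (cmon 1 1 0), (cmon 1 0 1 - emb p); split=> //.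
- exact: conv2_cmon.
- by apply: conv2D; [exact: conv2_cmon | exact/conv2N/conv2_emb].
- exists (cmon 1 1 0, cmon 1 0 1 + emb p).
    by split=> //=; rewrite !psDE /cmon /emb /cst1 /= p0 addr0.
  rewrite /map_map /= pbD // (pb_emb_u p fc) // !pb_cmon //= !expr0 !expr1 cmon1.
  by rewrite !mul1r mulr1 subrK.
apply: (@State_u _ _ _ _ _ _ _ 0 0 m (cmon 1 0 1 - emb p)) => //.
- by rewrite pb_id; exact: mu_mon.
- by rewrite pb_id cmon1 mul1r.
- by case: fc.
- rewrite !psBE /cmon /emb /cst1 /= subr0; apply/eqP; exact: oner_neq0.
- rewrite evB // ev_cmon // ev_emb // expr0 expr1 (fil_cst1 (filtered1 R)).
  by rewrite !mul1r.
- by rewrite mul0n addn0.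
Qed.

(** The algorithm ends at [Q]: the point after its last corner has normal
    crossings, hence it is no longer a centre. *)
Lemma cusp_coordinates_exist (m n : nat) C Q :
  puiseux_cusp m n C -> cuspidal_divisor C Q ->
  exists f1 f2, cusp_coordinates n m C Q f1 f2.
Proof.
move=> hC [[d nc] first]; have [n2 nm co _ _] := hC.
have [f1 [f2 [fc f1v f2v fG st]]] := puiseux_coordinates hC.
have [gL [gc gv CE ns [ncr d1 d2]]] := normal_crossings_arc nc.
have st' : near_state n m f1 f2 [::] (map_arc (blowup (rcons Q d)) gL) by rewrite -CE.
have [P [c [rest [LE c0 lc o1]]]] := near_points co n2 nm gc ns ncr d1 d2 (P := [::]) (erefl _) st'.
pose g := map_arc (blowup rest) gL.
have gc' : centred1 g by exact: blowup_arc_centred.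
have gv' : conv_arc g by exact: blowup_arc_conv.
have CE' : C = map_arc (blowup (rcons P (Some c))) g.
  by rewrite CE LE -cat_rcons blowup_cat map_arcA //; exact: blowup_centred.
have ncP : curve_normal_crossings C (rcons P (Some c)).
  apply: (@normal_crossings_of_transversal _ _ _ g) => //.
    split; last by rewrite blowup_mapE.
    by case: gc'; case: gv'; split.
  by rewrite divisor_rcons (lc_div lc) /=; move/eqP/negbTE: c0 => ->.
case/lastP: rest LE @g gc' gv' CE' o1 => [|rest e] LE g gc' gv' CE' o1.
  move: LE; rewrite -[P ++ _]/(P ++ [:: Some c]) cats1 => /rcons_inj [QP _]; subst P.
  exists f1, f2; split=> //.
  by exists c, g.
move: LE; rewrite -rcons_cons -rcons_cat => /rcons_inj [QE _].
case: (first (size P).+1).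
  by rewrite QE size_cat /=; lia.
by rewrite QE -cat_rcons take_cat size_rcons ltnn subnn take0 cats0.
Qed.

End CuspCoordinates.

(** * The holes of a semimodule *)

Section Holes.
Local Open Scope nat_scope.

Definition semigroup2 (n m : nat) (g : nat) := exists i j, g = (i * n + j * m)%N.

Lemma semigroup2C n m g : semigroup2 n m g -> semigroup2 m n g.
Proof. by move=> [i [j ->]]; exists j, i; rewrite addnC. Qed.
Lemma semigroup2D n m g d : semigroup2 n m g -> semigroup2 n m d ->
  semigroup2 n m (g + d).
Proof.
by move=> [i [j ->]] [k [l ->]]; exists (i + k)%N, (j + l)%N; rewrite !mulnDl; lia.
Qed.

(** [holes_below L u k]: beyond [u], all the holes of [L] lie strictly below
    the corner [k] of the staircase of [L] drawn in the plane of exponents. *)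
Definition holes_below (n m : nat) (L : nat -> Prop) (u k : nat) :=
  forall q, ~ L q -> (u < q)%N ->
  exists x y, [/\ (0 < x)%N, (0 < y)%N & k = (q + x * n + y * m)%N].
Definition below_holes (n m : nat) (L : nat -> Prop) (k : nat) :=
  forall q x y, (0 < x)%N -> (0 < y)%N -> k = (q + x * n + y * m)%N -> ~ L q.

Definition extend (n m : nat) (L : nat -> Prop) (lam v : nat) :=
  L v \/ exists2 g, semigroup2 n m g & v = (g + lam)%N.

Lemma coprime_mul_eq n m a b : coprime n m -> (a * m = b * n)%N -> (0 < b)%N ->
  (0 < n)%N -> (n <= a)%N.
Proof.
move=> co e b0 n0; have /dvdn_leq : n %| a.
  by rewrite -(Gauss_dvdl _ co) e dvdn_mull.
apply; case: a e => //; rewrite mul0n => /esym /eqP; rewrite muln_eq0; lia.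
Qed.

(** A new generator [lam] below the corner [k] splits it into the two corners
    lam + a n and lam + b m.  If the first one is smaller, a hole beyond it exceeds
    [lam] in the exponent of m, hence not in that of n: it lies below the second
    corner. *)
Lemma new_corner n m (L : nat -> Prop) u k lam a b :
  coprime n m -> (0 < n)%N -> (0 < m)%N ->
  holes_below n m L u k -> below_holes n m L k ->
  ~ L lam -> (u < lam)%N -> (0 < a)%N -> (0 < b)%N -> (b < n)%N ->
  k = (lam + a * n + b * m)%N -> (a * n < b * m)%N ->
  [/\ L (lam + a * n)%N,
      forall g, semigroup2 n m g -> L (g + lam)%N -> (g < b * m)%N ->
        exists2 d, semigroup2 n m d & g = (d + a * n)%N,
      holes_below n m (extend n m L lam) (lam + a * n) (lam + b * m)
    & below_holes n m (extend n m L lam) (lam + b * m)].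
Proof.
move=> co n0 m0 Lh hL Ll ul a0 b0 bn ke ab; subst k; split.
- apply: contrapT => /Lh [|x [y [x0 y0 e]]]; first by lia.
  have : ((b - y) * m = x * n)%N by rewrite mulnBl; lia.
  by move=> /(coprime_mul_eq co) /(_ x0 n0); lia.
- move=> g [c [d ->]] Lg gb.
  have db : (d < b)%N by rewrite -(ltn_pmul2r m0); lia.
  have [ac|ca] := leqP a c.
    by exists ((c - a) * n + d * m)%N; [exists (c - a)%N, d | rewrite mulnBl; nia].
  by case: (hL (c * n + d * m + lam)%N (a - c)%N (b - d)%N) => //; try lia; rewrite !mulnBl; nia.
- move=> q /not_orP [Lq ql] uq.
  have [|x [y [x0 y0 e]]] := Lh q Lq; first by lia.
  have yb : (y < b)%N by rewrite -(ltn_pmul2r m0); lia.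
  have [xa|ax] := leqP x a.
    case: ql; exists ((a - x) * n + (b - y) * m)%N; first by exists (a - x)%N, (b - y)%N.
    by rewrite !mulnBl; nia.
  by exists (x - a)%N, y; split; rewrite ?mulnBl; nia.
move=> q x y x0 y0 e [Lq|[_ [c [d ->]] e']].
  by apply: (hL q (x + a)%N y) Lq; rewrite ?mulnDl; lia.
have : ((b - d - y) * m = (c + x) * n)%N by rewrite !mulnBl mulnDl; lia.
by move=> /(coprime_mul_eq co); lia.
Qed.

Lemma next_corners n m (L : nat -> Prop) u k lam :
  coprime n m -> (1 < n)%N -> (n < m)%N ->
  holes_below n m L u k -> below_holes n m L k ->
  ~ L lam -> (u < lam)%N -> (n <= lam)%N -> (k <= n * m + n)%N ->
  exists g0 k', [/\ semigroup2 n m g0, L (g0 + lam)%N, (g0 + lam < k' <= n * m + n)%N &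
    [/\ forall g, semigroup2 n m g -> L (g + lam)%N -> (g + lam < k')%N ->
          exists2 d, semigroup2 n m d & g = (d + g0)%N,
        holes_below n m (extend n m L lam) (g0 + lam) k'
      & below_holes n m (extend n m L lam) k']].
Proof.
move=> co n1 nm Lh hL Ll ul nl kb.
have [a [b [a0 b0 e]]] := Lh _ Ll ul.
have n0 : (0 < n)%N by lia.
have m0 : (0 < m)%N by lia.
have bn : (b < n)%N by rewrite -(ltn_pmul2r m0); nia.
have am : (a < m)%N by rewrite -(ltn_pmul2r n0); nia.
have [ab|ba] := ltnP (a * n) (b * m).
  have [h1 h2 h3 h4] := new_corner co n0 m0 Lh hL Ll ul a0 b0 bn e ab.
  exists (a * n)%N, (lam + b * m)%N; split.
  - by exists a, 0%N; rewrite mul0n addn0.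
  - by rewrite addnC.
  - lia.
  by split=> //; [move=> g G Lg gb; apply: h2 => //; lia | rewrite addnC].
have {}ba : (b * m < a * n)%N.
  rewrite ltn_neqAle ba andbT; apply/eqP => E.
  by have := coprime_mul_eq co E a0 n0; lia.
have co' : coprime m n by rewrite coprime_sym.
have sym L' u' k' : holes_below n m L' u' k' -> holes_below m n L' u' k'.
  by move=> H q q1 q2; have [x [y [x0 y0 ->]]] := H q q1 q2; exists y, x; split=> //; lia.
have sym' L' k' : below_holes n m L' k' -> below_holes m n L' k'.
  by move=> H q x y x0 y0 e1; apply: (H q y x) => //; lia.
have e' : k = (lam + b * m + a * n)%N by lia.
have [h1 h2 h3 h4] := new_corner co' m0 n0 (sym _ _ _ Lh) (sym' _ _ hL) Ll ul b0 a0 am e' ba.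
have ext v : extend m n L lam v <-> extend n m L lam v.
  by split=> [] [Lv|[g /semigroup2C G ->]]; by [left | right; exists g].
exists (b * m)%N, (lam + a * n)%N; split.
- by exists 0%N, b; rewrite mul0n.
- by rewrite addnC.
- lia.
split.
- move=> g G Lg gb; have [|d /semigroup2C D ->] := h2 g (semigroup2C G) Lg; first by lia.
  by exists d.
- move=> q Lq uq.
  have Lq' : ~ extend m n L lam q by move=> /ext.
  have uq' : (lam + b * m < q)%N by lia.
  by have [x [y [x0 y0 ->]]] := h3 q Lq' uq'; exists y, x; split=> //; lia.
move=> q x y x0 y0 e'' /ext; apply: (h4 q y x) => //; lia.
Qed.

(** The staircase of the semigroup itself has the only corner [n * m]: take the
    j < n with j m congruent to [q] modulo n. *)
Lemma semigroup2_hole n m q : coprime n m -> (0 < n)%N -> (0 < m)%N ->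
  ~ semigroup2 n m q ->
  exists x y, [/\ (0 < x)%N, (0 < y)%N & (n * m = q + x * n + y * m)%N].
Proof.
move=> co n0 m0 Gq.
have [j jn /eqP je] : exists2 j, (j < n)%N & j * m == q %[mod n].
  exists (chinese n m q 0 %/ m %% n)%N; first exact: ltn_pmod.
  have mc : (chinese n m q 0 %% m = 0)%N by rewrite chinese_modr // mod0n.
  rewrite -modnMml modn_mod modnMml divnK; last by rewrite /dvdn mc.
  by rewrite chinese_modl.
have [jq|qj] := leqP (j * m) q.
  have /dvdnP [x xe] : n %| q - j * m by rewrite -eqn_mod_dvd // je.
  by case: Gq; exists x, j; lia.
have /dvdnP [x xe] : n %| j * m - q by rewrite -eqn_mod_dvd ?je //; lia.
exists x, (n - j)%N; split; [| lia |].
  by case: x xe => //; lia.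
have : (j * m <= n * m)%N by apply: leq_mul => //; lia.
by rewrite mulnBl; lia.
Qed.

Lemma semigroup2_below n m q x y : coprime n m -> (0 < n)%N -> (0 < m)%N ->
  (0 < x)%N -> (0 < y)%N -> (n * m = q + x * n + y * m)%N -> ~ semigroup2 n m q.
Proof.
move=> co n0 m0 x0 y0 e [i [j ij]].
have : ((n - j - y) * m = (i + x) * n)%N by rewrite !mulnBl mulnDl; lia.
move=> /(coprime_mul_eq co); lia.
Qed.

Lemma semigroup2_inj n m i j k l : coprime n m -> (0 < n)%N -> (0 < m)%N ->
  (i * n + j * m < n * m)%N -> (i * n + j * m = k * n + l * m)%N ->
  i = k /\ j = l.
Proof.
move=> co n0 m0 b e.
have jn : (j < n)%N by rewrite -(ltn_pmul2r m0); lia.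
have ln : (l < n)%N by rewrite -(ltn_pmul2r m0); lia.
suff jl : j = l by split=> //; apply/eqP; rewrite -(eqn_pmul2r n0); apply/eqP; lia.
have [lj|jl|//] := ltngtP l j.
  have : ((j - l) * m = (k - i) * n)%N by rewrite !mulnBl; lia.
  move=> /(coprime_mul_eq co); have [ki|ik] := leqP k i; last by lia.
  have := leq_mul ki (leqnn n); have : (l * m < j * m)%N by rewrite ltn_pmul2r.
  by lia.
have : ((l - j) * m = (i - k) * n)%N by rewrite !mulnBl; lia.
move=> /(coprime_mul_eq co); have [ki|ik] := leqP i k; last by lia.
have := leq_mul ki (leqnn n); have : (j * m < l * m)%N by rewrite ltn_pmul2r.
by lia.
Qed.

End Holes.

(** * The standard-basis process *)

Section Process.
Variables (K : fieldType) (X : lmodType K) (n m p : nat).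
Hypotheses (co : coprime n m) (n1 : (1 < n)%N) (nm : (n < m)%N).
Local Notation G := (semigroup2 n m).

(** [X] stands for the module of forms, [E g] for the multiplication by the
    monomial of value [g], [ge w] for the forms whose divisorial order is at
    least [w], and [lc1 w], [lc2 w] for the coefficients of order [w] on the two
    leaves. *)
Variables (E : nat -> X -> X) (ge : nat -> X -> Prop) (lc1 lc2 : nat -> X -> K).
Variables (adm : X -> Prop).
Hypotheses
  (E_lin : forall g a x y, E g (a *: x + y) = a *: E g x + E g y)
  (E_add : forall g d x, G g -> G d -> (g + d < n * m)%N -> E g (E d x) = E (g + d) x)
  (ge_lin : forall w a x y, ge w x -> ge w y -> ge w (a *: x + y))
  (geW : forall v w x, (v <= w)%N -> ge w x -> ge v x)
  (ge0 : forall w, ge w 0)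
  (ge_all : forall x, ge 0 x)
  (ge_E : forall g w x, G g -> ge w x -> ge (w + g)%N (E g x))
  (ge_E_strict : forall g w x, G g -> ge w x -> ge (w + g).+1 (E g x) -> ge w.+1 x)
  (lc1_lin : forall w a x y, lc1 w (a *: x + y) = a * lc1 w x + lc1 w y)
  (lc2_lin : forall w a x y, lc2 w (a *: x + y) = a * lc2 w x + lc2 w y)
  (lc1_ge : forall w x, ge w.+1 x -> lc1 w x = 0)
  (lc2_ge : forall w x, ge w.+1 x -> lc2 w x = 0)
  (lc1_E : forall g w x, G g -> ge w x ->
     exists2 c, c != 0 & lc1 (w + g)%N (E g x) = c * lc1 w x)
  (lc2_E : forall g w x, G g -> ge w x ->
     exists2 c, c != 0 & lc2 (w + g)%N (E g x) = c * lc2 w x)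
  (adm_lin : forall a x y, adm x -> adm y -> adm (a *: x + y))
  (adm0 : adm 0)
  (adm_E : forall g x, G g -> adm x -> adm (E g x)).

Definition good w x := [/\ ge w x, lc1 w x != 0 & lc2 w x != 0].

Let E_0 g : E g 0 = 0.
Proof. by have := E_lin g 1 0 0; rewrite !scale1r addr0 => /(congr1 (fun y => y - E g 0)); rewrite subrr addrK => <-. Qed.
Let E_D g x y : E g (x + y) = E g x + E g y.
Proof. by have := E_lin g 1 x y; rewrite !scale1r. Qed.
Let ge_D w x y : ge w x -> ge w y -> ge w (x + y).
Proof. by move=> xw yw; rewrite -[x]scale1r; apply: ge_lin. Qed.
Let ge_Z w a x : ge w x -> ge w (a *: x).
Proof. by move=> xw; rewrite -[a *: x]addr0; apply: ge_lin. Qed.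
Let adm_D x y : adm x -> adm y -> adm (x + y).
Proof. by move=> xw yw; rewrite -[x]scale1r; apply: adm_lin. Qed.

Lemma good_E g w x : G g -> good w x -> good (g + w) (E g x).
Proof.
move=> Gg [gx l1 l2]; rewrite addnC; split; first exact: ge_E.
  by have [c c0 ->] := lc1_E Gg gx; rewrite mulf_neq0.
by have [c c0 ->] := lc2_E Gg gx; rewrite mulf_neq0.
Qed.

Lemma good_lead w a x y : a != 0 -> good w x -> ge w.+1 y -> good w (a *: x + y).
Proof.
move=> a0 [gx l1 l2] gy; split.
- by apply: ge_lin => //; apply: geW gy.
- by rewrite lc1_lin (lc1_ge gy) addr0 mulf_neq0.
- by rewrite lc2_lin (lc2_ge gy) addr0 mulf_neq0.
Qed.

(** A span filtered by the level [w], in which everything of order beyond [p]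
    counts as zero. *)
Inductive combination (L : nat -> Prop) (h : nat -> X) (eta : X) (lam w : nat) :
    X -> Prop :=
| Comb_ge x : ge p.+1 x -> combination L h eta lam w x
| Comb_h v a x : L v -> (w <= v)%N -> (v <= p)%N ->
    combination L h eta lam w x -> combination L h eta lam w (a *: h v + x)
| Comb_e g a x : G g -> (w <= g + lam)%N -> (g + lam <= p)%N ->
    combination L h eta lam w x -> combination L h eta lam w (a *: E g eta + x).

Section Combination.
Variables (L : nat -> Prop) (h : nat -> X) (eta : X) (lam : nat).
Local Notation P := (combination L h eta lam).

Lemma comb0 w : P w 0. Proof. exact/Comb_ge/ge0. Qed.
Lemma combD w x y : P w x -> P w y -> P w (x + y).
Proof.
move=> Px Py; elim: Px => [z gz|v a z Lv wv vp _ IH|g a z Gg wg gp _ IH].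
- elim: Py => [z' gz'|v a z' Lv wv vp _ IH|g a z' Gg wg gp _ IH].
  + exact/Comb_ge/ge_D.
  + by rewrite addrCA; apply: Comb_h.
  + by rewrite addrCA; apply: Comb_e.
- by rewrite -addrA; apply: Comb_h.
- by rewrite -addrA; apply: Comb_e.
Qed.
Lemma combZ w c x : P w x -> P w (c *: x).
Proof.
elim=> [z gz|v a z Lv wv vp _ IH|g a z Gg wg gp _ IH].
- exact/Comb_ge/ge_Z.
- by rewrite scalerDr scalerA; apply: Comb_h.
- by rewrite scalerDr scalerA; apply: Comb_e.
Qed.
Lemma combB w x y : P w x -> P w y -> P w (x - y).
Proof. by move=> Px Py; apply: combD => //; rewrite -scaleN1r; apply: combZ. Qed.
Lemma combW v w x : (v <= w)%N -> P w x -> P v x.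
Proof.
move=> vw; elim=> [z gz|u a z Lu wu up _ IH|g a z Gg wg gp _ IH].
- exact: Comb_ge.
- by apply: Comb_h => //; exact: leq_trans wu.
- by apply: Comb_e => //; exact: leq_trans wg.
Qed.
Lemma comb_h w v : L v -> (w <= v)%N -> (v <= p)%N -> P w (h v).
Proof.
by move=> Lv wv vp; rewrite -[h v]scale1r -[_ *: _]addr0; apply: Comb_h => //; exact: comb0.
Qed.
Lemma comb_e w g : G g -> (w <= g + lam)%N -> ge lam eta -> P w (E g eta).
Proof.
move=> Gg wg le; have [gp|pg] := leqP (g + lam) p; last first.
  by apply: Comb_ge; apply: (geW (w := lam + g)); [lia | exact: ge_E].
by rewrite -[E g eta]scale1r -[_ *: _]addr0; apply: Comb_e => //; exact: comb0.
Qed.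

Hypothesis hgood : forall v, L v -> (v <= p)%N -> good v (h v).
Hypothesis eta_ge : ge lam eta.

Lemma comb_ge w x : (w <= p.+1)%N -> P w x -> ge w x.
Proof.
move=> wp; elim=> [z gz|v a z Lv wv vp _ IH|g a z Gg wg gp _ IH].
- exact: geW gz.
- by apply: ge_lin => //; have [gv _ _] := hgood Lv vp; apply: geW gv.
- by apply: ge_lin => //; apply: (geW (w := lam + g)); [lia | exact: ge_E].
Qed.

Lemma comb_level w x : P w x -> (w <= p)%N ->
  exists a c y, [/\ x = a *: h w + c *: E (w - lam) eta + y, P w.+1 y,
    a != 0 -> L w & c != 0 -> (lam <= w)%N /\ G (w - lam)].
Proof.
move=> Px wp; elim: Px => [z gz|v a z Lv wv vp _ [b [c [y [-> Py Hb Hc]]]]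
    |g a z Gg wg gp _ [b [c [y [-> Py Hb Hc]]]]].
- exists 0, 0, z; rewrite !scale0r !add0r eqxx; split=> //; exact: Comb_ge.
- have [E1|vw] := eqVneq v w.
    exists (a + b), c, y; rewrite E1 in Lv *; split=> //.
    by rewrite scalerDl !addrA.
  exists b, c, (a *: h v + y); split=> //; last by apply: Comb_h => //; lia.
  by rewrite addrCA.
have [E1|vw] := eqVneq (g + lam)%N w.
  exists b, (a + c), y; split=> //.
    by rewrite -E1 addnK scalerDl !addrA; congr (_ + _); rewrite addrAC addrC !addrA.
  by rewrite -E1 addnK; split=> //; lia.
exists b, c, (a *: E g eta + y); split=> //; last by apply: Comb_e => //; lia.
by rewrite addrCA.
Qed.

(** When no level below [p] is reached twice, the lowest term of a combination
    decides. *)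
Lemma comb_final :
  (forall g, G g -> (g + lam < p)%N -> ~ L (g + lam) /\ good lam eta) ->
  (forall x, P 0 x) -> forall x, (exists2 w, (w < p)%N & good w x) \/ ge p x.
Proof.
move=> sep P0 x.
have H w : (w <= p)%N -> P w x \/ (exists2 w, (w < p)%N & good w x).
  elim: w => [|w IH] wp; first by left; exact: P0.
  have [Px|] := IH (ltnW wp); last by right.
  have [a [c [y [xE Py Ha Hc]]]] := comb_level Px (ltnW wp).
  have gy : ge w.+1 y by apply: comb_ge Py; lia.
  have [c0|c0] := eqVneq c 0; last first.
    have [lw Gw] := Hc c0; have [|nL gl] := sep _ Gw; first by lia.
    have a0 : a = 0.
      by apply/eqP/negbNE/negP => /Ha; rewrite subnK // in nL.
    right; exists w => //; rewrite xE a0 scale0r add0r; apply: good_lead => //.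
    by rewrite -{1}(subnK lw); apply: good_E.
  have [a0|a0] := eqVneq a 0.
    by left; rewrite xE a0 c0 !scale0r !add0r.
  right; exists w => //; rewrite xE c0 scale0r addr0; apply: good_lead => //.
  by apply: hgood; [exact: Ha | lia].
by have [Px|] := H p (leqnn p); [right; apply: comb_ge Px; lia | left].
Qed.

End Combination.

(** The divisorial order of [x] is [w], but the value on one of the leaves is
    larger. *)
Definition bad w x := [/\ ge w x, ~ ge w.+1 x & lc1 w x = 0 \/ lc2 w x = 0].

Variable xl : X.
Hypothesis xl_good : good p xl.

(** Expand [xl].  Below [p] its terms vanish one after the other: a leading
    coefficient that is zero for [zeta] kills the multiple of [h w], and then the
    order kills that of [zeta].  At level [p] only a multiple of [zeta] is left,
    while both leading coefficients of [xl] are nonzero. *)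
Lemma comb_bad (L : nat -> Prop) (h : nat -> X) (zeta : X) (w0 : nat) :
  (forall v, L v -> (v <= p)%N -> good v (h v)) ->
  bad w0 zeta -> ~ L p -> (forall x, combination L h zeta w0 0 x) -> False.
Proof.
move=> hgood [gz ngz z0] Lp P0; have [gx x1 x2] := xl_good.
have lcE s : (s = lc1 \/ s = lc2) -> s w0 zeta = 0 -> forall w, (w0 <= w)%N ->
    G (w - w0) -> s w (E (w - w0) zeta) = 0.
  move=> + sz w w0w Gw.
  case=> E1; rewrite E1 in sz *; rewrite -{1}(subnKC w0w).
    by have [c _ ->] := lc1_E Gw gz; rewrite sz mulr0.
  by have [c _ ->] := lc2_E Gw gz; rewrite sz mulr0.
have [s [sE sz s_lin s_ge s_good]] : exists s, [/\ s = lc1 \/ s = lc2, s w0 zeta = 0,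
    forall w a x y, s w (a *: x + y) = a * s w x + s w y,
    forall w x, ge w.+1 x -> s w x = 0 & forall w x, good w x -> s w x != 0].
  by case: z0 => z0; [exists lc1 | exists lc2]; split; auto; move=> w x [].
have s_D w x y : s w (x + y) = s w x + s w y.
  by have := s_lin w 1 x y; rewrite scale1r mul1r.
have s_Z w a x : s w (a *: x) = a * s w x.
  by have := s_lin w a x 0; rewrite !addr0 (s_ge w 0) ?addr0 //; exact: ge0.
have lcz w a c : (c != 0 -> (w0 <= w)%N /\ G (w - w0)) ->
    s w (a *: h w + c *: E (w - w0) zeta) = a * s w (h w).
  move=> Hc; rewrite s_D !s_Z; have [->|/Hc [w0w Gw]] := eqVneq c 0.
    by rewrite mul0r addr0.
  by rewrite (lcE s sE sz) // mulr0 addr0.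
have H w : (w <= p)%N -> combination L h zeta w0 w xl.
  elim: w => [|w IH] wp; first exact: P0.
  have [a [c [y [xE Py Ha Hc]]]] := comb_level (IH (ltnW wp)) (ltnW wp).
  have gy : ge w.+1 y by apply: (comb_ge hgood gz) Py; lia.
  have gac : ge w.+1 (a *: h w + c *: E (w - w0) zeta).
    rewrite -[_ + _](addrK y) -xE -[_ - y]addrC -scaleN1r; apply: ge_lin => //.
    exact: geW gx.
  have a0 : a = 0.
    apply/eqP/negbNE/negP => a0.
    have := s_ge _ _ gac; rewrite lcz // => /eqP; rewrite mulf_eq0 (negbTE a0) /=.
    by apply/negP/s_good/hgood; [exact: Ha | lia].
  have c0 : c = 0.
    apply/eqP/negbNE/negP => c0; have [w0w Gw] := Hc c0.
    rewrite a0 scale0r add0r in gac.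
    have := ge_Z c^-1 gac; rewrite scalerA mulVf // scale1r -{1}(subnKC w0w).
    by move=> /(ge_E_strict Gw gz).
  by rewrite xE a0 c0 !scale0r !add0r.
have [a [c [y [xE Py Ha Hc]]]] := comb_level (H p (leqnn p)) (leqnn p).
have gy : ge p.+1 y by apply: (comb_ge hgood gz) Py; lia.
have a0 : a = 0 by apply/eqP/negbNE/negP => /Ha.
have : s p xl = 0.
  by rewrite xE s_D lcz // a0 mul0r add0r s_ge.
by apply/eqP/s_good.
Qed.

Hypothesis p_minimal : forall d x g, adm x -> good d x -> (d < p)%N -> G g ->
  p <> (g + d)%N.

(** A state of the process: [L] is generated by the values of the forms found
    before [eta], whose value is [lam]; [h v] is a multiple of one of them of
    value [v].  By [st_gen] every form reduces to multiples of [eta] and to one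
    multiple [h v] for each [v]; by [st_mul] another multiple of the same value
    differs from [h v] by terms of higher level. *)
Record stage (L : nat -> Prop) (h : nat -> X) (eta : X) (lam u k : nat) : Prop :=
  Stage {
  st_h : forall v, L v -> (v <= p)%N -> good v (h v) /\ adm (h v);
  st_n : forall v, L v -> (n <= v)%N;
  st_LG : forall v g, L v -> G g -> L (g + v)%N;
  st_p : ~ L p;
  st_eta : good lam eta;
  st_adm : adm eta;
  st_nlam : (n <= lam)%N;
  st_lamp : (lam < p)%N;
  st_hole : ~ L lam;
  st_u : (u < lam)%N;
  st_holes : holes_below n m L u k;
  st_below : below_holes n m L k;
  st_k : (k <= n * m + n)%N;
  st_gen : forall x, combination L h eta lam 0 x;
  st_mul : forall v g, L v -> G g -> (g + v <= p)%N ->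
    exists a, combination L h eta lam (g + v).+1 (E g (h v) - a *: h (g + v)%N) }.

Section Step.
Variables (L : nat -> Prop) (h : nat -> X) (eta : X) (lam u k : nat).
Hypothesis S : stage L h eta lam u k.
Variables (g0 k' : nat).
Local Notation u' := (g0 + lam)%N.
Local Notation L' := (extend n m L lam).
Local Notation P := (combination L h eta lam).
Hypotheses (Gg0 : G g0) (Lu' : L u') (u'p : (u' < p)%N) (k'b : (k' <= n * m + n)%N).
Hypothesis corner : forall g, G g -> L (g + lam)%N -> (g + lam < k')%N ->
          exists2 d, G d & g = (d + g0)%N.
Hypothesis holes' : holes_below n m L' u' k'.
Hypothesis below' : below_holes n m L' k'.

Let L'p : ~ L' p.
Proof.
move=> [/(st_p S)//|[g Gg]].
exact: (p_minimal (st_adm S) (st_eta S) (st_lamp S) Gg).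
Qed.
Let pk' : (p < k')%N.
Proof. by have [x [y [x0 y0 ->]]] := holes' L'p u'p; nia. Qed.

Definition step_h v := if `[< L v >] then h v else E (v - lam) eta.
Let h'L v : L v -> step_h v = h v.
Proof. by move=> Lv; rewrite /step_h asboolT. Qed.
Let h'E g : ~ L (g + lam)%N -> step_h (g + lam) = E g eta.
Proof. by move=> Lv; rewrite /step_h asboolF // addnK. Qed.
Let EE g d x : G g -> G d -> (g + d + lam <= p)%N -> E g (E d x) = E (g + d) x.
Proof. by move=> Gg Gd gd; apply: E_add => //; have := st_nlam S; lia. Qed.
Let eta_ge : ge lam eta. Proof. by case: (st_eta S). Qed.

Lemma step_h_good v : L' v -> (v <= p)%N -> good v (step_h v) /\ adm (step_h v).
Proof.
move=> L'v vp; have [Lv|nLv] := pselect (L v); first by rewrite h'L //; exact: (st_h S).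
case: L'v => // -[g Gg E1]; rewrite E1 in nLv *; rewrite h'E //.
by split; [exact/good_E/(st_eta S) | exact/adm_E/(st_adm S)].
Qed.

Inductive tail : X -> Prop :=
| Tail0 : tail 0
| Tail_h v a x : L v -> (u' <= v)%N -> (v <= p)%N -> tail x -> tail (a *: h v + x)
| Tail_e g a x : G g -> (g0 < g)%N -> (g + lam <= p)%N -> tail x ->
    tail (a *: E g eta + x).

(** The candidates for the next form: the S-process at the corner [u']. *)
Definition s_form zeta := exists2 y, tail y & zeta = E g0 eta + y.

Lemma s_form_adm zeta : s_form zeta -> adm zeta.
Proof.
move=> [y ty ->]; apply: adm_D; first exact/adm_E/(st_adm S).
elim: ty => [//|v a x Lv uv vp _ IH|g a x Gg gg gp _ IH]; apply: adm_lin => //.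
  by have [] := st_h S Lv vp.
exact/adm_E/(st_adm S).
Qed.

Lemma s_form_tail zeta y : s_form zeta -> tail y -> s_form (y + zeta).
Proof.
move=> [y' ty' ->] ty; exists (y + y'); last by rewrite addrCA.
elim: ty => [|v a x Lv uv vp _ IH|g a x Gg gg gp _ IH]; first by rewrite add0r.
  by rewrite -addrA; apply: Tail_h.
by rewrite -addrA; apply: Tail_e.
Qed.

Section Next.
Variables (zeta : X) (w1 : nat).
Hypotheses (rel : s_form zeta) (zeta_ge : ge w1 zeta) (uw1 : (u' <= w1)%N).
Local Notation P' := (combination L' step_h zeta w1).

Let sub_from w : (forall g, G g -> (g + lam <= p)%N -> (w <= g + lam)%N ->
    P' (g + lam) (E g eta)) -> forall v x, (w <= v)%N -> P v x -> P' v x.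
Proof.
move=> H v x wv; elim=> [z gz|v' a z Lv wv' vp _ IH|g a z Gg wg gp _ IH].
- exact: Comb_ge.
- by rewrite -(h'L Lv); apply: Comb_h => //; left.
- by apply: combD => //; apply: combZ; apply: (combW wg); apply: H => //; exact: leq_trans wg.
Qed.

(** By descending induction on the level: if [g + lam] is already in [L], then
    [g] is a multiple of [g0], and the definition of [zeta] expresses [E g eta]
    by a multiple of [zeta], by [h] and by terms of higher level. *)
Lemma step_e g : G g -> (g + lam <= p)%N ->
  P' (g + lam) (E g eta) /\
  ((u' < w1)%N -> exists a, P' (g + lam).+1 (E g eta - a *: step_h (g + lam))).
Proof.
move: {2}(p - (g + lam))%N (leqnn (p - (g + lam))) => N.
elim/ltn_ind: N g => N IHN g gN Gg gp.
have IH g' : G g' -> (g' + lam <= p)%N -> ((g + lam).+1 <= g' + lam)%N ->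
    P' (g' + lam) (E g' eta).
  move=> Gg' gp' gg'; have lt : (p - (g' + lam) < N)%N by lia.
  by have [] := IHN _ lt g' (leqnn _) Gg' gp'.
have sub := sub_from IH.
have [Lg|nLg] := pselect (L (g + lam)%N); last first.
  have hE := h'E nLg; split.
    by rewrite -hE; apply: comb_h => //; right; exists g.
  by move=> _; exists 1; rewrite scale1r hE subrr; exact: comb0.
have [d Gd gE] := corner Gg Lg (leq_ltn_trans gp pk').
have w0E : (g + lam = d + u')%N by rewrite gE addnA.
have [y ty zE] := rel.
have [a Pa] : exists a, P' (g + lam).+1 (E d y - a *: step_h (g + lam)).
  elim: ty => [|v b x Lv uv vp _ [a Pa]|g' b x Gg' gg gp' _ [a Pa]].
  - by exists 0; rewrite E_0 scale0r subrr; exact: comb0.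
  - rewrite E_lin; have [pv|vp'] := ltnP p (d + v).
      exists a; rewrite -addrA; apply: combD => //; apply: combZ; apply: Comb_ge.
      have [[gv _ _] _] := st_h S Lv vp.
      by apply: (geW (w := (v + d)%N)); [lia | exact: ge_E].
    have [c Pc] := st_mul S Lv Gd vp'.
    have Pc' : P' (g + lam).+1 (E d (h v) - c *: h (d + v)%N).
      by apply: (combW (w := (d + v).+1)); [lia | apply: sub Pc; lia].
    have [E1|vu] := eqVneq v u'.
      have vE : (d + v = g + lam)%N by rewrite w0E E1.
      exists (a + b * c); rewrite vE in Pc'.
      rewrite h'L // in Pa *; have := combD (combZ b Pc') Pa.
      by rewrite scalerBr scalerA scalerDl opprD addrACA [- (a *: _) - _]addrC.
    exists a; rewrite -addrA; apply: combD => //; apply: combZ.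
    rewrite -(subrK (c *: h (d + v)%N) (E d (h v))); apply: combD => //.
    have Ldv := st_LG S Lv Gd.
    by apply: combZ; rewrite -(h'L Ldv); apply: comb_h; [left | lia |].
  rewrite E_lin; exists a; rewrite -addrA; apply: combD => //; apply: combZ.
  have [pv|vp'] := ltnP p (d + g' + lam).
    apply: Comb_ge; apply: (geW (w := (lam + g' + d)%N)); first lia.
    by apply: ge_E => //; apply: ge_E.
  rewrite EE //; apply: (combW (w := (d + g' + lam)%N)); first lia.
  by apply: IH => //; [exact: semigroup2D | lia].
have Edz : P' (d + w1) (E d zeta) by apply: comb_e.
have Eg : E g eta = E d zeta - E d y.
  by rewrite zE E_D addrK EE ?gE //; lia.
have hp : P' (g + lam) (step_h (g + lam)) by apply: comb_h => //; left.
split.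
  rewrite Eg; apply: combB; first by apply: combW Edz; lia.
  rewrite -(subrK (a *: step_h (g + lam)) (E d y)).
  by apply: combD; [apply: combW Pa | apply: combZ].
move=> uw; exists (- a); rewrite scaleNr opprK Eg -addrA; apply: combD.
  by apply: combW Edz; lia.
by rewrite -[- _ + _]opprK opprD opprK -scaleN1r; apply: combZ.
Qed.

Let sub v x : P v x -> P' v x.
Proof. by apply: (sub_from (w := 0)) => // g Gg gp _; have [] := step_e Gg gp. Qed.

Lemma step_gen x : P' 0 x.
Proof. exact/sub/(st_gen S). Qed.

Lemma step_mul : (u' < w1)%N -> forall v g, L' v -> G g -> (g + v <= p)%N ->
  exists a, P' (g + v).+1 (E g (step_h v) - a *: step_h (g + v)%N).
Proof.
move=> uw v g L'v Gg gv; have [Lv|nLv] := pselect (L v).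
  have [a Pa] := st_mul S Lv Gg gv; exists a.
  by rewrite !h'L //; [exact: sub | exact: (st_LG S)].
case: L'v => // -[d Gd E1]; rewrite E1 in nLv gv *.
rewrite h'E // EE ?addnA //; last lia.
rewrite addnA in gv.
by have [_ /(_ uw)] := step_e (semigroup2D Gg Gd) gv.
Qed.

Lemma step_stage : good w1 zeta -> ~ L' w1 -> (w1 < p)%N ->
  stage L' step_h zeta w1 u' k'.
Proof.
move=> gz L'w w1p.
have uw : (u' < w1)%N.
  by rewrite ltn_neqAle uw1 andbT; apply/eqP => E1; apply: L'w; left; rewrite -E1.
split=> //.
- exact: step_h_good.
- by move=> v [/(st_n S)//|[g Gg ->]]; have := st_nlam S; lia.
- move=> v g [Lv|[d Gd ->]] Gg; first by left; exact: (st_LG S).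
  by right; exists (g + d)%N; [exact: semigroup2D | rewrite addnA].
- exact: s_form_adm.
- by have := st_nlam S; lia.
- exact: step_gen.
- exact: step_mul.
Qed.

End Next.

(** Subtracting the [h v] raises the order of the S-process until it exceeds
    [p], or reaches a new value, or shows a form of type [bad]. *)
Lemma step_loop w : (u' <= w)%N -> (w <= p.+1)%N ->
  (exists2 zeta, s_form zeta & ge w zeta) \/
  (exists zeta w', [/\ (u' <= w')%N, (w' <= p)%N, s_form zeta &
     (good w' zeta /\ ~ L' w') \/ bad w' zeta]).
Proof.
elim: w => [|w IH] uw wp.
  left; exists (E g0 eta) => //; exists 0; [exact: Tail0 | by rewrite addr0].
have [wu|uw'] := ltnP w u'.
  left; exists (E g0 eta); first by exists 0; [exact: Tail0 | rewrite addr0].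
  by apply: (geW (w := (lam + g0)%N)); [lia | exact: ge_E].
have [[zeta rel gz]|] := IH uw' (ltnW wp); last by right.
have [gz'|ngz] := pselect (ge w.+1 zeta); first by left; exists zeta.
have [L'w|nL'w] := pselect (L' w); last first.
  right; exists zeta, w; split=> //; rewrite /good /bad.
  have [z1|z1] := eqVneq (lc1 w zeta) 0; first by right; split=> //; left.
  by have [z2|z2] := eqVneq (lc2 w zeta) 0; [right; split=> //; right | left].
have [[gh h1 h2] _] := step_h_good L'w wp.
pose a := - (lc1 w zeta / lc1 w (step_h w)).
have rel' : s_form (a *: step_h w + zeta).
  apply: s_form_tail => //; rewrite -[_ *: _]addr0.
  have [Lw|nLw] := pselect (L w); first by rewrite h'L //; apply: Tail_h => //; exact: Tail0.
  case: (L'w) => // -[g Gg wE]; rewrite wE in nLw uw' wp *; rewrite h'E //.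
  apply: Tail_e => //; last exact: Tail0.
  rewrite ltn_neqAle; apply/andP; split; last lia.
  by apply/eqP => E1; apply: nLw; rewrite -E1.
have gz' : ge w (a *: step_h w + zeta) by apply: ge_lin.
have [gz''|ngz'] := pselect (ge w.+1 (a *: step_h w + zeta)).
  by left; exists (a *: step_h w + zeta).
right; exists (a *: step_h w + zeta), w; split=> //; right; split=> //; left.
by rewrite lc1_lin /a mulNr divfK // addNr.
Qed.

End Step.

(** The value of [eta] increases at each step, hence the process ends. *)
Lemma stage_final N L h eta lam u k : stage L h eta lam u k -> (p - lam <= N)%N ->
  forall x, (exists2 w, (w < p)%N & good w x) \/ ge p x.
Proof.
elim: N L h eta lam u k => [|N IH] L h eta lam u k S lamN.
  by have := st_lamp S; lia.
have [g0 [k' [Gg0 Lu' /andP [k'u k'b] [corner holes' below']]]] :=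
  next_corners co n1 nm (st_holes S) (st_below S) (st_hole S) (st_u S) (st_nlam S) (st_k S).
have L'p : ~ extend n m L lam p.
  move=> [/(st_p S)//|[g Gg]].
  exact: (p_minimal (st_adm S) (st_eta S) (st_lamp S) Gg).
have hg v : L v -> (v <= p)%N -> good v (h v) by move=> Lv vp; have [] := st_h S Lv vp.
have [u'p|pu'] := ltnP (g0 + lam) p; last first.
  apply: (comb_final hg _ _ (st_gen S)); first by case: (st_eta S).
  move=> g Gg gp; split; last exact: (st_eta S).
  move=> Lg.
  have pu : (p < g0 + lam)%N.
    by rewrite ltn_neqAle pu' andbT; apply/eqP => E1; apply: (st_p S); rewrite E1.
  have [d _ E1] := corner _ Gg Lg (ltn_trans gp (ltn_trans pu k'u)).
  by lia.
have hg' v : extend n m L lam v -> (v <= p)%N -> good v (step_h L h eta lam v).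
  by move=> L'v vp; have [] := step_h_good S L'v vp.
have up1 : (g0 + lam <= p.+1)%N by lia.
have [[zeta rel gz]|] := step_loop S Gg0 Lu' u'p k'b holes' up1 (leqnn _).
  apply: (comb_final hg' gz); last first.
    apply: (step_gen S Gg0 u'p k'b corner holes' rel gz); lia.
  by move=> g _; lia.
move=> [zeta [w [uw wp rel [[gz L'w]|bz]]]]; last first.
  have [gz _ _] := bz.
  have := comb_bad hg' bz L'p; case.
  exact: (step_gen S Gg0 u'p k'b corner holes' rel gz).
have [E1|wp'] := eqVneq w p.
  have [gz1 _ _] := gz.
  apply: (comb_final hg' gz1); last first.
    exact: (step_gen S Gg0 u'p k'b corner holes' rel gz1).
  by move=> g _; lia.
have {}wp : (w < p)%N by rewrite ltn_neqAle wp' wp.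
have [gz1 _ _] := gz.
apply: (IH _ _ _ _ _ _ (step_stage S Gg0 Lu' u'p k'b corner holes' below' rel gz1 uw gz L'w wp)).
have : w <> (g0 + lam)%N by move=> E1; apply: L'w; left; rewrite E1.
by have := st_lamp S; lia.
Qed.


(** The process starts from two forms of values [n] and [m] which generate. *)
Variables (x0 x1 : X).
Hypotheses (x0_good : good n x0) (x1_good : good m x1) (x0_adm : adm x0) (x1_adm : adm x1).
Let L0 v := exists2 g, G g & v = (g + n)%N.
Let h0 v := E (v - n) x0.
Hypothesis gen0 : forall x, combination L0 h0 x1 m 0 x.

Let n0 : (0 < n)%N. Proof. by lia. Qed.
Let m0 : (0 < m)%N. Proof. by lia. Qed.

Lemma first_holes : holes_below n m L0 0 (n * m + n).
Proof.
move=> q Lq q0; have Gq : ~ semigroup2 n m q \/ (n <= q)%N.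
  have [nq|qn] := leqP n q; [by right | left].
  move=> [[|i] [[|j] E1]]; lia.
have [G1|nq] := Gq.
  have [x [y [x_0 y_0 ->]]] := semigroup2_hole co n0 m0 G1.
  by exists x.+1, y; split=> //; rewrite mulSn; lia.
have G1 : ~ semigroup2 n m (q - n).
  by move=> G1; apply: Lq; exists (q - n)%N => //; rewrite subnK.
have [x [y [x_0 y_0 ->]]] := semigroup2_hole co n0 m0 G1.
by exists x, y; split=> //; lia.
Qed.

Lemma first_below : below_holes n m L0 (n * m + n).
Proof.
move=> q x y x_0 y_0 e [g Gg qE]; apply: (semigroup2_below co n0 m0 x_0 y_0 _ Gg).
by lia.
Qed.

Theorem values_below_p x : (exists2 w, (w < p)%N & good w x) \/ ge p x.
Proof.
have h0_good v : L0 v -> (v <= p)%N -> good v (h0 v) /\ adm (h0 v).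
  move=> [g Gg ->] _; rewrite /h0 addnK; split; [exact: good_E | exact: adm_E].
have hg v : L0 v -> (v <= p)%N -> good v (h0 v) by move=> Lv vp; have [] := h0_good v Lv vp.
have [pm|mp] := leqP p m.
  apply: (comb_final hg _ _ gen0); first by case: x1_good.
  by move=> g _; lia.
have L0p : ~ L0 p.
  by move=> [g Gg]; apply: (p_minimal x0_adm x0_good _ Gg); lia.
have pnm : (p < n * m + n)%N.
  by have [|x' [y' [x_0 y_0 ->]]] := first_holes L0p; nia.
apply: (@stage_final (p - m)%N L0 h0 x1 m 0 (n * m + n)%N) => //; split=> //.
- by move=> v [g _ ->]; lia.
- move=> v g [d Gd ->] Gg; exists (g + d)%N; [exact: semigroup2D | by rewrite addnA].
- exact: ltnW.
- move=> [_ [i [[|j] ->]] E1]; last by nia.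
  have : (n %| m)%N by rewrite {1}E1 mul0n addn0 dvdn_addl ?dvdn_mull.
  by move=> /gcdn_idPl; rewrite (eqP co); lia.
- exact: first_holes.
- exact: first_below.
move=> v g [d Gd vE] Gg gv; exists 1; rewrite /h0 scale1r vE addnA !addnK E_add //; last by lia.
by rewrite subrr; exact: comb0.
Qed.

End Process.

(** * Forms restricted to the leaves of a dicritical foliation *)

Definition form (R : realType) := (ps (ps R[i]) * ps (ps R[i]))%type.

Section FormModule.
Variable R : realType.
Local Notation K := R[i].
Local Notation S2 := (ps (ps K)).

HB.instance Definition _ := GRing.Zmodule.on (form R).

Definition mulf (f : S2) (x : form R) : form R := (f * x.1, f * x.2).

Lemma mulfA f h x : mulf f (mulf h x) = mulf (f * h) x.
Proof. by rewrite /mulf /= !mulrA. Qed.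
Lemma mulfDr f x y : mulf f (x + y) = mulf f x + mulf f y.
Proof. by rewrite /mulf /= !mulrDr. Qed.
Lemma mulfDl f h x : mulf (f + h) x = mulf f x + mulf h x.
Proof. by rewrite /mulf !mulrDl. Qed.

Definition scalef (a : K) (x : form R) : form R := mulf (cmon a 0 0) x.
Fact scalefA a b x : scalef a (scalef b x) = scalef (a * b) x.
Proof. by rewrite /scalef mulfA cmonM. Qed.
Fact scalef1 : left_id 1 scalef.
Proof. by move=> x; rewrite /scalef cmon1 /mulf !mul1r; case: x. Qed.
Fact scalefDr : right_distributive scalef +%R.
Proof. by move=> a x y; exact: mulfDr. Qed.
Fact scalefDl x : {morph scalef^~ x : a b / a + b}.
Proof. by move=> a b; rewrite /scalef cmonD mulfDl. Qed.
HB.instance Definition _ := GRing.Zmodule_isLmodule.Build K (form R)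
  scalefA scalef1 scalefDr scalefDl.

Lemma scaleE (a : K) (x : form R) : a *: x = mulf (cmon a 0 0) x. Proof. by []. Qed.
End FormModule.

Section Leaves.
Variable R : realType.
Local Notation K := R[i].
Local Notation S1 := (ps K).
Local Notation S2 := (ps (ps K)).
Local Notation arc := (S1 * S1)%type.
Local Notation map2 := (S2 * S2)%type.
Local Notation ord1 := (@Defs.ord1 R).
Local Notation form := (form R).
Local Notation varX := (varX R).
Implicit Types (f h : S2) (g C : arc) (P Q : seq (direction R)) (x y w : form).

Lemma formD1 x y : (x + y).1 = x.1 + y.1. Proof. by []. Qed.
Lemma formD2 x y : (x + y).2 = x.2 + y.2. Proof. by []. Qed.

Lemma fpbD F x y : centred2 F -> fpb F (x + y) = fpb F x + fpb F y :> form.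
Proof.
move=> Fc; rewrite /fpb formD1 formD2 !pbD //.
by congr pair; rewrite ?formD1 ?formD2 /=; ring.
Qed.
Lemma fpb_mulf F f x : centred2 F -> fpb F (mulf f x) = mulf (pb F f) (fpb F x).
Proof. by move=> Fc; rewrite /fpb /mulf /= !pbM //; congr pair; ring. Qed.
Lemma apbD g x y : centred1 g -> apb g (x + y) = apb g x + apb g y.
Proof. by move=> gc; rewrite /apb formD1 formD2 !evD //; ring. Qed.
Lemma apb_mulf g f x : centred1 g -> apb g (mulf f x) = ev g f * apb g x.
Proof. by move=> gc; rewrite /apb /mulf /= !evM //; ring. Qed.
Lemma apb_diff g f : centred1 g -> apb g (du f, dv f) = dt (ev g f).
Proof. by move=> gc; rewrite dt_ev. Qed.
Lemma wdg_mulf (a x : form) f : wdg a (mulf f x) = f * wdg a x.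
Proof. by rewrite /wdg /mulf /=; ring. Qed.
Lemma wdgD (a x y : form) : wdg a (x + y) = wdg a x + wdg a y.
Proof. by rewrite /wdg formD1 formD2; ring. Qed.

Lemma mulXE (s : S1) k : (varX * s) k.+1 = s k.
Proof.
by rewrite -[varX]expr1 varXn_mulE subn1.
Qed.
Lemma mulX0 (s : S1) : (varX * s) 0%N = 0.
Proof. by rewrite psM0E /varX /= mul0r. Qed.

Lemma nu_formE g x k : nu_form g x k <-> ord1 (varX * apb g x) k.
Proof.
split=> [[o [ox xv] ->]|[kx xv]].
  by split; [rewrite mulXE | move=> [|i] io; rewrite ?mulX0 ?mulXE //; apply: xv].
case: k kx xv => [|k] kx xv; first by rewrite mulX0 eqxx in kx.
exists k => //; split; first by rewrite mulXE in kx.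
by move=> i ik; have := xv i.+1; rewrite mulXE; apply.
Qed.

Variables (Q : seq (direction R)) (wF : form).
Hypothesis Qdiv : divisor Q = (true, true).
Local Notation F := (blowup Q).
Let Fc : centred2 F := blowup_centred Q.
Local Notation chartQ c := (chart (Some c)).

Definition FQ : form := fpb F wF.
(** The pull-back of the jacobian of [wF] and [x], times the jacobian
    determinant of the blowing-ups. *)
Definition kfun (x : form) : S2 := wdg FQ (fpb F x).

Lemma kfunD x y : kfun (x + y) = kfun x + kfun y.
Proof. by rewrite /kfun fpbD // wdgD. Qed.
Lemma kfun_mulf f x : kfun (mulf f x) = pb F f * kfun x.
Proof. by rewrite /kfun fpb_mulf // wdg_mulf. Qed.

Record leaf g (c : K) g' : Prop := Leaf {
  leaf_c : c <> 0;
  leaf_centred : centred1 g';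
  leaf_strict : g = map_arc (blowup (rcons Q (Some c))) g';
  leaf_trans : ord1 g'.1 1;
  leaf_inv : apb g wF = 0 }.

Section OneLeaf.
Variables (g : arc) (c : K) (g' : arc).
Hypothesis lf : leaf g c g'.
Let g'c : centred1 g' := leaf_centred lf.
Local Notation gQ := (map_arc (chartQ c) g').

Lemma leafQ_centred : centred1 gQ.
Proof. by apply: map_arc_centred => //; exact: chart_centred. Qed.
Let gQc := leafQ_centred.

Lemma leafQ : g = map_arc F gQ.
Proof. by rewrite (leaf_strict lf) blowup_rcons map_arcA //; exact: chart_centred. Qed.

Lemma leaf_arc_centred : centred1 g.
Proof. by rewrite leafQ; exact: map_arc_centred. Qed.

Lemma leafQ_ord : ord1 gQ.1 1 /\ ord1 gQ.2 1.
Proof.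
rewrite map_chart_some //=; split; first exact: (leaf_trans lf).
rewrite -[1%N]addn0; apply: ord1M; first exact: (leaf_trans lf).
by apply: ord1_unit; rewrite psDE; case: g'c => _ ->; rewrite add0r; exact: (leaf_c lf).
Qed.

(** On a leaf the vector field (B, - A) is proportional to the tangent. *)
Lemma leaf_kfun x : ev gQ FQ.2 * apb g x = - (dt gQ.1 * ev gQ (kfun x)).
Proof.
have : apb gQ FQ = 0.
  by rewrite /FQ -apb_map // -leafQ; exact: (leaf_inv lf).
rewrite leafQ (@apb_map R _ _ x Fc gQc) /kfun /wdg evB // !evM // /apb.
move: (fpb F x) FQ => y A; move: (ev gQ A.1) (ev gQ A.2) (ev gQ y.1) (ev gQ y.2).
move: (dt gQ.1) (dt gQ.2) => a b A1 A2 y1 y2 e.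
have {}e : A1 * a = - (A2 * b) by apply/eqP; rewrite -addr_eq0 e.
transitivity (- (a * (- (A2 * y1)) + (A2 * b) * - y2)); first ring.
rewrite -[A2 * b]opprK -e; ring.
Qed.

Lemma leaf_dt : ord1 (dt gQ.1) 0.
Proof.
have [[o1 _] _] := leafQ_ord.
by apply: ord1_unit; rewrite dtE mulr1n; apply/eqP.
Qed.

Variables (N : nat).
Hypothesis FN : sharp N (pb (chartQ c) FQ.2).

Let evB_ord : ord1 (ev gQ FQ.2) N.
Proof.
rewrite -ev_pb //; last exact: chart_centred.
by apply: sharp_ev => //; exact: (leaf_trans lf).
Qed.

Lemma leaf_vanish v x : vanish2 (N + v) (kfun x) -> vanish v (apb g x).
Proof.
move=> Kx; have [BN Bv] := evB_ord.
apply: (vanish_cancel (@field_no_zero_divisors K) Bv); first by apply/eqP.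
rewrite leaf_kfun => k kN; rewrite psNE (vanishM (a := 0) (b := N + v)) ?oppr0 //.
exact: ev_fil.
Qed.

Lemma leaf_ord T x : sharp T (pb (chartQ c) (kfun x)) ->
  exists2 o, ord1 (apb g x) o & (N + o = T)%N.
Proof.
move=> KT.
have oK : ord1 (- (dt gQ.1 * ev gQ (kfun x))) T.
  have o1 : ord1 (dt gQ.1 * ev gQ (kfun x)) (0 + T).
    apply: ord1M leaf_dt _; rewrite -ev_pb //; last exact: chart_centred.
    by apply: sharp_ev => //; exact: (leaf_trans lf).
  case: o1 => o1 v1; split; first by rewrite psNE oppr_eq0.
  by move=> i iT; rewrite psNE v1 ?oppr0.
rewrite -leaf_kfun in oK; have [a [o [oa oo ->]]] := ord1_factor oK.
by exists o; rewrite ?(ord1_inj oa evB_ord).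
Qed.

End OneLeaf.

(** Both orders are the multiplicity of [f] at [Q]. *)
Lemma sharp_chart_unique (c d : K) a b f :
  sharp a (pb (chartQ c) f) -> sharp b (pb (chartQ d) f) -> a = b.
Proof.
move=> [fa fa0] [fb fb0]; case: (ltngtP a b) => // ab.
  case: fa0; have /vanish_chart H := fb.
  by have /vanish_chart H' := H; rewrite (H' c a ab).
case: fb0; have /vanish_chart H := fa.
by have /vanish_chart H' := H; rewrite (H' d b ab).
Qed.

(** Transversality to E makes the du-coefficient of the transform of the
    foliation a multiple of its dv-coefficient u B, where B is the transform
    of [FQ.2], so that B divides the transform of [kfun e].  The latter is a power of u times a unit,
    hence so is B. *)
Lemma dicritical_sharp (e : form) (c : K) : c <> 0 ->
  (exists k1 k2, mu k1 k2 (jac F)) ->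
  totally_dicritical Q wF -> E_transversality Q wF e ->
  exists N T, [/\ sharp N (pb (chartQ c) FQ.2), vanish2 N FQ.1, vanish2 N FQ.2
    & sharp T (pb (chartQ c) (kfun e))].
Proof.
move=> c0 [k1 [k2 mj]] /(_ (Some c)) [e' [[_ [h [hv h0 hE]]] tr _]] /(_ (Some c)).
have cc := chart_centred (Some c).
have div : divisor (rcons Q (Some c)) = (true, false).
  by rewrite divisor_rcons Qdiv; move/eqP/negbTE: c0 => ->.
rewrite /strict_equation div => -[h' [h'v [a [b [JE _ b0]]]] h'0].
have e2 : e'.2 0%N 0%N <> 0.
  move: tr; rewrite wedgeE [last_divisor_eq _]mon2E -[differential _]/(du (cmon 1 1 0), dv (cmon 1 1 0)).
  rewrite /wdg /= du_cmon dv_cmon !mulr0n mulr1n /=.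
  by rewrite cmon0 mulr0 sub0r cmon1 mulr1 !psNE oppr_eq0 => /eqP.
pose A := pb (chartQ c) FQ.1; pose B := pb (chartQ c) FQ.2.
have [E1 E2] : A + B * (cmon 1 0 1 + cmon c 0 0) = (h : S2) * e'.1 /\
    B * cmon 1 1 0 = (h : S2) * e'.2.
  move: hE; rewrite pullback_mapE blowup_mapE blowup_rcons fpb_map //.
  rewrite -/FQ /fpb /= !duD !dvD !du_cmon !dv_cmon !mulr0n !mulr1n /= !mul2E.
  by rewrite !cmon0 !addr0 mulr0 add0r cmon1 mulr1 => -[-> ->].
have {hE tr} [q1 [q2 [q20 {}E1 {}E2]]] : exists q1 q2 : S2, [/\ q2 0%N 0%N <> 0,
    A + B * (cmon 1 0 1 + cmon c 0 0) = (h : S2) * q1 & B * cmon 1 1 0 = (h : S2) * q2].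
  by exists e'.1, e'.2.
have EA : q2 * A = B * (cmon 1 1 0 * q1 - q2 * (cmon 1 0 1 + cmon c 0 0)).
  have -> : q2 * A = (A + B * (cmon 1 0 1 + cmon c 0 0)) * q2
     - B * (q2 * (cmon 1 0 1 + cmon c 0 0)) by ring.
  have E3 : (h : S2) * q1 * q2 = q1 * (B * cmon 1 1 0) by rewrite E2; ring.
  by rewrite E1 E3; ring.
have e2s : sharp 0 q2 by split.
pose y := fpb F e; pose y1 := pb (chartQ c) y.1; pose y2 := pb (chartQ c) y.2.
have KE : pb (chartQ c) (kfun e) = A * y2 - B * y1.
  by rewrite /kfun /wdg pbB // !pbM.
have [T KT] : exists T, sharp T (pb (chartQ c) (kfun e)).
  rewrite /kfun wdg_fpb // pbM // pb_pb // -blowup_rcons.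
  have -> : pb (blowup (rcons Q (Some c))) (wdg wF e) = cmon 1 a 0 * h'.
    move: JE; rewrite /jacobian wedgeE blowup_mapE mul2E mon2E b0.
    by [].
  exists (a + (k1 + k2))%N; apply: sharpM.
    by apply: mu_sharp; exists h' => //; apply/eqP.
  exact/mu_sharp/mu_chart_noncorner.
have BS : sharp T (B * ((cmon 1 1 0 * q1 - q2 * (cmon 1 0 1 + cmon c 0 0)) * y2 - q2 * y1)).
  have -> : B * ((cmon 1 1 0 * q1 - q2 * (cmon 1 0 1 + cmon c 0 0)) * y2 - q2 * y1)
     = q2 * pb (chartQ c) (kfun e).
    have -> : q2 * pb (chartQ c) (kfun e) = q2 * A * y2 - q2 * B * y1 by rewrite KE; ring.
    by rewrite EA; ring.
  by rewrite -[T]add0n; exact: sharpM.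
have [N BN] := sharp_factor BS; exists N, T; split=> //.
  apply/(vanish_chart c); apply: (vanish_cancel (a := 0) (p := q2)) => //.
  - exact/ps_no_zero_divisors/field_no_zero_divisors.
  - by move=> z; apply: q20; rewrite z.
  by rewrite EA -[X in vanish X]addn0; apply: vanishM => //; case: BN.
by apply/(vanish_chart c); case: BN.
Qed.

End Leaves.

(** * Comparison of two leaves *)

Section Values.
Variable R : realType.
Local Notation K := R[i].
Local Notation S1 := (ps K).
Local Notation S2 := (ps (ps K)).
Local Notation arc := (S1 * S1)%type.
Local Notation map2 := (S2 * S2)%type.
Local Notation ord1 := (@Defs.ord1 R).
Local Notation form := (form R).
Local Notation varX := (varX R).
Implicit Types (f h : S2) (g C : arc) (P Q : seq (direction R)) (x y : form).

Variables (n m : nat) (C : arc) (Q : seq (direction R)) (f1 f2 : S2) (wF : form).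
Hypotheses (co : coprime n m) (n2 : (2 <= n)%N) (nm : (n < m)%N).
Hypothesis cc : cusp_coordinates n m C Q f1 f2.
Local Notation F := (blowup Q).
Local Notation G := (semigroup2 n m).
Local Notation f12 := ((f1, f2) : map2).
Local Notation df1 := ((du f1, dv f1) : form).
Local Notation df2 := ((du f2, dv f2) : form).
Let Fc : centred2 F := blowup_centred Q.
Let fc : centred2 f12 := cc_centred cc.
Let Qdiv : divisor Q = (true, true) := lc_div (cc_centre cc).
Let n0 : (0 < n)%N. Proof. by lia. Qed.
Let m0 : (0 < m)%N. Proof. by lia. Qed.

Definition monf i j : S2 := f1 ^+ i * f2 ^+ j.

Lemma monf_mu i j : exists a b, mu a b (pb F (monf i j)) /\ (a + b = i * n + j * m)%N.
Proof.
have [a [b [c [d [m1 m2 nE mE]]]]] := lc_mu (cc_centre cc).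
exists (a * i + c * j)%N, (b * i + d * j)%N; split; last by rewrite nE mE; nia.
have X h k : pb F (h ^+ k) = pb F h ^+ k by exact: (subX (filtered2 R) (pb_subst Fc)).
by rewrite pbM // !X; apply: muM; exact: muX.
Qed.

Lemma monf_conv i j : convergent2 (monf i j).
Proof.
have X h k : convergent2 h -> convergent2 (h ^+ k).
  move=> hv; elim: k => [|k IH]; last by rewrite exprS; exact: conv2M.
  by rewrite expr0 -cmon1; exact: conv2_cmon.
by apply: conv2M; apply: X; [exact: cc_conv1 cc | exact: cc_conv2 cc].
Qed.

Lemma function_expansion M h : exists (a : S2) r, vanish2 M r /\
  h = \sum_(i < M) \sum_(j < M) cmon (a i j) 0 0 * monf i j + r.
Proof.
have [H Hc HE] := cc_inverse cc.
have hE : h = pb f12 (pb H h) by rewrite pb_pb // HE pb_id.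
exists (pb H h), (pb f12 (pb H h - taylor2 M (pb H h))); split.
  by apply: pb_fil => //; exact: taylor2P.
transitivity (pb f12 (taylor2 M (pb H h)) + pb f12 (pb H h - taylor2 M (pb H h))).
  by rewrite -pbD // addrC subrK -hE.
congr (_ + _).
have D (p q : S2) : pb f12 (p + q) = pb f12 p + pb f12 q by exact: pbD.
rewrite /taylor2 (big_morph _ D (pb0 fc)); apply: eq_bigr => i _.
rewrite (big_morph _ D (pb0 fc)); apply: eq_bigr => j _.
by rewrite pb_cmon // mulrA.
Qed.

Lemma form_expansion x : exists a b, x = mulf a df1 + mulf b df2.
Proof.
have [H Hc HE] := cc_inverse cc.
have fpb_id (y : form) : fpb (cmon 1 1 0, cmon 1 0 1) y = y.
  rewrite /fpb !pb_id /= !du_cmon !dv_cmon !mulr0n !mulr1n /= !cmon0 !mulr0.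
  by rewrite cmon1 !mulr1 addr0 add0r; case: y.
have xE : x = fpb f12 (fpb H x) by rewrite -fpb_map // HE fpb_id.
exists (pb f12 (fpb H x).1), (pb f12 (fpb H x).2).
by rewrite {1}xE.
Qed.

Section TransversalArc.
(** An arc of the family: the image of an arc at [Q] with both coordinates of
    order one. *)
Variables (g gQ : arc).
Hypotheses (gE : g = map_arc F gQ) (gQc : centred1 gQ)
  (gQ1 : ord1 gQ.1 1) (gQ2 : ord1 gQ.2 1).
Let gc : centred1 g. Proof. by rewrite gE; exact: map_arc_centred. Qed.

Lemma arc_monf i j : ord1 (ev g (monf i j)) (i * n + j * m).
Proof.
have [a [b [mf <-]]] := monf_mu i j; rewrite gE -ev_pb //.
by have := mu_ev gQc mf gQ1 gQ2; rewrite !mul1n.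
Qed.

Inductive values_from (w : nat) : S1 -> Prop :=
| Values_high s : vanish (n * m) s -> values_from w s
| Values_mon c i j s : (w <= i * n + j * m)%N -> values_from w s ->
    values_from w (cst1 c * ev g (monf i j) + s).

Let values_vanish w s : (w <= n * m)%N -> values_from w s -> vanish w s.
Proof.
move=> wM; elim=> [t tv k kw|c i j t wij _ IH k kw]; first by apply: tv; lia.
by have [_ v] := arc_monf i j; rewrite psDE cst1ME v ?mulr0 ?add0r ?IH //; lia.
Qed.

Let values_step w s : (w < n * m)%N -> values_from w s ->
  exists c i j t, [/\ s = cst1 c * ev g (monf i j) + t, values_from w.+1 t &
    c != 0 -> w = (i * n + j * m)%N].
Proof.
move=> wM; elim=> [t tv|c i j t wij _ [d [k [l [t' [-> t'v Hd]]]]]].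
  exists 0, 0%N, 0%N, t; rewrite cst1_0 mul0r add0r eqxx; split=> //.
  exact: Values_high.
have [E|ne] := eqVneq w (i * n + j * m)%N; last first.
  exists d, k, l, (cst1 c * ev g (monf i j) + t'); split=> //.
    by rewrite addrCA.
  by apply: Values_mon => //; lia.
have [d0|d0] := eqVneq d 0.
  exists c, i, j, t'; split=> //.
  by rewrite d0 cst1_0 mul0r add0r.
have [ki lj] : k = i /\ l = j.
  by apply: (semigroup2_inj co n0 m0); rewrite -(Hd d0) // -E.
exists (c + d), i, j, t'; split=> //; rewrite ki lj addrA -mulrDl; congr (_ * _ + _).
by apply/funext => a; rewrite psDE /cst1; case: ifP; rewrite ?addr0.
Qed.

(** Below n m each number is the value of at most one monomial in [f1] and
    [f2], so that no cancellation creates new values; beyond n m there are no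
    holes. *)
Lemma arc_Gamma k : Gamma g k <-> G k.
Proof.
split=> [[h hv hk]|[i [j ->]]]; last first.
  exists (monf i j); [exact: monf_conv | exact: arc_monf].
apply: contrapT => Gk; have [x [y [x0 y0 e]]] := semigroup2_hole co n0 m0 Gk.
have kM : (k < n * m)%N by nia.
have v0 : values_from 0 (ev g h).
  have [a [r [rv ->]]] := function_expansion (n * m) h.
  rewrite evD //.
  have base : values_from 0 (ev g r) by apply: Values_high; exact: ev_fil.
  have ev_0 : ev g 0 = 0 by exact: (sub0 (ev_subst gc)).
  rewrite (big_morph _ (evD gc) ev_0).
  elim/big_ind: _ (ev g r) base => [r' b|p q Hp Hq r' b|i _ r' b].
  - by rewrite add0r.
  - by rewrite -addrA; apply/Hp/Hq.
  rewrite (big_morph _ (evD gc) ev_0).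
  elim/big_ind: _ r' b => [r' b|p q Hp Hq r' b|j _ r' b].
  - by rewrite add0r.
  - by rewrite -addrA; apply/Hp/Hq.
  by rewrite evM // ev_cmon // !expr0 !mulr1; apply: Values_mon.
have vw w : (w <= k)%N -> values_from w (ev g h).
  elim: w => // w IH wk.
  have [|c [i [j [t [hE tv Hc]]]]] := values_step _ (IH (ltnW wk)); first lia.
  rewrite hE; have [->|c0] := eqVneq c 0; first by rewrite cst1_0 mul0r add0r.
  have : (ev g h) w = 0 by case: hk => _; apply.
  rewrite hE psDE cst1ME (values_vanish _ tv); [|lia|lia].
  rewrite addr0 => /eqP; rewrite mulf_eq0 (negbTE c0) /= (Hc c0).
  by have [/negbTE -> _] := arc_monf i j.
have [c [i [j [t [hE tv Hc]]]]] := values_step kM (vw k (leqnn k)).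
have c0 : c = 0.
  by apply/eqP/negbNE/negP => /Hc kE; apply: Gk; exists i, j.
case: hk => /eqP hk _; apply: hk; rewrite -[comp21 h g]/(ev g h) hE c0 cst1_0 mul0r add0r.
by rewrite (values_vanish _ tv).
Qed.
End TransversalArc.

Definition expts (e : nat) : nat * nat :=
  if pselect (exists q : nat * nat, e = (q.1 * n + q.2 * m)%N) is left H
  then projT1 (cid H) else (0%N, 0%N).

Lemma exptsP (e : nat) : G e -> e = ((expts e).1 * n + (expts e).2 * m)%N.
Proof.
move=> [i [j eE]]; rewrite /expts; case: pselect => [H|[]].
  by case: (cid H).
by exists (i, j).
Qed.

Lemma expts_eq i j : (i * n + j * m < n * m)%N -> expts (i * n + j * m) = (i, j).
Proof.
move=> b; have Gg : G (i * n + j * m) by exists i, j.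
have [] := semigroup2_inj co n0 m0 b (exptsP Gg).
by case: (expts _) => a c /= -> ->.
Qed.

Definition shift (e : nat) x : form := mulf (monf (expts e).1 (expts e).2) x.

Lemma shift_add (e d : nat) x : G e -> G d -> (e + d < n * m)%N ->
  shift e (shift d x) = shift (e + d) x.
Proof.
move=> Ge Gd b; rewrite /shift mulfA; congr mulf.
have -> : expts (e + d) = ((expts e).1 + (expts d).1, (expts e).2 + (expts d).2)%N.
  rewrite -expts_eq; last by have := exptsP Ge; have := exptsP Gd; rewrite !mulnDl; lia.
  by congr expts; have := exptsP Ge; have := exptsP Gd; rewrite /= !mulnDl; lia.
by rewrite /monf /= !exprD; ring.
Qed.

Local Notation kfun := (kfun Q wF).

Variables (c c' : K) (Ct g g' : arc).
Hypotheses (lf : leaf Q wF C c g) (lf' : leaf Q wF Ct c' g').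
Variable N : nat.
Hypotheses (FN : sharp N (pb (chart (Some c)) (FQ Q wF).2))
  (FN' : sharp N (pb (chart (Some c')) (FQ Q wF).2))
  (F1N : vanish2 N (FQ Q wF).1) (F2N : vanish2 N (FQ Q wF).2).

Definition gev w x := vanish2 (N + w).-1 (kfun x).
Definition lcv (h : arc) w x : K := (varX * apb h x) w.

Lemma lcv_lin (h : arc) w a x y : centred1 h -> lcv h w (a *: x + y) = a * lcv h w x + lcv h w y.
Proof.
move=> hc; rewrite /lcv scaleE apbD // apb_mulf // ev_cmon // !expr0 !mulr1.
by rewrite mulrDr psDE mulrCA cst1ME.
Qed.

Lemma leaf_gev (h h' : arc) (d : K) w x : leaf Q wF h d h' ->
  sharp N (pb (chart (Some d)) (FQ Q wF).2) -> gev w x ->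
  vanish w (varX * apb h x).
Proof.
move=> lh hN; case: w => [|w] // gx.
have xv : vanish w (apb h x) by apply: (leaf_vanish lh hN); move: gx; rewrite /gev addnS.
by move=> [|k] kw; rewrite ?mulX0 ?mulXE //; apply: xv.
Qed.

Lemma leaf_lc_E (h h' : arc) (d : K) e w x : leaf Q wF h d h' ->
  sharp N (pb (chart (Some d)) (FQ Q wF).2) -> G e -> gev w x ->
  exists2 a, a != 0 & lcv h (w + e) (shift e x) = a * lcv h w x.
Proof.
move=> lh hN Ge gx; have hc := leaf_arc_centred lh.
have [o1 o2] := leafQ_ord lh.
have [ne vz] := arc_monf (leafQ lh) (leafQ_centred lh) o1 o2 (expts e).1 (expts e).2.
rewrite -(exptsP Ge) in ne vz.
exists (ev h (monf (expts e).1 (expts e).2) e) => //.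
rewrite /lcv /shift apb_mulf // mulrCA addnC vanishM_lead //.
exact: (leaf_gev lh hN gx).
Qed.

Lemma good_nu (h h' : arc) (d : K) w x : leaf Q wF h d h' ->
  sharp N (pb (chart (Some d)) (FQ Q wF).2) -> gev w x -> lcv h w x != 0 -> nu_form h x w.
Proof.
move=> lh hN gx l0; apply/nu_formE; split=> // i iw.
by apply: (leaf_gev lh hN gx).
Qed.

Lemma shift_gev e w x : G e -> gev w x -> gev (w + e) (shift e x).
Proof.
move=> Ge gx; have [a [b [mf ab]]] := monf_mu (expts e).1 (expts e).2.
rewrite /gev /shift kfun_mulf //.
apply: (vanish2W (b := (e + (N + w).-1)%N)); first lia.
by apply: vanish2M => //; have := mu_vanish2 mf; rewrite ab -(exptsP Ge).
Qed.

Lemma shift_gev_strict e w x : G e -> gev w x -> gev (w + e).+1 (shift e x) -> gev w.+1 x.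
Proof.
move=> Ge gx; have [a [b [mf ab]]] := monf_mu (expts e).1 (expts e).2.
rewrite /gev /shift kfun_mulf // => H; apply: (mu_cancel mf).
apply: vanish2W H; rewrite ab -(exptsP Ge); lia.
Qed.

Lemma kfun0 : kfun 0 = 0.
Proof. by apply: (addrI (kfun 0)); rewrite -kfunD // !addr0. Qed.

Lemma gev_lin w a x y : gev w x -> gev w y -> gev w (a *: x + y).
Proof.
move=> gx gy; rewrite /gev kfunD // scaleE kfun_mulf // pb_cmon // !expr0 !mulr1.
apply: vanish2D => //; rewrite -[(N + w).-1]add0n; exact: vanish2M.
Qed.

Lemma gev_diff h e : (0 < e)%N -> vanish2 e (pb F h) -> gev e (du h, dv h).
Proof.
move=> e0 hv; rewrite /gev /kfun fpb_diff // /wdg /=.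
have -> : (N + e).-1 = (N + e.-1)%N by lia.
have e1 : e = (e.-1 + 1)%N by lia.
rewrite e1 in hv.
apply: vanish2D; first by apply: vanish2M => //; exact: vanish2_dv.
by apply: vanish2N; apply: vanish2M => //; exact: vanish2_du.
Qed.

Lemma lcv_diff (h : arc) f e : centred1 h -> (0 < e)%N -> ord1 (ev h f) e ->
  lcv h e (du f, dv f) != 0.
Proof.
move=> hc; case: e => // e _ [fe _]; rewrite /lcv mulXE apb_diff // dtE.
by rewrite mulrn_eq0 negb_or fe.
Qed.

Local Notation good := (good gev (lcv C) (lcv Ct)).

Let evf (h h' : arc) (d : K) i j : leaf Q wF h d h' -> ord1 (ev h (monf i j)) (i * n + j * m).
Proof.
move=> lh; have [o1 o2] := leafQ_ord lh.
exact: (arc_monf (leafQ lh) (leafQ_centred lh) o1 o2).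
Qed.

Lemma good_df1 : good n df1.
Proof.
have mf : monf 1 0 = f1 by rewrite /monf expr1 expr0 mulr1.
have nE : (1 * n + 0 * m = n)%N by lia.
split.
- apply: gev_diff => //; have [a [b [mu1 ab]]] := monf_mu 1 0.
  by rewrite mf in mu1; rewrite -nE -ab; exact: mu_vanish2.
- have := evf 1 0 lf; rewrite mf nE; exact: lcv_diff (leaf_arc_centred lf) n0.
have := evf 1 0 lf'; rewrite mf nE; exact: lcv_diff (leaf_arc_centred lf') n0.
Qed.
Lemma good_df2 : good m df2.
Proof.
have mf : monf 0 1 = f2 by rewrite /monf expr1 expr0 mul1r.
have mE : (0 * n + 1 * m = m)%N by lia.
split.
- apply: gev_diff => //; have [a [b [mu1 ab]]] := monf_mu 0 1.
  by rewrite mf in mu1; rewrite -mE -ab; exact: mu_vanish2.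
- have := evf 0 1 lf; rewrite mf mE; exact: lcv_diff (leaf_arc_centred lf) m0.
have := evf 0 1 lf'; rewrite mf mE; exact: lcv_diff (leaf_arc_centred lf') m0.
Qed.

Variables (p : nat) (xl : form).
Hypothesis xl_good : good p xl.
Hypothesis p_minimal : forall d x e, convergent_form x -> nu_form C x d ->
  (d < p)%N -> G e -> p <> (e + d)%N.

Let df1_conv : convergent_form df1.
Proof. by split; [apply: conv2_du | apply: conv2_dv]; exact: cc_conv1 cc. Qed.
Let df2_conv : convergent_form df2.
Proof. by split; [apply: conv2_du | apply: conv2_dv]; exact: cc_conv2 cc. Qed.

Let p_minimal' d x e : convergent_form x -> good d x -> (d < p)%N -> G e -> p <> (e + d)%N.
Proof. by move=> xv [gx lx _]; apply: (p_minimal xv); exact: (good_nu lf FN gx lx). Qed.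

Let p_bound : (p < n * m + n)%N.
Proof.
rewrite ltnNge; apply/negP => pb.
have Gp : G (p - n).
  apply: contrapT => /(semigroup2_hole co n0 m0) [x [y [x0 y0 e]]]; nia.
have np : (n < p)%N by nia.
by apply: (p_minimal' df1_conv good_df1 np Gp); lia.
Qed.

Local Notation L0 := (fun v => exists2 e, G e & v = (e + n)%N).
Local Notation comb := (combination n m p shift gev L0 (fun v => shift (v - n) df1) df2 m).

Let comb_gen x : comb 0 x.
Proof.
have [a [b ->]] := form_expansion x.
have sum_comb h y s (Hm : forall i j t (k : K), comb 0 t ->
    comb 0 (k *: mulf (monf i j) y + t)) :
    comb 0 s -> comb 0 (mulf h y + s).
  move=> sP; pose M := (N + p).+2.
  have [d [r [rv ->]]] := function_expansion M h.
  have m_0 : mulf 0 y = 0 by rewrite /mulf !mul0r.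
  have mD (u v : S2) : mulf (u + v) y = mulf u y + mulf v y by exact: mulfDl.
  rewrite mD (big_morph (fun u => mulf u y) mD m_0) -addrA.
  have base : comb 0 (mulf r y + s).
    apply: combD => //; first exact: gev_lin.
    apply: Comb_ge; rewrite /gev kfun_mulf //.
    apply: (vanish2W (b := (M + 0)%N)); first by rewrite /M; lia.
    by apply: vanish2M => //; apply: pb_fil.
  elim/big_ind: _ (mulf r y + s) base => [r' h0|u v Hu Hv r' h0|i _ r' h0].
  - by rewrite add0r.
  - by rewrite -addrA; apply/Hu/Hv.
  rewrite (big_morph (fun u => mulf u y) mD m_0).
  elim/big_ind: _ r' h0 => [r' h0|u v Hu Hv r' h0|j _ r' h0].
  - by rewrite add0r.
  - by rewrite -addrA; apply/Hu/Hv.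
  by rewrite -mulfA -scaleE; apply: Hm.
have high i j y k t v : good v y -> (p < i * n + j * m + v)%N -> comb 0 t ->
    comb 0 (k *: mulf (monf i j) y + t).
  move=> [gy _ _] pv tP; apply: combD => //; first exact: gev_lin.
  apply: Comb_ge; rewrite -[_ *: _]addr0; apply: gev_lin; last first.
    by rewrite /gev kfun0.
  have [e [e' [mf ee]]] := monf_mu i j.
  rewrite /gev kfun_mulf //; apply: (vanish2W (b := (e + e' + (N + v).-1)%N)).
    by rewrite ee; lia.
  by apply: vanish2M gy; exact: mu_vanish2.
apply: (sum_comb) => [i j t k tP|].
  have [pv|vp] := ltnP p (i * n + j * m + n); first exact: high good_df1 pv tP.
  have -> : mulf (monf i j) df1 = shift (i * n + j * m + n - n) df1.
    by rewrite /shift addnK expts_eq //; lia.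
  by apply: Comb_h => //; exists (i * n + j * m)%N => //; exists i, j.
rewrite -[mulf b df2]addr0; apply: (sum_comb) => [i j t k tP|].
  have [pv|vp] := ltnP p (i * n + j * m + m); first exact: high good_df2 pv tP.
  have -> : mulf (monf i j) df2 = shift (i * n + j * m) df2.
    by rewrite /shift expts_eq //; lia.
  by apply: Comb_e => //; exists i, j.
by apply: Comb_ge; rewrite /gev kfun0.
Qed.

Theorem leaf_values x : (exists2 w, (w < p)%N & good w x) \/ gev p x.
Proof.
have Cc := leaf_arc_centred lf; have Ctc := leaf_arc_centred lf'.
apply: (@values_below_p K form n m p co n2 nm shift gev (lcv C) (lcv Ct)
  (@convergent_form R) _ _ _ _ _ _ _ _ _ _ _ _ _ _ _ _ _ xl _ _ df1 df2) => //.
- by move=> e a y z; rewrite /shift mulfDr !scaleE !mulfA mulrC.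
- exact: shift_add.
- exact: gev_lin.
- by move=> v w y vw; apply: vanish2W; lia.
- by move=> w; rewrite /gev kfun0.
- move=> y; rewrite /gev /kfun; apply: (vanish2W (b := (N + 0)%N)); first lia.
  apply: vanish2D; first exact: vanish2M.
  by apply: vanish2N; exact: vanish2M.
- exact: shift_gev.
- exact: shift_gev_strict.
- by move=> w a y z; exact: lcv_lin.
- by move=> w a y z; exact: lcv_lin.
- by move=> w y gy; apply: (leaf_gev lf FN gy).
- by move=> w y gy; apply: (leaf_gev lf' FN' gy).
- by move=> e w y Ge gy; exact: (leaf_lc_E lf FN Ge gy).
- by move=> e w y Ge gy; exact: (leaf_lc_E lf' FN' Ge gy).
- move=> a y z [y1 y2] [z1 z2].
  by split; apply: conv2D => //; apply: conv2M => //; exact: conv2_cmon.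
- by split; exists 1, 0; split=> // i j; rewrite normr0 mul0r.
- by move=> e y Ge [y1 y2]; split; apply: conv2M => //; exact: monf_conv.
- exact: good_df1.
- exact: good_df2.
Qed.

End Values.

(** * Bases of semimodules *)

Section Bases.
Variable R : realType.
Local Notation arc := (ps R[i] * ps R[i])%type.
Implicit Types (g : arc) (b : seq nat).

Lemma Gamma_add g p q : centred1 g -> Gamma g p -> Gamma g q -> Gamma g (p + q).
Proof.
move=> gc [h hv hp] [f fv fq]; exists ((h : ps (ps R[i])) * f); first exact: conv2M.
rewrite /nu_fun -[comp21 _ _]/(ev g _) evM //; exact: ord1M.
Qed.

Lemma Lambda_uptoE g b v : Lambda_upto g b (size b) v <->
  exists x q, [/\ x \in b, Gamma g q & v = (x + q)%N].
Proof.
split=> [[k [q [_ kb Gq ->]]]|[x [q [/(nthP 0%N) [k kb <-] Gq ->]]]].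
  by exists (nth 0%N b k), q; split=> //; exact: mem_nth.
by exists k, q; split=> //; exact: ltnW.
Qed.

Lemma basis_sorted g b : Lambda_basis g b -> sorted ltn b. Proof. by case=> -[]. Qed.
Lemma basis_mem g b v : Lambda_basis g b ->
  (Lambda g v <-> exists x q, [/\ x \in b, Gamma g q & v = (x + q)%N]).
Proof. by move=> [[_ ->] _]; exact: Lambda_uptoE. Qed.

(** Otherwise the list without [x] would still generate. *)
Lemma basis_irredundant g b x y q : centred1 g -> Lambda_basis g b ->
  x \in b -> y \in b -> Gamma g q -> x = (y + q)%N -> x = y.
Proof.
move=> gc hb xb yb Gq xE; apply: contrapT => xy.
have bs := basis_sorted hb; have [[_ LE] bmin] := hb.
have bu : uniq b by apply: (sorted_uniq ltn_trans ltnn bs).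
have := bmin (rem x b) _; rewrite size_rem //.
have b0 : (0 < size b)%N by case: (b) xb.
move=> H; suff : (size b <= (size b).-1)%N by lia.
apply: H; split; first exact: (subseq_sorted ltn_trans (rem_subseq x b) bs).
apply/funext => v; apply/propext; rewrite (basis_mem v hb) Lambda_uptoE.
split=> [[z [r [zb Gr ->]]]|[z [r [zb Gr ->]]]]; last first.
  by exists z, r; split=> //; exact: mem_rem zb.
have [->|zx] := eqVneq z x.
  exists y, (q + r)%N; rewrite addnA -xE mem_rem_uniq // inE yb andbT; split=> //.
    by apply/eqP => yx; apply: xy.
  exact: Gamma_add.
by exists z, r; rewrite mem_rem_uniq // inE zx.
Qed.

Lemma basis_minimal g b k d q : centred1 g -> Lambda_basis g b -> (k < size b)%N ->
  Lambda g d -> (d < nth 0%N b k)%N -> Gamma g q -> nth 0%N b k <> (q + d)%N.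
Proof.
move=> gc hb kb /(basis_mem _ hb) [x [r [xb Gr dE]]] db Gq E.
have e : nth 0%N b k = (x + (q + r))%N by rewrite E dE; lia.
have i := basis_irredundant gc hb (mem_nth 0%N kb) xb (Gamma_add gc Gq Gr) e.
by move: db; rewrite i dE ltnNge leq_addr.
Qed.

(** The next entry of an irredundant basis is the least value which the
    previous ones do not generate. *)
Lemma basis_prefix g g' b b' p k : centred1 g -> centred1 g' ->
  Lambda_basis g b -> Lambda_basis g' b' ->
  (forall q, Gamma g q <-> Gamma g' q) ->
  (forall v, (v <= p)%N -> (Lambda g v <-> Lambda g' v)) ->
  (k < size b)%N -> (nth 0%N b k <= p)%N ->
  (k < size b')%N /\ nth 0%N b' k = nth 0%N b k.
Proof.
move=> gc gc' hb hb' GG LL; elim/ltn_ind: k => k IH kb kp.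
have bs := basis_sorted hb; have bs' := basis_sorted hb'.
have mono s i j : sorted ltn s -> (i < j)%N -> (j < size s)%N -> (nth 0%N s i < nth 0%N s j)%N.
  move=> ss ij js; apply: (sorted_ltn_nth ltn_trans 0%N ss) => //.
  by rewrite inE; exact: ltn_trans js.
have IH' j : (j < k)%N -> (j < size b')%N /\ nth 0%N b' j = nth 0%N b j.
  by move=> jk; have := mono b j k bs jk kb; move=> ?; apply: IH => //; lia.
have bkb := mem_nth 0%N kb.
have G0 : Gamma g 0.
  exists (cmon 1 0 0); first exact: conv2_cmon.
  by rewrite /nu_fun -[comp21 _ _]/(ev g _) cmon1; split=> //; rewrite ev0 // !ps1E oner_neq0.
have /(LL _ kp) /(basis_mem _ hb') [x [q [/(nthP 0%N) [i ib' <-] Gq bE]]] : Lambda g (nth 0%N b k).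
  by apply/(basis_mem _ hb); exists (nth 0%N b k), 0%N; rewrite addn0.
have ki : (k <= i)%N.
  rewrite leqNgt; apply/negP => ik; have [_ E] := IH' i ik.
  rewrite E in bE.
  have eq := basis_irredundant gc hb bkb (mem_nth 0%N (ltn_trans ik kb)) ((GG q).2 Gq) bE.
  by have := mono b i k bs ik kb; rewrite eq ltnn.
have kb' : (k < size b')%N by exact: leq_ltn_trans ki ib'.
have le1 : (nth 0%N b' k <= nth 0%N b k)%N.
  have : (nth 0%N b' k <= nth 0%N b' i)%N.
    by case: (ltngtP k i) ki => // [ki|->] _ //; apply/ltnW/mono.
  by rewrite bE => h; apply: leq_trans h (leq_addr _ _).
split=> //.
have bkb' := mem_nth 0%N kb'.
have G0' : Gamma g' 0 by apply/GG.
have : Lambda g' (nth 0%N b' k).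
  by apply/(basis_mem _ hb'); exists (nth 0%N b' k), 0%N; rewrite addn0.
move=> /(LL _ (leq_trans le1 kp)).2 /(basis_mem _ hb) [y [r [/(nthP 0%N) [j jb <-] Gr b'E]]].
have kj : (k <= j)%N.
  rewrite leqNgt; apply/negP => jk; have [jb' E] := IH' j jk.
  rewrite -E in b'E.
  have eq := basis_irredundant gc' hb' bkb' (mem_nth 0%N jb') ((GG r).1 Gr) b'E.
  by have := mono b' j k bs' jk kb'; rewrite eq ltnn.
have : (nth 0%N b k <= nth 0%N b j)%N.
  by case: (ltngtP k j) kj => // [kj|->] _ //; apply/ltnW/mono.
move=> h; apply/eqP; rewrite eqn_leq le1 /= b'E.
exact: leq_trans h (leq_addr _ _).
Qed.
End Bases.

Lemma nu_form_inj (R : realType) (g : ser1 R * ser1 R) w a b :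
  nu_form g w a -> nu_form g w b -> a = b.
Proof. by move=> /nu_formE ha /nu_formE hb; exact: ord1_inj ha hb. Qed.

Section Main.
Variable R : realType.
Local Notation K := R[i].
Local Notation S2 := (ps (ps K)).
Local Notation arc := (ps K * ps K)%type.

Lemma Curv_leaf (Q : seq (direction R)) (wF : form R) (Ct : arc) :
  divisor Q = (true, true) -> Curv Q wF Ct -> exists c g, leaf Q wF Ct c g.
Proof.
move=> Qd [_ inv [d [g [nc sg _ t1]]]].
have [gc _ gE] := strict_arcE sg; case: d nc gE t1 {sg} => [c|]; last first.
  by rewrite /corner divisor_rcons Qd.
rewrite /corner divisor_rcons Qd /= => c0 gE t1.
exists c, g; split=> //; first by apply/eqP.
  move: t1; rewrite mon2E -[comp21 _ _]/(ev g _) ev_cmon //.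
  rewrite expr0 expr1 mulr1 (fil_cst1 (filtered1 R)) mul1r => /eqP t1.
  by apply: ord1_1P => //; case: gc.
by apply/funext => k; exact: inv.
Qed.

(** Here [e] generates the foliation of the form [w] of value [p], and [p] is
    irredundant among the values of [C]. *)
Lemma leaves_agree (m n : nat) (C Ct : arc) (Q : seq (direction R)) (wF w e : form R)
    (p : nat) :
  puiseux_cusp m n C -> cuspidal_divisor C Q -> totally_dicritical Q wF ->
  invariant_curve wF C -> Curv Q wF Ct ->
  foliation_of w e -> E_transversality Q wF e -> nu_form C w p ->
  (forall d q, Lambda C d -> (d < p)%N -> Gamma C q -> p <> (q + d)%N) ->
  [/\ centred1 C, centred1 Ct, forall q, Gamma C q <-> Gamma Ct q, nu_form Ct w p &
    forall x d, (d < p)%N -> nu_form C x d <-> nu_form Ct x d].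
Proof.
move=> hC hE hdic hinv hCt [[[e1v e2v] _] [h [hv _ wE]]] htr wp pmin.
have [n2 nm co _ _] := hC.
have [f1 [f2 cc]] := cusp_coordinates_exist hC hE.
have Qd := lc_div (cc_centre cc).
have [c [g [c0 gc CE g1]]] := cc_strict cc.
have lf : leaf Q wF C c g.
  by split=> //; apply/funext => k; exact: hinv.
have [c' [g' lf']] := Curv_leaf Qd hCt.
have c'0 := leaf_c lf'.
have [N [T [FN F1N F2N KT]]] := dicritical_sharp Qd c0 (lc_jac (cc_centre cc)) hdic htr.
have [N' [T' [FN' _ _ KT']]] := dicritical_sharp Qd c'0 (lc_jac (cc_centre cc)) hdic htr.
have NN := sharp_chart_unique FN' FN; have TT := sharp_chart_unique KT' KT; subst N' T'.
have {}wE : w = mulf h e by rewrite wE /mulf !mul2E.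
have Cc := leaf_arc_centred lf; have Ctc := leaf_arc_centred lf'.
have GC := arc_Gamma co n2 nm cc (leafQ lf) (leafQ_centred lf) (leafQ_ord lf).1 (leafQ_ord lf).2.
have GCt := arc_Gamma co n2 nm cc (leafQ lf') (leafQ_centred lf') (leafQ_ord lf').1 (leafQ_ord lf').2.
(* If h vanished at the origin, [p] would be the value of [e], which is
   smaller, plus an element of the semigroup. *)
have h0 : (h : S2) 0%N 0%N <> 0.
  move=> h0; move/nu_formE: (wp); rewrite wE apb_mulf // mulrCA => /ord1_factor.
  move=> [a [d [ha hd pE]]].
  have a0 : (0 < a)%N by apply: ord1_pos ha; rewrite ev0.
  have Ld : Lambda C d by exists e => //; apply/nu_formE.
  by apply: (pmin d a Ld) => //; [lia | exists h].
have sharp_w (d : K) : sharp T (pb (chart (Some d)) (kfun Q wF e)) ->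
    sharp T (pb (chart (Some d)) (kfun Q wF w)).
  move=> ks; have dc := chart_centred (Some d).
  rewrite wE kfun_mulf pbM // -[T]add0n; apply: sharpM => //.
  by split=> //; rewrite !pb00 //; exact: blowup_centred.
have [o oC oT] := leaf_ord lf FN (sharp_w _ KT).
have [o' oCt oT'] := leaf_ord lf' FN' (sharp_w _ KT').
have oo : o' = o by lia.
have wp' : nu_form C w o.+1 by exists o.
have po := nu_form_inj wp wp'.
have wtp : nu_form Ct w p by exists o' => //; rewrite oo.
have gw : good (gev Q wF N) (lcv C) (lcv Ct) p w.
  split.
  - rewrite /gev; have -> : (N + p).-1 = T by lia.
    by apply/(vanish_chart c); case: (sharp_w _ KT).
  - by move/nu_formE: wp => [].
  - by move/nu_formE: wtp => [].
have pmin' d (x : form R) q : convergent_form x -> nu_form C x d -> (d < p)%N ->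
    semigroup2 n m q -> p <> (q + d)%N.
  move=> xv xd dp /GC Gq; apply: pmin => //; by exists x.
have main x := leaf_values co n2 nm cc lf lf' FN FN' F1N F2N gw pmin' x.
split=> //; first by move=> q; rewrite GC GCt.
move=> x d dp; case: (main x) => [[v vp [gx l1 l2]]|gx].
  have xC := good_nu lf FN gx l1; have xCt := good_nu lf' FN' gx l2.
  by split=> xd; [rewrite (nu_form_inj xd xC) | rewrite (nu_form_inj xd xCt)].
have v1 := leaf_gev lf FN gx; have v2 := leaf_gev lf' FN' gx.
by split=> /nu_formE [/eqP + _]; rewrite ?v1 ?v2.
Qed.

End Main.

Theorem theorem1 (R : realType) (m n : nat) (C : ser1 R * ser1 R)
    (Q : seq (direction R)) (b : seq nat) (ws : seq (oneform R))
    (wF : oneform R) (l : nat) (Ct : ser1 R * ser1 R) (bt : seq nat)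
    (hC : puiseux_cusp m n C)
    (hE : cuspidal_divisor C Q)
    (hb : Lambda_basis C b)
    (hws : minimal_standard_basis C b ws)
    (hF : foliation wF)
    (hdic : totally_dicritical Q wF)
    (hinv : invariant_curve wF C)
    (hl : (1 <= l)%N /\ (l.+2 <= size b)%N)
    (htr : l_transversality Q ws wF l)
    (hCt : Curv Q wF Ct)
    (hbt : Lambda_basis Ct bt) :
  [/\ (l.+2 <= size bt)%N,
      (forall i, (i <= l.+1)%N -> nth 0%N bt i = nth 0%N b i),
      (forall i, (i <= l.+1)%N -> Lambda_upto Ct bt i = Lambda_upto C b i)
    & exists wst : seq (oneform R),
        minimal_standard_basis Ct bt wst /\ take l.+2 wst = take l.+2 ws].
Proof.
have [_ lb] := hl; have [e ewl htr'] := htr; have [ws_size ws_val] := hws.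
have [_ wlp] := ws_val _ lb.
set p := nth 0%N b l.+1 in wlp.
have Cc : centred1 C by case: hC => _ _ _ [[_ _ C1 C2] _] _.
have pmin d q : Lambda C d -> (d < p)%N -> Gamma C q -> p <> (q + d)%N.
  by move=> Ld dp Gq; apply: (basis_minimal Cc hb lb Ld).
have [_ Ctc GG wtp vals] := leaves_agree hC hE hdic hinv hCt ewl htr' wlp pmin.
have bs := basis_sorted hb.
have mono i : (i <= l.+1)%N -> (nth 0%N b i <= p)%N.
  move=> il; rewrite /p; case: (ltngtP i l.+1) il => // [il|->] _ //.
  apply/ltnW/(sorted_ltn_nth ltn_trans 0%N bs) => //.
  by rewrite inE; lia.
have val_i i : (i <= l.+1)%N ->
    convergent_form (nth (zero_form R) ws i) /\
    nu_form Ct (nth (zero_form R) ws i) (nth 0%N b i).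
  move=> il; have [wv wi] := ws_val i (leq_ltn_trans il lb); split=> //.
  move: il; rewrite leq_eqVlt => /orP [/eqP -> //|il].
  apply/vals => //; rewrite /p; apply: (sorted_ltn_nth ltn_trans 0%N bs) => //.
  by rewrite inE; lia.
have LL v : (v <= p)%N -> (Lambda C v <-> Lambda Ct v).
  rewrite leq_eqVlt => /orP [/eqP ->|vp]; last first.
    by split=> -[x xv xd]; exists x => //; apply/(vals x v vp).
  have [wv wp'] := val_i _ (leqnn l.+1).
  by split=> _; exists (nth (zero_form R) ws l.+1).
have pre i (il : (i <= l.+1)%N) := basis_prefix Cc Ctc hb hbt GG LL
  (leq_ltn_trans il lb) (mono i il).
split.
- by have [] := pre _ (leqnn l.+1).
- by move=> i il; have [] := pre i il.
- move=> i il; apply/funext => v; apply/propext; split=> -[k [q [ki ks Gq ->]]].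
    have [_ E] := pre k (leq_trans ki il).
    by exists k, q; split=> //; [lia | apply/GG | rewrite E].
  have [ks' E] := pre k (leq_trans ki il).
  by exists k, q; split=> //; [apply/GG | rewrite E].
have bt_val i : (i < size bt)%N -> exists w : oneform R,
    convergent_form w /\ nu_form Ct w (nth 0%N bt i).
  move=> ib; have : Lambda Ct (nth 0%N bt i).
    apply/(basis_mem _ hbt); exists (nth 0%N bt i), 0%N; rewrite addn0; split=> //.
      exact: mem_nth.
    exists (cmon 1 0 0); first exact: conv2_cmon.
    by rewrite /nu_fun -[comp21 _ _]/(ev Ct _) cmon1; split=> //; rewrite ev0 // !ps1E oner_neq0.
  by move=> [w wv wd]; exists w.
pose pick i := if pselect (exists w : oneform R,
    convergent_form w /\ nu_form Ct w (nth 0%N bt i)) is left H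
  then projT1 (cid H) else zero_form R.
pose wst := mkseq (fun i => if (i <= l.+1)%N then nth (zero_form R) ws i else pick i) (size bt).
exists wst; split.
  split=> [|i ib]; first by rewrite size_mkseq.
  rewrite nth_mkseq //; case: ifP => il.
    by have [_ ->] := pre i il; exact: val_i.
  rewrite /pick; case: pselect => [H|[]]; last exact: bt_val.
  by case: (cid H).
have [lbt _] := pre _ (leqnn l.+1).
apply: (@eq_from_nth _ (zero_form R)) => [|i].
  by rewrite !size_takel ?size_mkseq ?ws_size.
rewrite size_takel ?size_mkseq // => il.
have ib := leq_trans il lbt.
by rewrite !nth_take // nth_mkseq // -ltnS il.
Qed.
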